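(* Let $g\in\mathcal{C}$ be an element of the Cremona-cubes group and let $\Phi\in\mathrm{Bir}(\mathbb{P}^3)$ be either $\Phi=g\circ c_3$ or $\Phi=c_3\circ g$. Let $\langle g\rangle\cdot\mathcal{E}=\{g^k\cdot e_i \mid k\in\mathbb{N},\ 1\le i\le 4\}$ be the orbit of the set of coordinate points $\mathcal{E}=\{e_1,\dots,e_4\}$ under $g$. Then $|\langle g\rangle\cdot\mathcal{E}|\in\{4,8,12\}$, and the following hold. (1) If $|\langle g\rangle\cdot\mathcal{E}|=8$, then $\Phi$ is integrable according to the algebraic entropy, with $d_n^{\Phi}\sim n^2$ as $n\to\infty$. Moreover $\Phi$ possesses a covariant net of quadrics (a covariant linear system of quadrics of projective dimension 2), and two functionally independent invariants, determined by the action on $\mathcal{R}\setminus(\langle g\rangle\cdot\mathcal{E})$. (2) If $|\langle g\rangle\cdot\mathcal{E}|=4$, then $\Phi$ is periodic in the sense that the sequence $d_n^\Phi$ is periodic, with $d_n^{\Phi}\in\{1,3\}$ for all $n$. Moreover $\Phi$ possesses a covariant linear system of quadrics of projective dimension 5, and three functionally independent invariants. (3) If $|\langle g\rangle\cdot\mathcal{E}|=12$, then $\Phi$ is non-integrable, with $d_n^{\Phi}\sim\varphi^{2n}$ as $n\to\infty$, where $\varphi=\frac{1+\sqrt5}{2}$ is the golden ratio. Moreover $\Phi$ exhibits late confinement, and it possesses a covariant pencil of desmic surfaces and one (nonconstant) invariant.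
   Context: Work over $\mathbb{C}$ with homogeneous coordinates $[x_1:x_2:x_3:x_4]$ on $\mathbb{P}^3$. The standard Cremona transformation is $c_3\colon\mathbb{P}^3\dashrightarrow\mathbb{P}^3$, $[x_1:\dots:x_4]\mapsto[1/x_1:\dots:1/x_4]$. Let $\mathcal{E}=\{e_1,\dots,e_4\}$ be the coordinate points, $\mathcal{P}=\{p_1,\dots,p_4\}$ and $\mathcal{Q}=\{q_1,\dots,q_4\}$ with $p_1=[1:-1:-1:-1]$, $p_2=[-1:1:-1:-1]$, $p_3=[-1:-1:1:-1]$, $p_4=[-1:-1:-1:1]$, $q_1=[1:-1:-1:1]$, $q_2=[-1:1:-1:1]$, $q_3=[1:1:-1:-1]$, $q_4=[1:1:1:1]$. Put $\mathcal{R}=\mathcal{E}\cup\mathcal{P}\cup\mathcal{Q}$. The Cremona-cubes group is $\mathcal{C}=\{g\in\mathrm{PGL}(4,\mathbb{C}) \mid g\cdot\mathcal{R}\subseteq\mathcal{R}\}$, acting on $\mathbb{P}^3$ by projectivities. Degrees and entropy. For $\Phi\in\mathrm{Bir}(\mathbb{P}^3)$ written as $[P_1:\dots:P_4]$ with homogeneous polynomials $P_i$ of the same degree without common factor, $d^\Phi=\deg P_i$, and $d_n^\Phi=d^{\Phi^n}$. The algebraic entropy is $S_\Phi=\lim_{n\to\infty}\frac1n\log d_n^\Phi$. $\Phi$ is integrable according to the algebraic entropy if $S_\Phi=0$, non-integrable if $S_\Phi>0$. The notation $d_n^\Phi\sim a_n$ means that $d_n^\Phi$ grows like $a_n$ up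 to a positive multiplicative constant, i.e. $d_n^\Phi/a_n$ tends to a positive constant. Covariance. A linear system $\Sigma$ of surfaces in $\mathbb{P}^3$ is covariant for $\Phi$ if there is a divisor $D\in\mathrm{Div}(\mathbb{P}^3)$ such that $W\mapsto(\Phi^{-1})^*W-D$ is a well defined automorphism of $\Sigma$; here, for $W=\{F=0\}$, $(\Phi^{-1})^*W$ is the divisor of $F\circ\Phi^{-1}$, with $\Phi^{-1}$ written with coprime homogeneous components. Invariants. An invariant of $\Phi$ is a rational function $R$ on $\mathbb{P}^3$ with $R\circ\Phi\equiv R$. Invariants $R_1,\dots,R_k$ are functionally independent if the Jacobian matrix of the map $(R_1,\dots,R_k)\colon\mathbb{P}^3\dashrightarrow\mathbb{C}^k$ has rank $k$ at a general point. In (1), ''determined by the action on $\mathcal{R}\setminus(\langle g\rangle\cdot\mathcal{E})$'' means that the pair of invariants can be chosen to depend only on the orbit $\langle g\rangle\cdot\mathcal{E}$ and on the permutation of the four remaining points of $\mathcal{R}$ induced by $g$ (for each of the two forms $g\circ c_3$, $c_3\circ g$ of $\Phi$). Desmic pencil. The pencil of desmic surfaces is the pencil of quartic surfaces that are singular (multiplicity at least 2) at all twelve points of $\mathcal{R}$; it is spanned by $(x_1^2-x_2^2)(x_3^2-x_4^2)$ and $(x_1^2-x_3^2)(x_2^2-x_4^2)$. Late confinement. The singularities of $\Phi$ are confined if every plane contracted by $\Phi$ is mapped to a point $m_1$ with a finite chain $\Phi(m_1)=m_2,\dots,\Phi(m_{K-1})=m_K$ of points such that $m_K$ is an indeterminacy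 point of $\Phi$ out of which a surface re-emerges (the exceptional divisor over $m_K$ is mapped by $\Phi$ onto a surface of $\mathbb{P}^3$). The confinement in case (3) is called late because the chains have length $K=3$, longer than the length $K=2$ occurring in the integrable case (1). *)

(* Defs.v *)
From HB Require Import structures.
From mathcomp Require Import all_boot all_order all_algebra.
From mathcomp Require Import complex mpoly.
From mathcomp Require Import boolp classical_sets functions cardinality reals.
From mathcomp Require Import topology normedtype sequences exp.

Set Implicit Arguments.
Unset Strict Implicit.
Unset Printing Implicit Defensive.

Import Order.TTheory GRing.Theory Num.Theory.
Import numFieldNormedType.Exports.

Local Open Scope classical_set_scope.
Local Open Scope ring_scope.

(* A point of P^3 is a line of K^4; [pt 0] is not a point. *)
Definition pt (K : fieldType) (v : 'cV[K]_4) : {vspace 'cV[K]_4} := <[v]>%VS.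

(* An element of PGL(4) is given by an invertible matrix; only its class
   modulo scalars matters for the action. *)
Definition pact (K : fieldType) (g : 'M[K]_4) (p : {vspace 'cV[K]_4}) :
  {vspace 'cV[K]_4} := (linfun (mulmx g) @: p)%VS.

Definition vec4 (K : fieldType) (a b c d : K) : 'cV[K]_4 :=
  \col_(i < 4) [:: a; b; c; d]`_i.

Definition coordE (K : fieldType) : seq 'cV[K]_4 :=
  [:: vec4 1 0 0 0; vec4 0 1 0 0; vec4 0 0 1 0; vec4 0 0 0 1].

Definition coordP (K : fieldType) : seq 'cV[K]_4 :=
  [:: vec4 1 (-1) (-1) (-1); vec4 (-1) 1 (-1) (-1);
      vec4 (-1) (-1) 1 (-1); vec4 (-1) (-1) (-1) 1].

Definition coordQ (K : fieldType) : seq 'cV[K]_4 :=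
  [:: vec4 1 (-1) (-1) 1; vec4 (-1) 1 (-1) 1;
      vec4 1 1 (-1) (-1); vec4 1 1 1 1].

Definition coordR (K : fieldType) : seq 'cV[K]_4 :=
  coordE K ++ coordP K ++ coordQ K.

Definition points (K : fieldType) (s : seq 'cV[K]_4) : set {vspace 'cV[K]_4} :=
  [set pt v | v in [set` s]].

Definition cremona_cubes (K : fieldType) (g : 'M[K]_4) : Prop :=
  g \in unitmx /\ pact g @` points (coordR K) `<=` points (coordR K).

Definition coord_orbit (K : fieldType) (g : 'M[K]_4) : set {vspace 'cV[K]_4} :=
  [set p | exists k, exists2 e, points (coordE K) e & p = iter k (pact g) e].

(* The action of [g] on the points of R outside the orbit of E, extended by
   the identity, so that it carries no other information on [g]. *)
Definition residual_action (K : fieldType) (g : 'M[K]_4) :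
    {vspace 'cV[K]_4} -> {vspace 'cV[K]_4} :=
  patch id (points (coordR K) `\` coord_orbit g) (pact g).

(* A rational self-map of P^3 is given by four forms of the same degree, not all
   zero, two such quadruples being identified when they are proportional. *)
Definition rmap (K : fieldType) := 4.-tuple {mpoly K[4]}.

Definition rmap_id (K : fieldType) : rmap K := [tuple 'X_i | i < 4].

Definition rmap_comp (K : fieldType) (F G : rmap K) : rmap K :=
  [tuple tnth F i \mPo G | i < 4].

Definition rmap_iter (K : fieldType) (n : nat) (F : rmap K) : rmap K :=
  iter n (rmap_comp F) (rmap_id K).

Definition rmap_eq (K : fieldType) (F G : rmap K) : Prop :=
  [/\ exists i, tnth F i != 0, exists i, tnth G i != 0 &
      forall i j, tnth F i * tnth G j = tnth F j * tnth G i].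

Definition linear_rmap (K : fieldType) (g : 'M[K]_4) : rmap K :=
  [tuple \sum_(j < 4) g i j *: 'X_j | i < 4].

(* [1/x_1 : ... : 1/x_4], multiplied by x_1 x_2 x_3 x_4. *)
Definition cremona (K : fieldType) : rmap K :=
  [tuple \prod_(j < 4 | j != i) 'X_j | i < 4].

Definition no_common_factor (K : fieldType) (s : seq {mpoly K[4]}) : Prop :=
  forall h, (forall p, p \in s -> exists q, p = q * h) ->
  exists c : K, h = c%:MP_[4].

Definition coprime_forms (K : fieldType) (d : nat) (F : rmap K) : Prop :=
  (forall i, tnth F i \is d.-homog) /\ no_common_factor F.

(* The degree of the coprime representatives of the rational map [F]; the junk
   value 0 is taken only if there is none. *)
Definition degree (K : fieldType) (F : rmap K) : nat :=
  xget 0%N [set d | exists2 G, coprime_forms d G & rmap_eq F G].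

Definition deg_seq (K : fieldType) (F : rmap K) (n : nat) : nat :=
  degree (rmap_iter n F).

Definition entropy_is (R : realType) (d : nat -> nat) (S : R) : Prop :=
  (fun n => ln (d n)%:R / n%:R : R) @ \oo --> S.

Definition integrable_entropy (R : realType) (d : nat -> nat) : Prop :=
  entropy_is d (0 : R).

Definition nonintegrable_entropy (R : realType) (d : nat -> nat) : Prop :=
  exists2 S : R, 0 < S & entropy_is d S.

Definition grows_like (R : realType) (d : nat -> nat) (a : nat -> R) : Prop :=
  exists2 c : R, 0 < c & (fun n => (d n)%:R / a n) @ \oo --> c.

Definition golden (R : realType) : R := (1 + Num.sqrt 5) / 2.

Definition periodic_seq (d : nat -> nat) : Prop :=
  exists2 T, (0 < T)%N & forall n, d (n + T)%N = d n.

Definition rmap_inverse (K : fieldType) (F G : rmap K) : Prop :=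
  rmap_eq (rmap_comp F G) (rmap_id K) /\ rmap_eq (rmap_comp G F) (rmap_id K).

(* A linear system of surfaces of degree [d] and projective dimension [r] is
   P(V) for V a space of forms of degree [d] with [\dim V = r.+1].  The divisor
   D is div(A) - div(B), and [f] induces on P(V) the automorphism
   W |-> (F^-1)^* W - D. *)
Definition covariant (K : fieldType) (F : rmap K) (d : nat)
    (V : {vspace dhomog 4 K d}) : Prop :=
  exists G e, [/\ rmap_inverse F G, coprime_forms e G &
    exists a b (A : dhomog 4 K a) (B : dhomog 4 K b) (f : 'End(dhomog 4 K d)),
      [/\ A != 0, B != 0, (f @: V)%VS = V &
          forall W : dhomog 4 K d, W \in V ->
            (val W \mPo G) * val B = val A * val (f W)]].

Definition singular_at (K : fieldType) (p : {mpoly K[4]}) (v : 'cV[K]_4) : Prop :=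
  p.@[v^~ 0] = 0 /\ forall i, (p^`M(i)).@[v^~ 0] = 0.

Definition desmic_system (K : fieldType) (V : {vspace dhomog 4 K 4}) : Prop :=
  forall W : dhomog 4 K 4,
    W \in V <-> (forall v, v \in coordR K -> singular_at (val W) v).

Record ratfun (K : fieldType) := RatFun {
  ratdeg : nat;
  ratnum : dhomog 4 K ratdeg;
  ratden : dhomog 4 K ratdeg;
  ratden_neq0 : ratden != 0
}.

Definition ratfun_invariant (K : fieldType) (F : rmap K) (r : ratfun K) : Prop :=
  val (ratden r) \mPo F != 0 /\
  (val (ratnum r) \mPo F) * val (ratden r) =
  val (ratnum r) * (val (ratden r) \mPo F).

Definition nonconstant (K : fieldType) (r : ratfun K) : Prop :=
  ~ exists c : K, ratnum r = c *: ratden r.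

(* Partial derivatives are taken in the homogeneous coordinates: by Euler's
   relation this Jacobian has the same rank as the one in an affine chart. *)
Definition ratfun_jacobian (K : fieldType) (k : nat) (r : 'I_k -> ratfun K)
    (v : 'cV[K]_4) : 'M[K]_(k, 4) :=
  \matrix_(j < k, i < 4)
    let A := val (ratnum (r j)) in let B := val (ratden (r j)) in
    (((A^`M(i)).@[v^~ 0] * B.@[v^~ 0] - A.@[v^~ 0] * (B^`M(i)).@[v^~ 0])
       / B.@[v^~ 0] ^+ 2).

Definition functionally_independent (K : fieldType) (k : nat)
    (r : 'I_k -> ratfun K) : Prop :=
  exists d (h : dhomog 4 K d), h != 0 /\
    forall v : 'cV[K]_4, (val h).@[v^~ 0] != 0 ->
      (forall j, (val (ratden (r j))).@[v^~ 0] != 0) /\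
      \rank (ratfun_jacobian r v) = k.

(* When the components of [F] are coprime, its indeterminacy points are the
   points where this vector is 0. *)
Definition rmap_eval (K : fieldType) (F : rmap K) (v : 'cV[K]_4) : 'cV[K]_4 :=
  \col_(i < 4) (tnth F i).@[v^~ 0].

(* The Zariski closure in P^3 has dimension at most 1, that is, codimension at
   least 2. *)
Definition small (K : fieldType) (S : set 'cV[K]_4) : Prop :=
  exists d e (p : dhomog 4 K d) (q : dhomog 4 K e),
    no_common_factor [:: val p; val q] /\
    forall v, S v -> (val p).@[v^~ 0] = 0 /\ (val q).@[v^~ 0] = 0.

Definition plane_image (K : fieldType) (F : rmap K) (l : 'rV[K]_4) :
    set 'cV[K]_4 :=
  [set u | u != 0 /\ exists2 v, l *m v = 0 & u = rmap_eval F v].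

(* [F_i (m + t w)], a polynomial in t. *)
Definition along (K : fieldType) (F : rmap K) (m w : 'cV[K]_4) (i : 'I_4) :
    {poly K} :=
  mmap polyC (fun j => (m j 0)%:P + w j 0 *: 'X) (tnth F i).

(* The image of the exceptional divisor over [m]: the lowest terms of [F] at
   [m], here of order [mu], evaluated at the tangent directions [w]. *)
Definition exceptional_image (K : fieldType) (F : rmap K) (m : 'cV[K]_4) :
    set 'cV[K]_4 :=
  [set u | u != 0 /\ exists mu : nat,
     (forall w i (k : nat), (k < mu)%N -> (along F m w i)`_k = 0) /\
     exists w, u = \col_(i < 4) (along F m w i)`_mu].

(* Every contracted plane is mapped to a point m_1, whose images m_2, ..., m_n
   are defined, up to an indeterminacy point m_n out of which a surface
   re-emerges. *)
Definition confined_in (K : fieldType) (n : nat) (F : rmap K) : Prop :=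
  forall l : 'rV[K]_4, l != 0 -> small (plane_image F l) ->
  exists m : nat -> 'cV[K]_4,
    [/\ forall k, (1 <= k <= n)%N -> m k != 0,
        forall u, plane_image F l u -> pt u = pt (m 1%N),
        forall k, (1 <= k < n)%N -> pt (rmap_eval F (m k)) = pt (m k.+1),
        rmap_eval F (m n) = 0 &
        ~ small (exceptional_image F (m n))].

(* Chains of length 3, against 2 in the integrable case. *)
Definition late_confinement (K : fieldType) (F : rmap K) : Prop :=
  exists d G, [/\ coprime_forms d G, rmap_eq F G & confined_in 3 G].

(* [true] is g o c_3 and [false] is c_3 o g. *)
Definition cremona_cubes_map (K : fieldType) (s : bool) (g : 'M[K]_4) : rmap K :=
  if s then rmap_comp (linear_rmap g) (cremona K)
  else rmap_comp (cremona K) (linear_rmap g).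

(* Main.v *)
Require Import Defs.
From HB Require Import structures.
From mathcomp Require Import all_boot all_order all_fingroup all_algebra.
From mathcomp Require Import complex mpoly.
From mathcomp Require Import boolp classical_sets functions cardinality reals.
From mathcomp Require Import topology normedtype sequences exp realfun.
From mathcomp Require Import ring lra zify ssrZ.

(** Let [E], [P], [Q] be the three tetrahedra of four points, and [X] the product of
    the coordinates.  The transformation [c_3] contracts the coordinate planes to
    the points of [E], blows these points up to the opposite planes, and fixes the
    eight points of [P] and [Q].  Two points of different tetrahedra are collinear
    with a point of the third one, two points of the same tetrahedron with no other
    point of the configuration; hence an element [g] of the group permutes the
    tetrahedra ([cubes_moves]), and the orbit of [E] consists of one, two or three
    of them ([orbit_card]).

    Degrees.  The components of an iterate span a linear system of some degree [d]
    with one multiplicity for each tetrahedron.  Composition with [g] permutes the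
    multiplicities, and composition with [c_3] replaces [d] and the multiplicity
    [m] at [E] by [3d - 4m] and [2d - 3m], and keeps the other two
    ([state_cremona]).  That no further factor splits off is expressed by
    [primitive], a form of coprimality which passes through both substitutions
    because only the primality of the coordinates is needed.  The degrees are
    therefore given by a linear recurrence ([deg_seq_degrees]), with solution
    1, 3, 1, 3 and so on if [E] is fixed, [2n^2 + 1] if [E] is exchanged with
    another tetrahedron, and [(8 L - 10 - (-1)^n) / 5] with the Lucas number [L] of
    index [2n] if the three are permuted cyclically.

    Covariant systems and invariants.  Up to a scalar, [g] is a signed permutation
    of the coordinates or the product of such a matrix with the reflection that
    exchanges [E] with [P] or with [Q] ([moves_forms]).  It follows that [g]
    permutes up to sign the products of two coordinates if [E] is fixed, the three
    quadrics [x_k x_l + x_i x_j] (with a minus for [Q]) if [E] is exchanged with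
    [P] or [Q], and in every case the three desmic quartics that are products of
    planes.  On each of these families [c_3] acts in the same way, up to a power
    of [X].  They span the covariant systems, and symmetric functions of their
    squares, or of the squares of the coordinates if [E] is fixed, give the
    invariants; the Jacobian is evaluated at one integer point.  A quartic singular
    at the twelve points has no exponent above 2 by its singularities at [E], and
    those at [P] and [Q], summed over all sign changes, make it even in each
    variable and leave a space of dimension two ([desmic_pencil_system]).

    Confinement.  If a plane is not a coordinate plane, its image under [c_3] has an
    equation that divides every form vanishing on it, so that the plane is not
    contracted ([cremona_image_big]).  A coordinate plane goes to a point of [E];
    when [g] permutes the tetrahedra cyclically, this point visits the two other
    ones, where [c_3] does nothing, and comes back to [E] at the third step.
    There the exceptional divisor goes to a coordinate plane by a plane quadratic
    Cremona transformation, and its image is again a surface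
    ([exceptional_big]). *)

Set Implicit Arguments.
Unset Strict Implicit.
Unset Printing Implicit Defensive.

Import Order.TTheory GRing.Theory Num.Theory.
Import numFieldNormedType.Exports.

Local Open Scope classical_set_scope.
Local Open Scope ring_scope.

Notation o0 := (@Ordinal 4 0 isT).
Notation o1 := (@Ordinal 4 1 isT).
Notation o2 := (@Ordinal 4 2 isT).
Notation o3 := (@Ordinal 4 3 isT).

Lemma ord4P (P : 'I_4 -> Prop) : P o0 -> P o1 -> P o2 -> P o3 -> forall i, P i.
Proof.
move=> P0 P1 P2 P3 [[|[|[|[|//]]]] lt_i].
- by rewrite (_ : Ordinal lt_i = o0) //; apply/val_inj.
- by rewrite (_ : Ordinal lt_i = o1) //; apply/val_inj.
- by rewrite (_ : Ordinal lt_i = o2) //; apply/val_inj.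
- by rewrite (_ : Ordinal lt_i = o3) //; apply/val_inj.
Qed.

Lemma big4 (T : Type) (idx : T) (op : Monoid.law idx) (F : 'I_4 -> T) :
  \big[op/idx]_i F i = op (op (op (F o0) (F o1)) (F o2)) (F o3).
Proof.
rewrite !big_ord_recr big_ord0 /= Monoid.mul1m.
by do !congr (op _ _); congr F; apply/val_inj.
Qed.

(** * Composition of rational maps *)

Section Substitution.

Variable K : fieldType.
Local Notation M := {mpoly K[4]}.
Implicit Types (p q r u : M) (F G : rmap K) (g h : 'M[K]_4) (i j : 'I_4).

Lemma tnth_comp F G i : tnth (rmap_comp F G) i = tnth F i \mPo G.
Proof. by rewrite tnth_mktuple. Qed.

Lemma comp_mpolyA p F G : (p \mPo F) \mPo G = p \mPo rmap_comp F G.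
Proof.
rewrite (comp_mpolyE p F) (comp_mpolyE p) raddf_sum; apply: eq_bigr => m _.
rewrite /= comp_mpolyZ rmorph_prod; congr (_ *: _); apply: eq_bigr => i _.
by rewrite rmorphXn tnth_comp.
Qed.

Lemma rmap_compA F G H : rmap_comp (rmap_comp F G) H = rmap_comp F (rmap_comp G H).
Proof. by apply: eq_from_tnth => i; rewrite !tnth_comp comp_mpolyA. Qed.

Lemma comp_mpolyXt i F : 'X_i \mPo F = tnth F i.
Proof. by rewrite comp_mpolyXU -tnth_nth. Qed.

Lemma rmap_comp_idl F : rmap_comp (rmap_id K) F = F.
Proof. by apply: eq_from_tnth => i; rewrite tnth_comp tnth_mktuple comp_mpolyXt. Qed.

Lemma rmap_comp_idr F : rmap_comp F (rmap_id K) = F.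
Proof. by apply: eq_from_tnth => i; rewrite tnth_comp comp_mpoly_id. Qed.

(** Homogeneity in the form in which it is used: a common factor of the
    substituted polynomials comes out. *)
Lemma comp_mpoly_scale d p u F G : p \is d.-homog ->
  (forall i, tnth G i = u * tnth F i) -> p \mPo G = u ^+ d * (p \mPo F).
Proof.
move=> /dhomogP hp eFG; rewrite !comp_mpolyE mulr_sumr !big_seq.
apply: eq_bigr => m /hp /= <-; rewrite -scalerAr; congr (_ *: _).
rewrite mdegE -prodrXr -big_split; apply: eq_bigr => i _.
by rewrite eFG exprMn.
Qed.

Lemma dhomog_comp d e p F : p \is d.-homog -> (forall i, tnth F i \is e.-homog) ->
  p \mPo F \is (d * e)%N.-homog.
Proof.
move=> /dhomogP hp hF; rewrite comp_mpolyE big_seq; apply: rpred_sum => m /hp /= <-.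
apply: rpredZ; rewrite mdegE big_distrl /=.
pose dt := [tuple (m i * e)%N | i < 4]; pose mt := [tuple tnth F i ^+ m i | i < 4].
have : \prod_(q <- mt) q \is (\sum_(k <- dt) k)%N.-homog.
  by apply/dhomog_prod => i; rewrite !tnth_mktuple mulnC; apply/dhomogMn/hF.
rewrite !big_tuple (eq_bigr (fun i => tnth F i ^+ m i)) => [|i _]; last first.
  by rewrite tnth_mktuple.
rewrite [X in X.-homog](eq_bigr (fun i => m i * e)%N) => [hm|i _]; last first.
  by rewrite tnth_mktuple.
exact: hm.
Qed.

Lemma meval_comp p F (v : 'cV[K]_4) :
  (p \mPo F).@[v^~ 0] = p.@[(rmap_eval F v)^~ 0].
Proof. by rewrite comp_mpoly_meval; apply: meval_eq => i; rewrite mxE. Qed.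

Lemma meval_scale d p (a : K) (v : 'cV[K]_4) : p \is d.-homog ->
  p.@[(a *: v)^~ 0] = a ^+ d * p.@[v^~ 0].
Proof.
move=> /dhomogP hp; rewrite !mevalE mulr_sumr !big_seq.
apply: eq_bigr => m /hp /= <-; rewrite mulrCA; congr (_ * _).
rewrite mdegE -prodrXr -big_split; apply: eq_bigr => i _.
by rewrite mxE exprMn.
Qed.

(** * Linear substitutions *)

Lemma tnth_linear g i : tnth (linear_rmap g) i = \sum_j g i j *: 'X_j.
Proof. by rewrite tnth_mktuple. Qed.

Lemma coord_homog i : ('X_i : M) \is 1.-homog.
Proof. by rewrite dhomogX /= mdeg1. Qed.

Lemma linear_homog g i : tnth (linear_rmap g) i \is 1.-homog.
Proof.
rewrite tnth_linear; apply: rpred_sum => j _; apply: rpredZ.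
exact: coord_homog.
Qed.

Lemma linear_eval g v : rmap_eval (linear_rmap g) v = g *m v.
Proof.
apply/matrixP => i j; rewrite ord1 !mxE tnth_linear raddf_sum.
by apply: eq_bigr => k _; rewrite /= mevalZ mevalXU.
Qed.

Lemma linear_comp g h :
  rmap_comp (linear_rmap g) (linear_rmap h) = linear_rmap (g *m h).
Proof.
apply: eq_from_tnth => i; rewrite tnth_comp !tnth_linear raddf_sum /=.
under eq_bigr => j _ do rewrite comp_mpolyZ comp_mpolyXt tnth_linear scaler_sumr.
rewrite exchange_big; apply: eq_bigr => k _; rewrite mxE scaler_suml.
by apply: eq_bigr => j _; rewrite scalerA.
Qed.

Lemma linear1 : linear_rmap 1%:M = rmap_id K.
Proof.
apply: eq_from_tnth => i; rewrite tnth_linear tnth_mktuple (bigD1 i) //= big1.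
  by rewrite addr0 mxE eqxx scale1r.
by move=> j neq; rewrite mxE eq_sym (negbTE neq) scale0r.
Qed.

Definition msub g p : M := p \mPo linear_rmap g.

HB.instance Definition _ g := GRing.LRMorphism.copy (msub g) (comp_mpoly (linear_rmap g)).

Lemma msub1 p : msub 1%:M p = p.
Proof. by rewrite /msub linear1 comp_mpoly_id. Qed.

Lemma msubM g h p : msub h (msub g p) = msub (g *m h) p.
Proof. by rewrite /msub comp_mpolyA linear_comp. Qed.

Lemma msubK g : g \in unitmx -> cancel (msub g) (msub (invmx g)).
Proof. by move=> ug p; rewrite msubM mulmxV ?msub1. Qed.

Lemma msubKV g : g \in unitmx -> cancel (msub (invmx g)) (msub g).
Proof. by move=> ug p; rewrite msubM mulVmx ?msub1. Qed.

Lemma msub_eq0 g p : g \in unitmx -> (msub g p == 0) = (p == 0).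
Proof. by move=> ug; rewrite -(inj_eq (can_inj (msubK ug)) p 0) raddf0. Qed.

Lemma msub_homog g d p : p \is d.-homog -> msub g p \is d.-homog.
Proof. by rewrite -{2}[d]muln1 => hp; apply: dhomog_comp => // i; exact: linear_homog. Qed.

Lemma msub_scale a g d p : p \is d.-homog -> msub (a *: g) p = a ^+ d *: msub g p.
Proof.
move=> hp; rewrite /msub (comp_mpoly_scale (u := a%:MP) (F := linear_rmap g) hp).
  by rewrite -rmorphXn mul_mpolyC.
move=> i; rewrite mul_mpolyC !tnth_linear scaler_sumr; apply: eq_bigr => j _.
by rewrite mxE scalerA.
Qed.

Lemma meval_msub g p (v : 'cV[K]_4) : (msub g p).@[v^~ 0] = p.@[(g *m v)^~ 0].
Proof. by rewrite meval_comp linear_eval. Qed.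

(** * Divisibility by the coordinates *)

Definition mdvd p q := exists u, q = p * u.

Lemma mdvd_mulr p q u : mdvd p q -> mdvd p (q * u).
Proof. by move=> [v ->]; exists (v * u); rewrite mulrA. Qed.

Lemma mdvd_mull p q u : mdvd p q -> mdvd p (u * q).
Proof. by rewrite mulrC; apply: mdvd_mulr. Qed.

Lemma mdvd_add p q u : mdvd p q -> mdvd p u -> mdvd p (q + u).
Proof. by move=> [a ->] [b ->]; exists (a + b); rewrite mulrDr. Qed.

Lemma mdvd_sum (I : Type) (r : seq I) (P : pred I) (E : I -> M) p :
  (forall x : I, P x -> mdvd p (E x)) -> mdvd p (\sum_(x <- r | P x) E x).
Proof.
move=> hE; apply: big_ind => //; first by exists 0; rewrite mulr0.
by move=> *; apply: mdvd_add.
Qed.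

Lemma mdvd_expl p q (a b : nat) : (b <= a)%N -> mdvd (p ^+ a) q -> mdvd (p ^+ b) q.
Proof. by move=> le_ba [u ->]; rewrite -(subnKC le_ba) exprD -mulrA; eexists. Qed.

Definition xkill i : rmap K := [tuple if j == i then 0 else 'X_j | j < 4].

Lemma mdvd_subM u p p' q q' :
  mdvd u (p - p') -> mdvd u (q - q') -> mdvd u (p * q - p' * q').
Proof.
move=> [a ea] [b eb]; exists (a * q + p' * b).
have -> : p * q - p' * q' = (p - p') * q + p' * (q - q') by ring.
by rewrite ea eb; ring.
Qed.

(** Substituting congruent arguments gives congruent values; this bounds the
    order of vanishing of a composite from below, and reduces a polynomial
    modulo a linear form. *)
Lemma comp_mpoly_congr u p F G :
  (forall i, mdvd u (tnth F i - tnth G i)) -> mdvd u ((p \mPo F) - (p \mPo G)).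
Proof.
move=> hFG; rewrite !comp_mpolyE -sumrB; apply: mdvd_sum => m _.
rewrite -scalerBr -mul_mpolyC; apply: mdvd_mull.
elim/big_rec2: _ => [|i q r _ IH]; first by rewrite subrr; exists 0; rewrite mulr0.
apply: mdvd_subM IH; elim: (m i) => [|k IH].
  by rewrite !expr0 subrr; exists 0; rewrite mulr0.
by rewrite !exprS; apply: mdvd_subM.
Qed.

Lemma mod_coord i p : mdvd 'X_i (p - (p \mPo xkill i)).
Proof.
rewrite -{1}[p]comp_mpoly_id; apply: comp_mpoly_congr => j.
rewrite !tnth_mktuple; case: eqP => [->|_].
  by exists 1; rewrite subr0 mulr1.
by exists 0; rewrite subrr mulr0.
Qed.

Lemma coord_dvdP i p : mdvd 'X_i p <-> p \mPo xkill i = 0.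
Proof.
split=> [[q ->]|p0]; last by have := mod_coord i p; rewrite p0 subr0.
by rewrite rmorphM /= comp_mpolyXt tnth_mktuple eqxx mul0r.
Qed.

Lemma coord_prime i p q : mdvd 'X_i (p * q) -> mdvd 'X_i p \/ mdvd 'X_i q.
Proof.
move/coord_dvdP; rewrite rmorphM /= => /eqP; rewrite mulf_eq0.
by case/orP=> /eqP /coord_dvdP; [left | right].
Qed.

Lemma coord_neq0 i : 'X_i != 0 :> M.
Proof. by rewrite -msize_poly_eq0 msizeX. Qed.

Lemma coord_nonconstant i (c : K) : 'X_i <> c%:MP :> M.
Proof.
move/(congr1 (mcoeff U_(i)%MM))/eqP.
by rewrite mcoeffXU mcoeffC mnm1_eq0 mulr0 eqxx oner_eq0.
Qed.

(** The coordinate is prime, and is taken out of both sides one at a time. *)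
Lemma coord_gauss i k p q :
  ~ mdvd 'X_i q -> mdvd ('X_i ^+ k) (p * q) -> mdvd ('X_i ^+ k) p.
Proof.
move=> ndvd; elim: k p => [|k IH] p hpq; first by exists p; rewrite mul1r.
have [p' ep] : mdvd 'X_i p.
  have /coord_prime[] // : mdvd 'X_i (p * q).
  by case: hpq => u ->; rewrite exprS -mulrA; eexists.
case: hpq => u; rewrite ep exprS -!mulrA => /(mulfI (coord_neq0 i)) eu.
by have [|v ->] := IH p'; [exists u | exists v; rewrite mulrA].
Qed.

Lemma coord_ndvd i j : i != j -> ~ mdvd 'X_i ('X_j : M).
Proof.
move=> neq /coord_dvdP; rewrite comp_mpolyXt tnth_mktuple eq_sym (negbTE neq).
by apply/eqP/coord_neq0.
Qed.

Lemma ndvd_exp i k p : ~ mdvd 'X_i p -> ~ mdvd 'X_i (p ^+ k).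
Proof.
move=> nd; elim: k => [|k IH]; last by rewrite exprS => /coord_prime[].
rewrite expr0 => /coord_dvdP; rewrite rmorph1; exact/eqP/oner_neq0.
Qed.

Definition xprod : M := \prod_i 'X_i.

Lemma xprodE : xprod = 'X_o0 * 'X_o1 * 'X_o2 * 'X_o3.
Proof. exact: big4. Qed.

Lemma xprod_neq0 : xprod != 0.
Proof. by apply/prodf_neq0 => i _; apply: coord_neq0. Qed.

Lemma xprod_homog : xprod \is 4.-homog.
Proof.
by rewrite xprodE -[4%N]/(1 + 1 + 1 + 1)%N; do !apply: dhomogM; apply: coord_homog.
Qed.

(** The powers of distinct coordinates are collected one coordinate at a time,
    each being prime and not dividing the previous ones. *)
Lemma xprod_dvd k p : (forall i, mdvd ('X_i ^+ k) p) -> mdvd (xprod ^+ k) p.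
Proof.
move=> hp; rewrite xprodE; have [p0 e0] := hp o0.
have step i q u : (~ mdvd 'X_i q) -> p = q ^+ k * u -> exists v, p = (q * 'X_i) ^+ k * v.
  move=> nd ep; have [|v ev] := coord_gauss (ndvd_exp (k := k) nd) (p := u) (k := k).
    by rewrite mulrC -ep.
  by exists v; rewrite ep ev exprMn mulrA.
have [|p1 e1] := step o1 _ _ _ e0; first exact: coord_ndvd.
have [|p2 e2] := step o2 _ _ _ e1; first by move=> /coord_prime[]; apply: coord_ndvd.
have [|p3 e3] := step o3 _ _ _ e2; last by exists p3.
by move=> /coord_prime[/coord_prime[]|]; apply: coord_ndvd.
Qed.

(** * The standard Cremona transformation *)

Local Notation c3 := (cremona K).

Lemma tnth_cremona i : tnth c3 i = \prod_(j | j != i) 'X_j.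
Proof. by rewrite tnth_mktuple. Qed.

Lemma cremona_coord i : 'X_i * tnth c3 i = xprod.
Proof. by rewrite tnth_cremona /xprod [RHS](bigD1 i). Qed.

Lemma cremonaE :
  (tnth c3 o0 = 'X_o1 * 'X_o2 * 'X_o3) * (tnth c3 o1 = 'X_o0 * 'X_o2 * 'X_o3) *
  (tnth c3 o2 = 'X_o0 * 'X_o1 * 'X_o3) * (tnth c3 o3 = 'X_o0 * 'X_o1 * 'X_o2).
Proof.
by do !split; rewrite tnth_cremona big_mkcond big4 /= ?mul1r ?mulr1.
Qed.

Lemma cremona_homog i : tnth c3 i \is 3.-homog.
Proof.
by move: i; apply: ord4P; rewrite cremonaE -[3%N]/(1 + 1 + 1)%N;
  do !apply: dhomogM; apply: coord_homog.
Qed.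

(** [c_3] is an involution of space; on forms this costs a power of the product
    of the coordinates, that is, of the contracted planes. *)
Lemma cremona_cremona i : tnth c3 i \mPo c3 = xprod ^+ 2 * 'X_i.
Proof.
by move: i; apply: ord4P; rewrite cremonaE !rmorphM /= !comp_mpolyXt !cremonaE xprodE; ring.
Qed.

Lemma comp_cremonaK d p : p \is d.-homog ->
  (p \mPo c3) \mPo c3 = xprod ^+ (2 * d) * p.
Proof.
move=> hp; rewrite comp_mpolyA exprM (comp_mpoly_scale (u := xprod ^+ 2) (F := rmap_id K) hp).
  by rewrite comp_mpoly_id.
by move=> i; rewrite tnth_comp cremona_cremona tnth_mktuple.
Qed.

Lemma xprod_cremona : xprod \mPo c3 = xprod ^+ 3.
Proof.
by rewrite [in LHS]xprodE !rmorphM /= !comp_mpolyXt !cremonaE xprodE; ring.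
Qed.

Lemma cremona_comp_homog d p : p \is d.-homog -> p \mPo c3 \is (d * 3)%N.-homog.
Proof. by move=> hp; apply: dhomog_comp => //; apply: cremona_homog. Qed.

Lemma cremona_comp_eq0 d p : p \is d.-homog -> p \mPo c3 = 0 -> p = 0.
Proof.
move=> hp p0; have /eqP := comp_cremonaK hp.
rewrite p0 raddf0 eq_sym mulf_eq0 expf_eq0 (negbTE xprod_neq0) andbF.
by move/eqP.
Qed.

End Substitution.

Section Vanishing.

Variable K : fieldType.
Local Notation M := {mpoly K[4]}.
Local Notation c3 := (cremona K).
Local Notation X := (xprod K).
Implicit Types (p q r u a t : M) (F G w : rmap K) (g h : 'M[K]_4) (v : 'cV[K]_4).
Implicit Types (i j : 'I_4).

(** * Order of vanishing *)

Definition vline a v t w : rmap K := [tuple a * (v i 0)%:MP_[4] + t * tnth w i | i < 4].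

(** The order of vanishing at the point [v] is read off along every line
    through [v], with polynomial coefficients; being quantified over all of
    them it can be transported along a substitution at once. *)
Definition ordge v k p := forall a t w, mdvd (t ^+ k) (p \mPo vline a v t w).

Lemma ordge0 v p : ordge v 0 p.
Proof. by move=> a t w; rewrite expr0; exists (p \mPo vline a v t w); rewrite mul1r. Qed.

Lemma ordge_mull v k p u : ordge v k p -> ordge v k (u * p).
Proof. by move=> hp a t w; rewrite rmorphM; apply: mdvd_mull; apply: hp. Qed.

Lemma ordge_msub g v k p : ordge (g *m v) k p -> ordge v k (msub g p).
Proof.
move=> hp a t w; rewrite /msub comp_mpolyA.
suff -> : rmap_comp (linear_rmap g) (vline a v t w) =
          vline a (g *m v) t (rmap_comp (linear_rmap g) w) by [].
apply: eq_from_tnth => i; rewrite tnth_comp !tnth_mktuple !raddf_sum mxE raddf_sum.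
rewrite !mulr_sumr -big_split; apply: eq_bigr => j _ /=.
rewrite !comp_mpolyZ !comp_mpolyXt tnth_mktuple mpolyCM -!mul_mpolyC; ring.
Qed.

Lemma ordge_msubE g v k p : g \in unitmx ->
  ordge v k (msub g p) <-> ordge (g *m v) k p.
Proof.
move=> ug; split; last exact: ordge_msub.
by rewrite -{1}[v](mulKmx ug) => /ordge_msub; rewrite (msubK ug).
Qed.

Lemma ordge_scale (c : K) v k p : c != 0 -> ordge (c *: v) k p <-> ordge v k p.
Proof.
suff imp (e : K) z : e != 0 -> ordge (e *: z) k p -> ordge z k p.
  move=> c0; split; first exact: imp.
  by rewrite -{1}[v](scalerK c0); apply: imp; rewrite invr_eq0.
move=> e0 hp a t w.
suff -> : vline a z t w = vline (a * (e^-1)%:MP) (e *: z) t w by [].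
apply: eq_from_tnth => i; rewrite !tnth_mktuple mxE mpolyCM mulrA -(mulrA a) -mpolyCM.
by rewrite mulVf // mpolyC1 mulr1.
Qed.

Definition cvec i : 'cV[K]_4 := delta_mx i 0.

Lemma mdvd_coordX i k p m : mdvd ('X_i ^+ k) p -> p@_m != 0 -> (k <= m i)%N.
Proof.
move=> [q ->]; rewrite mulrC mpolyXn -mcoeff_msupp (perm_mem (msuppMX _ _)).
case/mapP=> m' _ ->; rewrite mnmDE mulmnE mnm1E eqxx mul1n.
exact: leq_addr.
Qed.

(** Composition with the Cremona map sends the monomial of exponents [m] to the
    one of exponents [d - m]: the order of vanishing at a coordinate point, the
    least value of [d - m i], becomes divisibility by the coordinate. *)
Lemma ordge_coordP d i k p : p \is d.-homog ->
  ordge (cvec i) k p <-> mdvd ('X_i ^+ k) (p \mPo c3).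
Proof.
move=> /dhomogP hp; split=> [/(_ (tnth c3 i) 'X_i
    [tuple if j == i then 0 else \prod_(l | (l != j) && (l != i)) 'X_l | j < 4])|].
  congr (mdvd _ (_ \mPo _)); apply: eq_from_tnth => j.
  rewrite !tnth_mktuple mxE eqxx andbT; case: (eqVneq j i) => [->|neq].
    by rewrite mpolyC1 mulr1 mulr0 addr0.
  by rewrite mpolyC0 mulr0 add0r [RHS](bigD1 i) // eq_sym.
pose f (m : 'X_{1..4}) := [multinom (mdeg m - m j)%N | j < 4].
have monE (m : 'X_{1..4}) : \prod_j tnth c3 j ^+ m j = 'X_[f m] :> M.
  have e0 : (mdeg m - m o0 = m o1 + m o2 + m o3)%N by rewrite mdegE big4 /=; lia.
  have e1 : (mdeg m - m o1 = m o0 + m o2 + m o3)%N by rewrite mdegE big4 /=; lia.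
  have e2 : (mdeg m - m o2 = m o0 + m o1 + m o3)%N by rewrite mdegE big4 /=; lia.
  have e3 : (mdeg m - m o3 = m o0 + m o1 + m o2)%N by rewrite mdegE big4 /=; lia.
  rewrite big4 /= !cremonaE [RHS]mpolyXE_id big4 /= !mnmE e0 e1 e2 e3.
  rewrite !exprMn !exprD; ring.
have finj m m' : m \in msupp p -> m' \in msupp p -> f m = f m' -> m = m'.
  move=> /hp /= dm /hp /= dm' /mnmP ef; apply/mnmP => j.
  have := ef j; rewrite !mnmE dm dm' => ej.
  have lej (n : 'X_{1..4}) : (n j <= mdeg n)%N by rewrite mdegE (bigD1 j) //= leq_addr.
  by rewrite -(subKn (lej m)) -(subKn (lej m')) dm dm' ej.
have coefE m : m \in msupp p -> (p \mPo c3)@_(f m) = p@_m.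
  move=> mp; rewrite comp_mpolyE raddf_sum (bigD1_seq m) ?msupp_uniq //=.
  rewrite monE mcoeffZ mcoeffX eqxx mulr1 big_seq_cond big1 ?addr0 // => m' /andP[m'p neq].
  rewrite monE mcoeffZ mcoeffX; case: eqP => [/finj e|_]; last by rewrite mulr0.
  by rewrite e // eqxx in neq.
move=> hdvd a t w; rewrite comp_mpolyE big_seq; apply: mdvd_sum => m mp.
rewrite -mul_mpolyC; apply: mdvd_mull; rewrite (bigD1 i) //=; apply: mdvd_mull.
have ki : (k <= f m i)%N.
  by apply: mdvd_coordX hdvd _; rewrite coefE // -mcoeff_msupp.
apply: mdvd_expl ki _; rewrite mnmE mdegE (bigD1 i) //= addKn.
rewrite (eq_bigr (fun j => t ^+ m j * tnth w j ^+ m j)).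
  by rewrite big_split /= prodrXr; eexists.
move=> j neq; rewrite tnth_mktuple mxE (negbTE neq) /= mpolyC0 mulr0 add0r.
by rewrite exprMn.
Qed.

(** Points whose coordinates are all [1] or [-1]: the fixed points of the
    Cremona map among the points of the configuration. *)
Definition sign_vec v := forall i, v i 0 ^+ 2 = 1.

Lemma sign_vec_neq0 v i : sign_vec v -> v i 0 != 0.
Proof.
by move=> /(_ i) e; apply/eqP => v0; move/eqP: e; rewrite v0 expr0n /= eq_sym oner_eq0.
Qed.

Lemma ordge_congr v k p a t F : ordge v k p ->
  (forall i, mdvd t (tnth F i - a * (v i 0)%:MP)) -> mdvd (t ^+ k) (p \mPo F).
Proof.
move=> hp /fin_all_exists[u eu].
rewrite (_ : F = vline a v t [tuple u i | i < 4]); first exact: hp.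
by apply: eq_from_tnth => i; rewrite !tnth_mktuple -eu addrC subrK.
Qed.

(** The point [v] is fixed by [c_3], and [c_3] maps a line through it with
    parameter [t] to the multiple [a ^+ 3 * prod v] of [v] modulo [t]. *)
Lemma ordge_cremona v k p : sign_vec v -> ordge v k p -> ordge v k (p \mPo c3).
Proof.
move=> sv hp a t w; rewrite comp_mpolyA.
apply: (ordge_congr (a := a ^+ 3 * (\prod_i v i 0)%:MP) hp) => i.
pose V : rmap K := [tuple a * (v j 0)%:MP | j < 4].
have <- : tnth c3 i \mPo V = a ^+ 3 * (\prod_i v i 0)%:MP * (v i 0)%:MP.
  rewrite big4 /=; have e j : (v j 0)%:MP_[4] ^+ 2 = 1 by rewrite -rmorphXn sv.
  move: i; apply: ord4P; rewrite cremonaE !rmorphM /= !comp_mpolyXt !tnth_mktuple.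
  - by rewrite -[LHS]mul1r -(e o0); ring.
  - by rewrite -[LHS]mul1r -(e o1); ring.
  - by rewrite -[LHS]mul1r -(e o2); ring.
  - by rewrite -[LHS]mul1r -(e o3); ring.
rewrite tnth_comp; apply: comp_mpoly_congr => j; rewrite !tnth_mktuple.
by exists (tnth w j); rewrite addrAC subrr add0r.
Qed.

(** Along the constant direction [0] only the value at the point is left. *)
Lemma ordge1_eval v p : ordge v 1 p -> p.@[v^~ 0] = 0.
Proof.
move=> /(_ 1 'X_o0 [tuple 0 | i < 4]); rewrite expr1 => /coord_dvdP.
set F := vline _ _ _ _; have -> : p \mPo F = (p.@[v^~ 0])%:MP.
  rewrite comp_mpolyE mevalE rmorph_sum; apply: eq_bigr => m _ /=.
  rewrite mpolyCM mul_mpolyC rmorph_prod; congr (_ *: _); apply: eq_bigr => i _.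
  by rewrite !tnth_mktuple mulr0 addr0 mul1r rmorphXn.
by rewrite comp_mpolyC => /eqP; rewrite mpolyC_eq0 => /eqP.
Qed.

Lemma coord_frame v : v o0 0 != 0 -> exists2 A : 'M[K]_4, A \in unitmx & A *m cvec o0 = v.
Proof.
move=> v0; pose u := v - cvec o0; pose f : 'rV[K]_4 := delta_mx 0 o0.
have fe : f *m cvec o0 = 1%:M.
  by rewrite /f /cvec mul_delta_mx; apply/matrixP => i j; rewrite !mxE !ord1 !eqxx.
have fu : f *m u = (v o0 0 - 1)%:M.
  rewrite mulmxBr fe -rowE [row _ _]mx11_scalar !mxE.
  by rewrite raddfB.
exists (1%:M + u *m f); last first.
  by rewrite mulmxDl mul1mx -mulmxA fe mulmx1 addrC subrK.
suff /mulmx1_unit[] : (1%:M + u *m f) *m (1%:M - (v o0 0)^-1 *: (u *m f)) = 1%:M by [].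
have: (u *m f) *m (u *m f) = (v o0 0 - 1) *: (u *m f).
  by rewrite mulmxA -(mulmxA u) fu mul_mx_scalar -scalemxAl.
move: (u *m f) => P PP; rewrite mulmxBr mulmx1 -scalemxAr mulmxDl mul1mx PP.
rewrite -{2}[P]scale1r -scalerDl (_ : 1 + (v o0 0 - 1) = v o0 0); last by ring.
rewrite scalerA mulVf //.
by rewrite scale1r addrK.
Qed.

(** A linear change of coordinates takes [v] to a coordinate point, where the
    order of vanishing counts the power of a prime by [ordge_coordP]. *)
Lemma ordge_cancel d e v k p q : v o0 0 != 0 -> q.@[v^~ 0] != 0 ->
  p \is d.-homog -> q \is e.-homog -> ordge v k (p * q) -> ordge v k p.
Proof.
move=> v0 qv hp hq; have [A uA eA] := coord_frame v0; rewrite -eA in qv *.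
have hA := msub_homog A; move=> /(ordge_msubE _ _ _ uA).2.
rewrite rmorphM /= => /(ordge_coordP _ _ (dhomogM (hA _ _ hp) (hA _ _ hq))).1.
rewrite rmorphM => /coord_gauss h.
apply/(ordge_msubE _ _ _ uA)/(ordge_coordP _ _ (hA _ _ hp)); apply: h.
move=> hx; have := (ordge_coordP o0 1 (hA _ _ hq)).2 hx.
by move=> /(ordge_msubE _ _ _ uA).1 /ordge1_eval/eqP; rewrite (negbTE qv).
Qed.

(** * Primitive quadruples *)

Definition homog_rmap d F := forall i, tnth F i \is d.-homog.

Definition proportional F G := forall i j, tnth F i * tnth G j = tnth F j * tnth G i.

(** A quadruple of forms is primitive when every quadruple representing the
    same rational map is a multiple of it.  Over a factorial ring this says
    that the components are coprime; stated in this way it passes through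
    linear and Cremona substitutions by the primality of the coordinates
    alone. *)
Definition primitive F := (exists i, tnth F i != 0) /\
  forall e G, homog_rmap e G -> proportional G F ->
  exists u, forall i, tnth G i = u * tnth F i.

Lemma proportional_comp F G H :
  proportional F G -> proportional (rmap_comp F H) (rmap_comp G H).
Proof. by move=> h i j; rewrite !tnth_comp -!rmorphM /= h. Qed.

Lemma proportional_mulr F G H u : u != 0 ->
  (forall i, tnth H i = u * tnth G i) -> proportional F H <-> proportional F G.
Proof.
move=> u0 e; split=> h i j; last by rewrite !e !(mulrCA _ u) h.
by apply: (mulfI u0); rewrite !(mulrCA u) -!e h.
Qed.

Lemma primitive_id : primitive (rmap_id K).
Proof.
split=> [|e G hG hp]; first by exists o0; rewrite tnth_mktuple coord_neq0.
have hx i j : 'X_j * tnth G i = 'X_i * tnth G j.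
  by have := hp i j; rewrite !tnth_mktuple mulrC => ->; rewrite mulrC.
have [u eu] : mdvd 'X_o0 (tnth G o0).
  have /coord_prime[] // : mdvd 'X_o0 ('X_o1 * tnth G o0).
    by rewrite hx; eexists.
  by move/(coord_ndvd (i := o0) (j := o1) isT).
exists u => i; apply: (mulfI (coord_neq0 K o0)).
by rewrite tnth_mktuple hx eu; ring.
Qed.

Lemma primitive_msub g F : g \in unitmx -> primitive F ->
  primitive (rmap_comp F (linear_rmap g)).
Proof.
move=> ug [[k Fk] hF]; split=> [|e G hG hp].
  by exists k; rewrite tnth_comp msub_eq0.
have [|i j|u eu] := hF e (rmap_comp G (linear_rmap (invmx g))).
- by move=> i; rewrite tnth_comp; apply: msub_homog.
- have := proportional_comp (linear_rmap (invmx g)) hp i j.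
  by rewrite rmap_compA linear_comp mulmxV // linear1 rmap_comp_idr.
exists (msub g u) => i; have := congr1 (msub g) (eu i).
by rewrite tnth_comp rmorphM /= [msub g (tnth F i)]/msub -[msub g _]/(msub g (msub (invmx g) _)) msubKV // tnth_comp.
Qed.

(** Removing the coordinate factors from a Cremona substitution leaves a
    primitive quadruple: substituting once more gives back the original
    quadruple up to powers of the coordinates, which divide out. *)
Lemma primitive_cremona d (a : nat) F F' : homog_rmap d F -> primitive F ->
  (forall i, tnth F i \mPo c3 = X ^+ a * tnth F' i) ->
  (forall i, exists j, ~ mdvd 'X_i (tnth F' j)) -> primitive F'.
Proof.
move=> hF [[k Fk] pF] eF' nd; have Xa0 n : X ^+ n != 0 by rewrite expf_neq0 ?xprod_neq0.
have F'k : tnth F' k != 0.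
  apply: contraNneq Fk => F'k0; apply/eqP/(cremona_comp_eq0 (hF k)).
  by rewrite eF' F'k0 mulr0.
split=> [|e G hG hp]; first by exists k.
have eFF j : X ^+ (2 * d) * tnth F j = X ^+ (3 * a) * (tnth F' j \mPo c3).
  by rewrite -(comp_cremonaK (hF j)) eF' rmorphM rmorphXn /= xprod_cremona exprM.
have [|i j|u eu] := pF (e * 3)%N (rmap_comp G c3).
- by move=> i; rewrite tnth_comp; apply: cremona_comp_homog.
- apply: (mulfI (Xa0 (2 * d)%N)); rewrite !(mulrCA (X ^+ (2 * d))) !eFF.
  by rewrite !(mulrCA _ (X ^+ (3 * a))) !tnth_comp -!rmorphM /= hp.
have eGG i : X ^+ (2 * e) * tnth G i = (u \mPo c3) * X ^+ a * tnth F' i.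
  rewrite -(comp_cremonaK (hG i)) -tnth_comp eu rmorphM /=.
  by rewrite eF' mulrA.
have [|u' eu'] := @xprod_dvd _ (2 * e) ((u \mPo c3) * X ^+ a).
  move=> i; have [j ndj] := nd i; apply: coord_gauss ndj _.
  by rewrite -eGG /xprod (bigD1 i) //= exprMn -mulrA; eexists.
exists u' => i; apply: (mulfI (Xa0 (2 * e)%N)).
by rewrite eGG eu' mulrA.
Qed.

Lemma pihomogM d e p q : q \is d.-homog ->
  pihomog [measure of mdeg] (e + d) (p * q) = pihomog [measure of mdeg] e p * q.
Proof.
move=> hq; elim/mpolyind: p => [|c m p _ _ IH]; first by rewrite !(mul0r, raddf0).
rewrite mulrDl !raddfD mulrDl /= IH -scalerAl !linearZ -scalerAl /=; congr (_ *: _ + _).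
rewrite pihomogX; case: eqP => [<-|/eqP ne].
  by rewrite pihomog_dE //; apply: dhomogM => //; rewrite dhomogX.
rewrite mul0r (pihomog_ne0 (d := mdeg m + d)) ?eqn_add2r //.
by apply: dhomogM => //; rewrite dhomogX.
Qed.

(** If [F = q * h] then [q], and each of its homogeneous parts, is proportional to
    [F], hence a multiple of it; so [F] divides [q] and [h] is a unit. *)
Lemma primitive_coprime d F : homog_rmap d F -> primitive F -> coprime_forms d F.
Proof.
move=> hF [[k Fk] pF]; split=> // h hdiv.
have /fin_all_exists[q eq] i : exists q, tnth F i = q * h.
  by apply: hdiv; apply: mem_tnth.
have h0 : h != 0 by apply: contraNneq Fk => h0; rewrite eq h0 mulr0.
have hq i j : q i * tnth F j = q j * tnth F i.
  by apply: (mulIf h0); rewrite mulrAC -eq (mulrC (tnth F i)) mulrAC -eq mulrC.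
pose mf := [measure of @mdeg 4].
have /choice[z ez] e : exists z : M, forall i, pihomog mf e (q i) = z * tnth F i.
  have [|i j|z ez] := pF e [tuple pihomog mf e (q i) | i < 4].
  - by move=> i; rewrite tnth_mktuple; apply: pihomogP.
  - by rewrite !tnth_mktuple -!(pihomogM _ _ (hF _)) hq.
  by exists z => i; rewrite -ez tnth_mktuple.
have eqk : q k = (\sum_(e < msize (q k)) z e) * tnth F k.
  rewrite {1}(@pihomog_partitionE _ _ mf _ (q k) (leqnn _)) mulr_suml.
  by apply: eq_bigr => e _; rewrite ez.
have : h \is a GRing.unit.
  apply/unitrP; exists (\sum_(e < msize (q k)) z e).
  suff e1 : (\sum_(e < msize (q k)) z e) * h = 1 by rewrite [h * _]mulrC e1.
  by apply: (mulIf Fk); rewrite mul1r mulrAC -eqk -eq.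
by case/andP=> /eqP -> _; eexists.
Qed.

Lemma proportional_degree d e F G : homog_rmap d F -> primitive F ->
  coprime_forms e G -> (exists i, tnth G i != 0) -> proportional G F -> e = d.
Proof.
move=> hF [_ pF] [hG cG] [k Gk] /(pF _ _ hG)[u eu].
have [p /tnthP[i ->]|c ec] := cG u; first by exists (tnth F i); rewrite eu mulrC.
move: Gk; have := hG k; rewrite eu ec mul_mpolyC => hGk Gk.
by apply/esym/(dhomog_uniq Gk _ hGk)/dhomogZ.
Qed.

(** A coprime quadruple representing the same map as a primitive one is a constant
    multiple of it, so that all of them have the same degree. *)
Lemma degree_primitive d q F G : homog_rmap d G -> primitive G -> q != 0 ->
  (forall i, tnth F i = q * tnth G i) -> degree F = d.
Proof.
move=> hG pG q0 eF; have [k Gk] := pG.1.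
have Fk : exists i, tnth F i != 0 by exists k; rewrite eF mulf_neq0.
apply: xget_unique => [|e [H cH [_ H0 hp]]].
  exists G; first exact: primitive_coprime.
  by split=> // [|i j]; [exists k | rewrite !eF; ring].
apply: (proportional_degree hG pG cH H0).
apply/(proportional_mulr _ q0 eF) => i j.
by rewrite mulrC (mulrC (tnth H j)) hp.
Qed.

End Vanishing.

(** * The three tetrahedra *)

Notation bE := (@Ordinal 3 0 isT).
Notation bP := (@Ordinal 3 1 isT).
Notation bQ := (@Ordinal 3 2 isT).

Lemma ord3P (P : 'I_3 -> Prop) : P bE -> P bP -> P bQ -> forall b, P b.
Proof.
move=> P0 P1 P2 [[|[|[|//]]] lt_i].
- by rewrite (_ : Ordinal lt_i = bE) //; apply/val_inj.
- by rewrite (_ : Ordinal lt_i = bP) //; apply/val_inj.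
- by rewrite (_ : Ordinal lt_i = bQ) //; apply/val_inj.
Qed.

Section Dynamics.

Variable K : fieldType.
Local Notation M := {mpoly K[4]}.
Local Notation c3 := (cremona K).
Local Notation X := (xprod K).
Implicit Types (p q r u : M) (F G : rmap K) (g h : 'M[K]_4) (v : 'cV[K]_4).
Implicit Types (i j : 'I_4).

Definition block (b : 'I_3) : seq 'cV[K]_4 :=
  nth [::] [:: coordE K; coordP K; coordQ K] b.

Lemma vec4E (a b c d : K) :
  (vec4 a b c d o0 0 = a) * (vec4 a b c d o1 0 = b) *
  (vec4 a b c d o2 0 = c) * (vec4 a b c d o3 0 = d).
Proof. by rewrite !mxE. Qed.

Lemma vec4_eta v : v = vec4 (v o0 0) (v o1 0) (v o2 0) (v o3 0).
Proof. by apply/matrixP => i j; rewrite ord1; move: i; apply: ord4P; rewrite !vec4E. Qed.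

Lemma cvecE :
  (cvec K o0 = vec4 1 0 0 0) * (cvec K o1 = vec4 0 1 0 0) *
  (cvec K o2 = vec4 0 0 1 0) * (cvec K o3 = vec4 0 0 0 1).
Proof. by do !split; rewrite [LHS]vec4_eta !mxE. Qed.

Lemma blockE_cvec v : v \in block bE -> exists i, v = cvec K i.
Proof.
by rewrite !inE => /or4P[] /eqP ->;
  [exists o0 | exists o1 | exists o2 | exists o3]; rewrite cvecE.
Qed.

Lemma cvec_blockE i : cvec K i \in block bE.
Proof. by move: i; apply: ord4P; rewrite cvecE !inE eqxx ?orbT. Qed.

Lemma block_sign b v : b != bE -> v \in block b -> sign_vec v.
Proof.
move: b; apply: ord3P => // _; rewrite !inE => /or4P[] /eqP -> i; move: i;
  by apply: ord4P; rewrite vec4E ?sqrrN expr1n.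
Qed.

Lemma block_neq0 b v : v \in block b -> v != 0.
Proof.
have [->|/block_sign sv /sv sv'] := eqVneq b bE.
  by case/blockE_cvec=> i ->; apply/eqP => /matrixP/(_ i 0)/eqP; rewrite !mxE !eqxx oner_eq0.
by apply/eqP => v0; have := sign_vec_neq0 o0 sv'; rewrite v0 mxE eqxx.
Qed.

(** * Degree and multiplicities along the iteration *)

(** The multiplicity at [v] of the linear system spanned by the components. *)
Definition mult_is v k F :=
  (forall i, ordge v k (tnth F i)) /\ ~ (forall i, ordge v k.+1 (tnth F i)).

(** What has to be remembered of an iterate in order to compute the degree of the
    next one. *)
Definition state d (m : 'I_3 -> nat) F :=
  [/\ homog_rmap d F, primitive F & forall b v, v \in block b -> mult_is v (m b) F].

Definition moves g (s : 'I_3 -> 'I_3) := forall b v, v \in block b ->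
  exists c v', [/\ c != 0, v' \in block (s b) & g *m v = c *: v'].

Lemma state_linear h : h \in unitmx -> state 1 (fun=> 0%N) (linear_rmap h).
Proof.
move=> uh; split; first exact: linear_homog.
  by rewrite -[linear_rmap h]rmap_comp_idl; apply: primitive_msub (primitive_id K).
move=> b v vb; split=> [i|h0]; first exact: ordge0.
have /negP[] := block_neq0 vb; apply/eqP.
rewrite -[v](mulKmx uh) (_ : h *m v = 0) ?mulmx0 // -linear_eval.
by apply/matrixP => i j; rewrite !mxE; apply: ordge1_eval (h0 i).
Qed.

Lemma state_msub d m g s F : g \in unitmx -> moves g s -> state d m F ->
  state d (m \o s) (rmap_comp F (linear_rmap g)).
Proof.
move=> ug gs [hF pF mF]; split; last 1 first.
- move=> b v /gs[c [v' [c0 v's ev]]].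
  have eo k i : ordge v k (tnth (rmap_comp F (linear_rmap g)) i) <-> ordge v' k (tnth F i).
    rewrite tnth_comp (ordge_msubE _ _ _ ug) ev; exact: ordge_scale.
  have [m1 m2] := mF _ _ v's; split=> [i|m3]; first exact/eo/m1.
  by apply: m2 => i; apply/eo/m3.
- by move=> i; rewrite tnth_comp; apply: msub_homog.
exact: primitive_msub.
Qed.

Lemma dhomog_divr d e p q : q != 0 -> q \is e.-homog -> p * q \is d.-homog ->
  p \is (d - e)%N.-homog.
Proof.
move=> q0 hq hpq; have [->|p0] := eqVneq p 0; first exact: dhomog0.
pose mf := [measure of @mdeg 4].
have zero k : (k + e)%N != d -> pihomog mf k p = 0.
  rewrite eq_sym => ne; apply: (mulIf q0).
  by rewrite -(pihomogM _ _ hq) (pihomog_ne0 ne hpq) mul0r.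
have [le_ed|lt_de] := leqP e d.
  rewrite (@pihomog_partitionE _ _ mf _ p (leqnn _)); apply: rpred_sum => k _.
  have [ek|/zero -> //] := eqVneq (k + e)%N d; last exact: dhomog0.
  by rewrite -ek addnK; apply: pihomogP.
rewrite (@pihomog_partitionE _ _ mf _ p (leqnn _)) big1 ?dhomog0 // => k _.
by apply: zero; rewrite neq_ltn (leq_trans lt_de) ?leq_addl ?orbT.
Qed.

Lemma coord_ndvd_cremona i : ~ mdvd 'X_i (tnth c3 i).
Proof.
by move: i; apply: ord4P; rewrite cremonaE => /coord_prime[/coord_prime[]|]; apply: coord_ndvd.
Qed.

Lemma primitive_ndvd d F i : homog_rmap d F -> primitive F ->
  exists j, ~ mdvd 'X_i (tnth F j).
Proof.
move=> hF pF; apply/existsNP => alldvd.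
have [_ cF] := primitive_coprime hF pF.
have [p /tnthP[j ->]|c /coord_nonconstant //] := cF 'X_i.
by have [u ->] := alldvd j; exists u; rewrite mulrC.
Qed.

(** The class computation for the standard Cremona map: with multiplicity [m bE]
    at the coordinate points exactly the factor [X ^+ m bE] splits off.  The new
    multiplicity at these points is found by applying the map again, which
    returns [F] up to a power of [X]; the sign vectors are fixed points outside
    the coordinate planes, so that nothing changes there. *)
Lemma state_cremona d m F : state d m F -> exists F',
  state (3 * d - 4 * m bE)%N (fun b => if b == bE then 2 * d - 3 * m bE else m b)%N F' /\
  forall i, tnth F i \mPo c3 = X ^+ m bE * tnth F' i.
Proof.
move=> [hF pF mF]; set a := m bE.
have ordF i k j : ordge (cvec K i) k (tnth F j) <-> mdvd ('X_i ^+ k) (tnth F j \mPo c3).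
  exact: ordge_coordP.
have /fin_all_exists[f ef] i : exists q, tnth F i \mPo c3 = X ^+ a * q.
  by apply: xprod_dvd => j; apply/ordF; have [+ _] := mF _ _ (cvec_blockE j); apply.
pose F' : rmap K := [tuple f i | i < 4].
have {}ef i : tnth F i \mPo c3 = X ^+ a * tnth F' i by rewrite tnth_mktuple.
have Xa0 n : X ^+ n != 0 by rewrite expf_neq0 ?xprod_neq0.
have nd i : exists j, ~ mdvd 'X_i (tnth F' j).
  apply/existsNP => alldvd; have [_ []] := mF _ _ (cvec_blockE i) => j.
  apply/ordF; rewrite ef -(cremona_coord K i) exprMn; have [u ->] := alldvd j.
  by exists (tnth c3 i ^+ a * u); rewrite exprSr; ring.
have pF' := primitive_cremona hF pF ef nd.
have hF' : homog_rmap (3 * d - 4 * a) F'.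
  move=> i; apply: (dhomog_divr (Xa0 a)); first exact/dhomogMn/xprod_homog.
  by rewrite mulrC -ef mulnC; apply: cremona_comp_homog.
have eFF i : X ^+ (2 * d) * tnth F i = X ^+ (3 * a) * (tnth F' i \mPo c3).
  by rewrite -(comp_cremonaK (hF i)) ef rmorphM rmorphXn /= xprod_cremona exprM.
exists F'; split=> //; split=> // b v vb; have [eb|nb] := eqVneq b bE; last first.
  have sv := block_sign nb vb; have v0 := sign_vec_neq0 o0 sv.
  have Xv n : (X ^+ n).@[v^~ 0] != 0.
    rewrite rmorphXn expf_neq0 // xprodE !rmorphM /= !mevalXU.
    by rewrite !mulf_neq0 // sign_vec_neq0.
  have eo k i : ordge v k (tnth F' i) <-> ordge v k (tnth F i).
    split=> [/(ordge_mull (X ^+ a))|/(ordge_cremona sv)]; last first.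
      rewrite ef mulrC; apply: ordge_cancel (Xv _) (hF' i) _ => //.
      exact/dhomogMn/xprod_homog.
    rewrite -ef => /(ordge_cremona sv); rewrite (comp_cremonaK (hF i)) mulrC.
    by apply: ordge_cancel (Xv _) (hF i) _ => //; apply/dhomogMn/xprod_homog.
  have [m1 m2] := mF _ _ vb; split=> [i|m3]; first exact/eo/m1.
  by apply: m2 => i; apply/eo/m3.
rewrite {}eb in vb; have [i ->] := blockE_cvec vb.
have [k ndk] := primitive_ndvd i hF pF.
have le_ad : (3 * a <= 2 * d)%N.
  rewrite leqNgt; apply/negP => lt_da; apply: ndk.
  have : tnth F k = X ^+ (3 * a - 2 * d) * (tnth F' k \mPo c3).
    apply: (mulfI (Xa0 (2 * d)%N)); rewrite eFF mulrA -exprD subnKC //.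
    exact: ltnW.
  move=> ->; rewrite -(cremona_coord K i) -(ltn_predK (m := 0) (n := 3 * a - 2 * d)) ?subn_gt0 //.
  by rewrite exprS -!mulrA; eexists.
have {}eFF j : tnth F' j \mPo c3 = X ^+ (2 * d - 3 * a) * tnth F j.
  by apply: (mulfI (Xa0 (3 * a)%N)); rewrite -eFF mulrA -exprD subnKC.
split=> [j|all1]; first by apply/(ordge_coordP _ _ (hF' j)); rewrite eFF -(cremona_coord K i) exprMn -mulrA; eexists.
apply: ndk; have /(ordge_coordP _ _ (hF' k)) := all1 k.
rewrite eFF -(cremona_coord K i) exprMn exprSr -!mulrA => -[u].
rewrite -mulrA => /(mulfI (expf_neq0 _ (coord_neq0 K i))) eu.
have /coord_prime[] // : mdvd 'X_i (tnth c3 i ^+ (2 * d - 3 * a) * tnth F k) by exists u.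
by move/(ndvd_exp (@coord_ndvd_cremona i)).
Qed.

(** * Degrees of the iterates *)

(** [g] permutes the multiplicities, then [c_3] changes the degree and the
    multiplicity at the coordinate points. *)
Definition step (s : 'I_3 -> 'I_3) (x : nat * ('I_3 -> nat)) : nat * ('I_3 -> nat) :=
  ((3 * x.1 - 4 * x.2 (s bE))%N,
   fun b => if b == bE then (2 * x.1 - 3 * x.2 (s bE))%N else x.2 (s b)).

Definition degrees s n := iter n (step s) (1%N, fun=> 0%N).

Lemma rmap_iterSr n F : rmap_iter n.+1 F = rmap_comp (rmap_iter n F) F.
Proof.
elim: n => [|n IH]; first by rewrite /rmap_iter /= rmap_comp_idl rmap_comp_idr.
change (rmap_comp F (rmap_iter n.+1 F) = rmap_comp (rmap_comp F (rmap_iter n F)) F).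
by rewrite IH rmap_compA.
Qed.

Lemma state_step s g x F : g \in unitmx -> moves g s -> state x.1 x.2 F ->
  exists F' a, state (step s x).1 (step s x).2 F' /\
    forall i, tnth F i \mPo rmap_comp (linear_rmap g) c3 = X ^+ a * tnth F' i.
Proof.
move=> ug gs /(state_msub ug gs)/state_cremona[F' [sF' eF']].
exists F', (x.2 (s bE)); split=> // i.
by rewrite -comp_mpolyA -tnth_comp eF'.
Qed.

(** Iterates are built by composing on the right with [g o c_3]; the map
    [c_3 o g] is its conjugate by [g], whence the last linear substitution. *)
Lemma iterates_state (b : bool) s g n : g \in unitmx -> moves g s ->
  exists F q e, [/\ state (degrees s n).1 (degrees s n).2 F, q != 0, q \is e.-homog &
    forall i, tnth (rmap_iter n (cremona_cubes_map b g)) i =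
      q * tnth (if b then F else rmap_comp F (linear_rmap g)) i].
Proof.
move=> ug gs; elim: n => [|n [F [q [e [sF q0 hq eF]]]]].
  exists (if b then rmap_id K else linear_rmap (invmx g)), 1, 0%N.
  split; rewrite ?oner_neq0 ?dhomog1 //.
    by case: b; rewrite -?linear1; apply: state_linear; rewrite ?unitmx1 ?unitmx_inv.
  by case: b => i; rewrite mul1r // linear_comp mulVmx // linear1.
have [F' [a [sF' eF']]] := state_step ug gs sF.
have comp_neq0 z (hz : z != 0) : z \is e.-homog -> z \mPo c3 != 0.
  by move=> /cremona_comp_eq0 h; apply: contraNneq hz => /h ->.
exists F'; case: b eF => eF; rewrite rmap_iterSr.
  exists ((msub g q \mPo c3) * X ^+ a), (e * 3 + 4 * a)%N; split=> //.
  - rewrite mulf_neq0 ?expf_neq0 ?xprod_neq0 // comp_neq0 ?msub_eq0 //.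
    exact: msub_homog.
  - by apply/dhomogM/dhomogMn/xprod_homog/cremona_comp_homog/msub_homog.
  by move=> i; rewrite tnth_comp eF rmorphM /= eF' -comp_mpolyA mulrA.
exists (msub g ((q \mPo c3) * X ^+ a)), (e * 3 + 4 * a)%N; split=> //.
- by rewrite msub_eq0 // mulf_neq0 ?expf_neq0 ?xprod_neq0 // comp_neq0.
- by apply/msub_homog/dhomogM/dhomogMn/xprod_homog/cremona_comp_homog.
move=> i; rewrite tnth_comp eF rmorphM /=.
rewrite -!comp_mpolyA tnth_comp.
rewrite [((tnth F i \mPo _) \mPo c3)]comp_mpolyA eF' /msub !rmorphM /=.
by rewrite tnth_comp mulrA.
Qed.

Theorem deg_seq_degrees b s g n : g \in unitmx -> moves g s ->
  deg_seq (cremona_cubes_map b g) n = (degrees s n).1.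
Proof.
move=> ug gs; have [F [q [e [[hF pF _] q0 _ eF]]]] := iterates_state b n ug gs.
apply: (degree_primitive _ _ q0 eF); case: b {eF} => //; last exact: primitive_msub.
by move=> i; rewrite tnth_comp; apply: msub_homog.
Qed.

Lemma degrees_fixed s n : s bE = bE ->
  (degrees s n).1 = (if odd n then 3 else 1)%N /\
  (degrees s n).2 bE = (if odd n then 2 else 0)%N.
Proof.
move=> sE; elim: n => [|n [IHd IHm]]; first by [].
by rewrite /degrees iterS /= -/(degrees s n) sE IHd IHm; case: (odd n).
Qed.

(** The multiplicity of the third tetrahedron stays 0, and the difference of the
    other two grows linearly. *)
Lemma degrees_swapped s n : s bE != bE -> s (s bE) = bE ->
  [/\ (degrees s n).1 = (2 * n ^ 2).+1, (degrees s n).2 bE = (n * n.+1)%N &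
      (degrees s n).2 (s bE) = (n * n.-1)%N].
Proof.
move=> sE ssE; elim: n => [|n [IHd IHm IHb]]; first by [].
rewrite /degrees iterS /= -/(degrees s n) (negbTE sE) ssE IHd IHm IHb -!mulnn.
by split=> //; case: n {IHd IHm IHb} => // n /=; nia.
Qed.

(** The even-indexed Lucas numbers, in consecutive pairs. *)
Definition lucas2 n : nat * nat := iter n (fun x => (x.2, 3 * x.2 - x.1)%N) (2, 3)%N.

Lemma lucas2S n : lucas2 n.+1 = ((lucas2 n).2, (3 * (lucas2 n).2 - (lucas2 n).1)%N).
Proof. by []. Qed.

(** The degree solves the recurrence with eigenvalues [phi ^+ 2], [phi ^- 2], [1]
    and [-1]; the induction needs the three multiplicities as well. *)
Lemma degrees_cyclic s n : s bE != bE -> s (s bE) != bE -> s (s (s bE)) = bE ->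
  (5 * (degrees s n).1 + 10 + (if odd n then 0 else 2) = 8 * (lucas2 n).1 + 1)%N.
Proof.
move=> s1 s2 s3; pose x := (lucas2 n).1; pose y := (lucas2 n).2.
suff [] : [/\ (5 * (degrees s n).1 + 10 + (if odd n then 0 else 2) = 8 * x + 1)%N,
  (5 * (degrees s n).2 bE + 5 + (if odd n then 0 else 2) = 2 * y + 1)%N,
  (5 * (degrees s n).2 (s bE) + 2 * y + 5 + (if odd n then 0 else 2) = 6 * x + 1)%N,
  (5 * (degrees s n).2 (s (s bE)) + 5 + (if odd n then 2 else 0) = 2 * x + 1)%N &
  (2 <= x <= y)%N] by [].
rewrite /x /y {x y}; elim: n => [|n]; first by [].
rewrite lucas2S.
rewrite /degrees iterS -/(degrees s n); move: (lucas2 n) (degrees s n) => [x y] [d m].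
rewrite /step /= (negbTE s1) (negbTE s2) s3.
by move=> [IHd IHE IH1 IH2 /andP[IHx IHy]]; case: (odd n) IHd IHE IH1 IH2 => /=; split; lia.
Qed.

End Dynamics.

(** * Growth of the degrees *)

Section Growth.

Variable R : realType.
Implicit Types (d : nat -> nat) (a : nat -> R) (c S : R).

Lemma cvg_invn : (fun n : nat => n%:R^-1 : R) @ \oo --> (0 : R).
Proof. by rewrite -cvg_shiftS; exact: cvg_harmonic. Qed.

(** A positive constant factor does not change the exponential rate. *)
Lemma grows_entropy d a c S : (forall n, 0 < d n)%N -> (forall n, (0 < n)%N -> 0 < a n) ->
  0 < c -> (fun n => (d n)%:R / a n) @ \oo --> c ->
  (fun n => ln (a n) / n%:R) @ \oo --> S -> entropy_is d S.
Proof.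
move=> d0 a0 c0 cvd cva.
have cvl : (fun n => ln ((d n)%:R / a n) / n%:R) @ \oo --> (0 : R).
  rewrite -[0](mulr0 (ln c)); apply: cvgM cvg_invn.
  exact: (continuous_cvg _ (continuous_ln c0) cvd).
rewrite /entropy_is -[S]add0r; apply: cvg_trans (cvgD cvl cva).
apply: near_eq_cvg; near=> n; have n0 : (0 < n)%N by near: n; exists 1%N.
rewrite /= !fctE -mulrDl -lnM ?posrE ?divr_gt0 ?ltr0n ?a0 //.
by rewrite mulfVK // gt_eqF ?a0.
Unshelve. all: by end_near. Qed.

(** Taking four times the logarithm of the square root makes the bound
    [ln x <= x] sufficient. *)
Lemma ln_natr_div : (fun n : nat => ln (n%:R ^+ 2) / n%:R : R) @ \oo --> (0 : R).
Proof.
have cvs : (fun n : nat => Num.sqrt (n%:R^-1 : R) *+ 4) @ \oo --> (0 : R).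
  rewrite -[0 in X in _ --> X](mul0rn _ 4) -[0 in X in _ --> X](sqrtr0 R).
  apply: cvgMn; apply: (continuous_cvg _ (@sqrt_continuous R 0) cvg_invn).
apply: (squeeze_cvgr _ (cvg_cst 0) cvs); near=> n.
have n1 : (1 <= n%:R :> R) by rewrite ler1n; near: n; exists 1%N.
have n0 : 0 < n%:R :> R by apply: lt_le_trans n1.
have s0 : 0 < Num.sqrt (n%:R : R) by rewrite sqrtr_gt0.
rewrite divr_ge0 ?ln_ge0 ?exprn_ege1 //= ler_pdivrMr //.
have -> : ln (n%:R ^+ 2 : R) = ln (Num.sqrt n%:R) *+ 4.
  by rewrite -lnXn // -[in LHS](sqr_sqrtr (ltW n0)) -exprM.
rewrite mulrnAl lerMn2r /= sqrtrV ?ltW // -[X in _ * X](sqr_sqrtr (ltW n0)) expr2 mulKf ?gt_eqF //.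
exact: ln_sublinear.
Unshelve. all: by end_near. Qed.

Lemma growth_quadratic d : (forall n, d n = (2 * n ^ 2).+1) ->
  integrable_entropy R d /\ grows_like d (fun n => n%:R ^+ 2 : R).
Proof.
move=> ed; have cvd : (fun n => (d n)%:R / n%:R ^+ 2 : R) @ \oo --> (2 : R).
  have cvi : (fun n : nat => 2 + (n%:R^-1 * n%:R^-1) : R) @ \oo --> (2 : R).
    rewrite -[2 in X in _ --> X]addr0; apply: cvgD; first exact: cvg_cst.
    by rewrite -[0 in X in _ --> X](mulr0 0); apply: cvgM; apply: cvg_invn.
  apply: cvg_trans cvi; apply: near_eq_cvg; near=> n.
  have n0 : n%:R != 0 :> R by rewrite pnatr_eq0 -lt0n; near: n; exists 1%N.
  by rewrite ed -(natr1 (2 * n ^ 2)) natrM natrX /=; field.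
split; last by exists 2.
apply: (grows_entropy _ _ _ cvd ln_natr_div) => [n|n n0|]; rewrite ?ed //.
by rewrite exprn_gt0 ?ltr0n.
Unshelve. all: by end_near. Qed.

Local Notation phi := (golden R).

Lemma goldenE : phi ^+ 2 = phi + 1.
Proof.
have s5 : Num.sqrt 5 ^+ 2 = 5 :> R by rewrite sqr_sqrtr ?ler0n.
by rewrite /golden; field: s5.
Qed.

Lemma golden_gt1 : 1 < phi.
Proof.
have : Num.sqrt 1 < Num.sqrt 5 :> R by rewrite ltr_sqrt ?ltr1n ?ltr0n.
rewrite sqrtr1 => s5.
by rewrite /golden; lra.
Qed.

Lemma golden2 : exists x y : R, [/\ phi ^+ 2 = x, 1 < x, x * y = 1 & x + y = 3].
Proof.
have p1 := golden_gt1; have e2 := goldenE.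
exists (phi ^+ 2), (3 - phi ^+ 2); split=> //; rewrite ?subrKC //.
  by rewrite exprn_egt1.
by rewrite e2; ring: e2.
Qed.

Lemma lucas2_ge2 n : (2 <= (lucas2 n).1 <= (lucas2 n).2)%N.
Proof.
elim: n => // n; by rewrite lucas2S /=; lia.
Qed.

(** Binet's formula, for the roots of [z ^+ 2 - 3 * z + 1]. *)
Lemma lucas2E (x y : R) n : x * y = 1 -> x + y = 3 ->
  (lucas2 n).1%:R = x ^+ n + y ^+ n /\ (lucas2 n).2%:R = x ^+ n.+1 + y ^+ n.+1.
Proof.
move=> xy xDy; elim: n => [|n [IH1 IH2]].
  by rewrite !expr0 !expr1 xDy.
rewrite lucas2S.
split=> //=; have /andP[_ le12] := lucas2_ge2 n.
rewrite natrB; last by lia.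
rewrite natrM IH1 IH2 -[3%:R]xDy.
have -> : (x + y) * (x ^+ n.+1 + y ^+ n.+1) =
  x ^+ n.+2 + y ^+ n.+2 + (x * y) * (x ^+ n + y ^+ n) by rewrite !exprS; ring.
by rewrite xy mul1r addrK.
Qed.

Lemma growth_golden d :
  (forall n, 5 * d n + 10 + (if odd n then 0 else 2) = 8 * (lucas2 n).1 + 1)%N ->
  nonintegrable_entropy R d /\ grows_like d (fun n => phi ^+ (2 * n)).
Proof.
move=> ed; have [x [y [ex x1 xy xDy]]] := golden2.
have x0 : 0 < x by apply: lt_trans x1.
have xi1 : `|x^-1| < 1 by rewrite gtr0_norm ?invr_gt0 // invf_lt1.
have yE : y = x^-1 by rewrite -[y](mulKf (lt0r_neq0 x0)) xy mulr1.
have cvd : (fun n => (d n)%:R / x ^+ n) @ \oo --> (8 / 5 : R).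
  have geo (z : R) : `|z| < 1 -> (fun n => z ^+ n) @ \oo --> (0 : R) by apply: cvg_expr.
  have cvs : (fun n => 8 / 5 + 8 / 5 * (y / x) ^+ n - 2 * (x^-1) ^+ n
      - 5^-1 * (- x^-1) ^+ n) @ \oo --> (8 / 5 + 8 / 5 * 0 - 2 * 0 - 5^-1 * 0 : R).
    apply: cvgB; last by apply: cvgM; [exact: cvg_cst | apply: geo; rewrite normrN].
    apply: cvgB; last by apply: cvgM; [exact: cvg_cst | apply: geo].
    apply: cvgD; first exact: cvg_cst.
    apply: cvgM; first exact: cvg_cst.
    by apply: geo; rewrite yE normrM mulr_ilt1.
  rewrite !mulr0 !subr0 addr0 in cvs; apply: cvg_trans cvs.
  apply: near_eq_cvg; near=> n => /=.
  have [/esym eL _] := lucas2E n xy xDy.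
  have xn0 : x ^+ n != 0 by rewrite expf_neq0 ?lt0r_neq0.
  have : 5 * (d n)%:R + 10 + (1 + (-1) ^+ n) = 8 * (lucas2 n).1%:R + 1 :> R.
    have := congr1 (GRing.natmul (1 : R)) (ed n).
    rewrite (natrD _ (5 * d n + 10)) (natrD _ (5 * d n)) (natrD _ (8 * _)) !natrM => <-.
    by rewrite -signr_odd; case: (odd n) => /=; rewrite ?expr0 ?expr1; ring.
  rewrite -eL => eD; rewrite [(- _) ^+ n]exprNn expr_div_n exprVn.
  (* the parity term of the hypothesis is [1 + (-1) ^+ n] *)
  have -> : (d n)%:R = (8 * (x ^+ n + y ^+ n) - 10 - (-1) ^+ n) / 5 :> R.
    apply: (mulfI (_ : 5 != 0)); first by rewrite pnatr_eq0.
    rewrite mulrCA mulfV ?pnatr_eq0 // mulr1; apply: (addIr (10 + (1 + (-1) ^+ n))).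
    by rewrite addrA eD; ring.
  by field.
split; last first.
  exists (8 / 5); first by rewrite divr_gt0 ?ltr0n.
  by under eq_cvg => n do rewrite exprM ex.
exists (ln x); first exact: ln_gt0.
apply: (grows_entropy _ _ _ cvd) => [n|n _||].
- rewrite lt0n; apply/eqP => d0; have := ed n; rewrite d0.
  by have := lucas2_ge2 n; case: (odd n); lia.
- exact: exprn_gt0.
- by rewrite divr_gt0 ?ltr0n.
have cvc : (fun _ : nat => ln x) @ \oo --> ln x by apply: cvg_cst.
apply: cvg_trans cvc; apply: near_eq_cvg; near=> n.
have n0 : n%:R != 0 :> R by rewrite pnatr_eq0 -lt0n; near: n; exists 1%N.
by rewrite /= lnXn // -[ln x *+ n]mulr_natr mulfK.
Unshelve. all: by end_near. Qed.

End Growth.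

(** * The configuration of twelve points *)

Section IntegerPoints.

(** The twelve points have integer coordinates, so that their incidences are
    decided by computation with integers. *)
Definition zpt : Type := int * int * int * int.

Definition zpoints : seq zpt := [::
  (1, 0, 0, 0); (0, 1, 0, 0); (0, 0, 1, 0); (0, 0, 0, 1);
  (1, -1, -1, -1); (-1, 1, -1, -1); (-1, -1, 1, -1); (-1, -1, -1, 1);
  (1, -1, -1, 1); (-1, 1, -1, 1); (1, 1, -1, -1); (1, 1, 1, 1)].

Definition zpoint (k : nat) : zpt := nth (0, 0, 0, 0) zpoints k.

Definition zcoord (k : nat) (x : zpt) : int :=
  nth 0 [:: x.1.1.1; x.1.1.2; x.1.2; x.2] k.

Definition zminor2 (p q : nat) (x y : zpt) : int :=
  zcoord p x * zcoord q y - zcoord q x * zcoord p y.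

Definition zminor3 (p q r : nat) (x y z : zpt) : int :=
  zcoord p x * zminor2 q r y z - zcoord q x * zminor2 p r y z + zcoord r x * zminor2 p q y z.

Definition zcomb (a b : int) (x y : zpt) : zpt :=
  (a * x.1.1.1 + b * y.1.1.1, a * x.1.1.2 + b * y.1.1.2,
   a * x.1.2 + b * y.1.2, a * x.2 + b * y.2).

Lemma all_pairs (P : nat -> nat -> bool) (i j : 'I_12) :
  all (fun i => all (P i) (iota 0 12)) (iota 0 12) -> P i j.
Proof.
by move=> /allP/(_ i); rewrite mem_iota ltn_ord => /(_ isT)/allP; apply; rewrite mem_iota ltn_ord.
Qed.

Definition zdistinct i j := (i == j) ||
  has (fun p => has (fun q => zminor2 p q (zpoint i) (zpoint j) != 0) (iota 0 4)) (iota 0 4).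

Lemma zpoints_distinct (i j : 'I_12) : zdistinct i j.
Proof. by apply: all_pairs; vm_compute. Qed.

(** Small coefficients suffice: the sum or difference of sign vectors of [P] and
    [Q] is twice a coordinate vector, and a sign vector plus a suitable even
    multiple of a coordinate vector is a sign vector. *)
Definition zcollinear i j := (i %/ 4 == j %/ 4)%N ||
  has (fun k => [&& k != i, k != j & has (fun a => has (fun b =>
      zcomb a b (zpoint i) (zpoint j) \in [:: zpoint k; zcomb 2 0 (zpoint k) (zpoint k)])
    [:: 1; -1; 2; -2]) [:: 1; -1; 2; -2]]) (iota 0 12).

(** Two points of different tetrahedra are collinear with another point of the
    configuration. *)
Lemma zpoints_collinear (i j : 'I_12) : zcollinear i j.
Proof. by apply: all_pairs; vm_compute. Qed.

Definition zedge i j := [|| i == j, (i %/ 4 != j %/ 4)%N |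
  all (fun k => [|| k == i, k == j | has (fun p => has (fun q => has (fun r =>
    zminor3 p q r (zpoint k) (zpoint i) (zpoint j) != 0) (iota 0 4)) (iota 0 4)) (iota 0 4)])
  (iota 0 12)].

(** Two points of one tetrahedron are collinear with no other point of the
    configuration. *)
Lemma zpoints_edges (i j : 'I_12) : zedge i j.
Proof. by apply: all_pairs; vm_compute. Qed.

End IntegerPoints.

Section Configuration.

Variable K : numFieldType.
Implicit Types (g : 'M[K]_4) (v : 'cV[K]_4) (i j k : 'I_12).

Definition zvec (x : zpt) : 'cV[K]_4 :=
  vec4 x.1.1.1%:~R x.1.1.2%:~R x.1.2%:~R x.2%:~R.

Lemma zvecE (p : nat) (lt_p : (p < 4)%N) x : zvec x (Ordinal lt_p) 0 = (zcoord p x)%:~R.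
Proof. by rewrite mxE; case: p lt_p => [|[|[|[|]]]]. Qed.

Lemma zcoord_default p x : (4 <= p)%N -> zcoord p x = 0.
Proof. by move=> ge_p; rewrite /zcoord nth_default. Qed.

Lemma zvec_comb a b x y : zvec (zcomb a b x y) = a%:~R *: zvec x + b%:~R *: zvec y.
Proof.
by rewrite [RHS]vec4_eta !mxE /= /zvec !rmorphD !rmorphM.
Qed.

Definition rpt i : 'cV[K]_4 := zvec (zpoint i).

Lemma coordR_zvec : coordR K = map zvec zpoints.
Proof. by rewrite /= /zvec /= !(mulrNz, mulr1z, mulr0z). Qed.

Lemma coordRP v : reflect (exists i, v = rpt i) (v \in coordR K).
Proof.
rewrite coordR_zvec; apply: (iffP idP) => [/mapP[x xz ->]|[i ->]].
  have lt_x : (index x zpoints < 12)%N by rewrite index_mem.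
  by exists (Ordinal lt_x); rewrite /rpt /zpoint /= nth_index.
by apply: (map_f zvec); apply/mem_nth/(ltn_ord i).
Qed.

Lemma rpt_coordR i : rpt i \in coordR K.
Proof. by apply/coordRP; exists i. Qed.

Lemma colZE (a : K) v (p : 'I_4) : (a *: v) p 0 = a * v p 0.
Proof. exact: mxE. Qed.

Lemma colDE v w (p : 'I_4) : (v + w) p 0 = v p 0 + w p 0.
Proof. exact: mxE. Qed.

Lemma zcoord_scale (a b : K) x y p : a *: zvec x = b *: zvec y ->
  a * (zcoord p x)%:~R = b * (zcoord p y)%:~R.
Proof.
move=> e; have [lt_p|ge_p] := ltnP p 4; last by rewrite !zcoord_default // !mulr0.
by have := congr1 (fun v : 'cV_4 => v (Ordinal lt_p) 0) e;
  rewrite /= !colZE !zvecE.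
Qed.

Lemma zcoord_scale3 (a b c : K) x y z p : c *: zvec z = a *: zvec x + b *: zvec y ->
  c * (zcoord p z)%:~R = a * (zcoord p x)%:~R + b * (zcoord p y)%:~R.
Proof.
move=> e; have [lt_p|ge_p] := ltnP p 4; last by rewrite !zcoord_default // !mulr0 addr0.
by have := congr1 (fun v : 'cV_4 => v (Ordinal lt_p) 0) e;
  rewrite /= colDE !colZE !zvecE.
Qed.

Lemma rpt_inj_scale (a b : K) i j : a != 0 -> a *: rpt i = b *: rpt j -> i = j.
Proof.
move=> a0 e; case/orP: (zpoints_distinct i j) => [/eqP/val_inj //|].
case/hasP=> p _ /hasP[q _ /negP[]]; rewrite -(intr_eq0 K) rmorphB !rmorphM.
apply/eqP/(mulfI a0); rewrite mulr0 mulrBr !mulrA !(zcoord_scale _ e).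
ring.
Qed.

Lemma rpt_edge (a b c : K) i j k : i != j -> (i %/ 4 = j %/ 4)%N ->
  c != 0 -> c *: rpt k = a *: rpt i + b *: rpt j -> (k == i) || (k == j).
Proof.
move=> neq eb c0 e; have := zpoints_edges i j; rewrite /zedge eb eqxx.
have -> : (val i == val j) = false := negbTE neq.
move/allP/(_ (val k)); rewrite mem_iota ltn_ord => /(_ isT).
rewrite orbA => /orP[//|/hasP[p _ /hasP[q _ /hasP[r _ /negP[]]]]].
rewrite -(intr_eq0 K) rmorphD rmorphB !rmorphM !rmorphB !rmorphM; apply/eqP/(mulfI c0).
rewrite mulr0 mulrDr mulrBr !mulrA !(zcoord_scale3 _ e).
ring.
Qed.

Lemma rpt_third i j : (i %/ 4 != j %/ 4)%N -> exists k (a b c : K),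
  [/\ k != i, k != j, c != 0 & c *: rpt k = a *: rpt i + b *: rpt j].
Proof.
move=> neq; have := zpoints_collinear i j; rewrite /zcollinear (negbTE neq) orFb.
case/hasP=> k k12 /and3P[ki kj /hasP[a _ /hasP[b _]]].
have lt_k : (k < 12)%N by move: k12; rewrite mem_iota.
rewrite !inE => /orP[] /eqP e; exists (Ordinal lt_k), a%:~R, b%:~R;
  [exists 1 | exists 2%:~R]; split=> //; rewrite ?oner_eq0 ?intr_eq0 // -zvec_comb e //.
  by rewrite scale1r.
by rewrite zvec_comb scale0r addr0.
Qed.

(** * Projectivities preserving the configuration *)

Lemma pt_eq v w : v != 0 -> pt v = pt w -> exists2 c : K, c != 0 & v = c *: w.
Proof.
move=> v0 e; have /vlineP[c ec] : v \in <[w]>%VS by rewrite -[<[w]>%VS]e memv_line.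
by exists c => //; apply: contraNneq v0 => c0; rewrite ec c0 scale0r.
Qed.

Lemma pt_scale (c : K) v : c != 0 -> pt (c *: v) = pt v.
Proof.
move=> c0; apply/eqP; rewrite eqEsubv -!memvE; apply/andP; split.
  by apply/vlineP; exists c.
by apply/vlineP; exists c^-1; rewrite scalerK.
Qed.

Lemma pact_pt g v : pact g (pt v) = pt (g *m v).
Proof. by rewrite /pact /pt limg_line lfunE. Qed.

Definition permutes g (s : 'S_12) (c : 'I_12 -> K) :=
  forall i, c i != 0 /\ g *m rpt i = c i *: rpt (s i).

Lemma rpt_neq0 i : rpt i != 0.
Proof.
apply/eqP => e0; have neq : i != i + 1 by rewrite -subr_eq0 opprD addrA subrr add0r oppr_eq0 oner_eq0.
have := @rpt_inj_scale 1 0 i (i + 1) (oner_neq0 K).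
by rewrite e0 scaler0 scale0r => /(_ erefl) e; rewrite -e eqxx in neq.
Qed.

Lemma cubes_permutes g : cremona_cubes g -> exists s c, permutes g s c.
Proof.
move=> [ug gR]; have gv v : v != 0 -> g *m v != 0.
  by move=> v0; apply: contraNneq v0 => gv0; rewrite -[v](mulKmx ug) gv0 mulmx0.
have /fin_all_exists[f /fin_all_exists2[c c0 ec]] i :
    exists j, exists2 c : K, c != 0 & g *m rpt i = c *: rpt j.
  have [|v /coordRP[j ->]] := gR (pact g (pt (rpt i))).
    by exists (pt (rpt i)) => //; exists (rpt i) => //; apply: rpt_coordR.
  rewrite pact_pt => e; exists j; apply: pt_eq; last by rewrite e.
  exact/gv/rpt_neq0.
have injf : injective f.
  move=> i j eij; apply: (@rpt_inj_scale (c j) (c i)) => //.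
  apply: (can_inj (mulKmx ug)); rewrite -!scalemxAr !ec eij !scalerA.
  by rewrite mulrC.
by exists (perm injf), c => i; rewrite permE.
Qed.

Lemma permutes_inv g s c : g \in unitmx -> permutes g s c ->
  permutes (invmx g) s^-1%g (fun i => (c (s^-1%g i))^-1).
Proof.
move=> ug pg i; have [c0 e] := pg (s^-1%g i); split; first by rewrite invr_eq0.
rewrite permKV in e; rewrite -{1}[rpt (s^-1%g i)](mulKmx ug) e -scalemxAr.
by rewrite scalerK.
Qed.

Lemma tetra_subproof i : (i %/ 4 < 3)%N.
Proof. by rewrite ltn_divLR. Qed.

Definition tetra i : 'I_3 := Ordinal (tetra_subproof i).

Lemma block_zvec b : block K b = [seq zvec (zpoint (4 * b + k)) | k : nat <- iota 0 4].
Proof.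
by move: b; apply: ord3P; rewrite /block /= /zvec /zpoint /= !(mulrNz, mulr1z, mulr0z).
Qed.

Lemma blockP b v : reflect (exists2 i, tetra i = b & v = rpt i) (v \in block K b).
Proof.
rewrite block_zvec; apply: (iffP mapP) => [[k]|[i <- ->]].
  rewrite mem_iota => /= k4 ->; have lt_i : (4 * b + k < 12)%N by case: b => b /= b3; lia.
  exists (Ordinal lt_i) => //; apply/val_inj => /=.
  by rewrite mulnC divnMDl // divn_small // addn0.
exists (i %% 4)%N; first by rewrite mem_iota ltn_mod.
by rewrite /rpt mulnC -divn_eq.
Qed.

(** Collinearity of triples of the configuration tells the tetrahedra apart, so
    that a projectivity preserving the configuration permutes them. *)
Lemma permutes_tetra g s c i j : g \in unitmx -> permutes g s c ->
  tetra i = tetra j -> tetra (s i) = tetra (s j).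
Proof.
move=> ug pg /(congr1 val)/= eij; have [-> //|neq] := eqVneq i j.
apply/val_inj/eqP => /=; apply/negPn/negP => /rpt_third[k [a [b [e [ki kj e0 ek]]]]].
have [l ekl] : exists l, k = s l by exists (s^-1%g k); rewrite permKV.
have /orP[/eqP eli|/eqP elj] : (l == i) || (l == j).
- apply: (@rpt_edge (a / c i) (b / c j) (e / c l) i j l neq eij).
    by rewrite mulf_neq0 // invr_eq0; have [] := pg l.
  apply: (can_inj (mulKmx ug)); rewrite mulmxDr -!scalemxAr.
  have [ci ->] := pg i; have [cj ->] := pg j; have [cl ->] := pg l.
  by rewrite !scalerA !mulfVK // -ekl.
- by rewrite ekl eli eqxx in ki.
- by rewrite ekl elj eqxx in kj.
Qed.

(** The index of the tetrahedron of the image is read off one point of each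
    tetrahedron. *)
Lemma cubes_moves g : cremona_cubes g ->
  exists t : 'S_3, moves g t /\ moves (invmx g) (t^-1)%g.
Proof.
move=> cg; have ug := cg.1; have [s [c pg]] := cubes_permutes cg.
have pgi := permutes_inv ug pg.
have lt4 (b : 'I_3) : (4 * b < 12)%N by case: b => b /= b3; lia.
pose f b := tetra (s (Ordinal (lt4 b))).
have tetra4 b : tetra (Ordinal (lt4 b)) = b by apply/val_inj; rewrite /= mulKn.
have injf : injective f.
  move=> b b' /(permutes_tetra _ pgi); rewrite unitmx_inv !permK !tetra4.
  exact.
pose t := perm injf; have tE i : tetra (s i) = t (tetra i).
  by rewrite permE; apply: (permutes_tetra ug pg); rewrite tetra4.
exists t; split=> b v /blockP[i <- ->].
  have [ci ->] := pg i; exists (c i), (rpt (s i)); split=> //.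
  by apply/blockP; exists (s i).
have [ci ->] := pgi i; exists (c (s^-1%g i))^-1, (rpt (s^-1%g i)); split=> //.
apply/blockP; exists (s^-1%g i) => //; apply: (@perm_inj _ t).
by rewrite -tE !permKV.
Qed.

Lemma blocks_disjoint b b' v w (c : K) : c != 0 ->
  v \in block K b -> w \in block K b' -> v = c *: w -> b = b'.
Proof.
move=> c0 /blockP[i <- ->] /blockP[j <- ->]; rewrite -[rpt i]scale1r.
by move/rpt_inj_scale => /(_ (oner_neq0 K)) ->.
Qed.

(** * The orbit of the coordinate tetrahedron *)

Local Open Scope card_scope.

Lemma card_blocks (A : seq 'I_3) : uniq A ->
  [set p | exists2 b, b \in A & points (block K b) p] #= `I_(4 * size A).
Proof.
move=> uA; pose B := [pred i : 'I_12 | tetra i \in A].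
have -> : [set p | exists2 b, b \in A & points (block K b) p] =
    (fun i => pt (rpt i)) @` [set` B].
  apply/seteqP; split=> [p [b bA [v /blockP[i ei ->] <-]]|p [k kB <-]].
    by exists i => //; rewrite /= inE ei.
  by exists (tetra k) => //; exists (rpt k) => //; apply/blockP; exists k.
have injp : {in [set` B] &, injective (fun i => pt (rpt i))}.
  move=> i j _ _ /= /(pt_eq (rpt_neq0 i))[c c0]; rewrite -[rpt i]scale1r.
  by move/rpt_inj_scale; apply; apply: oner_neq0.
rewrite (card_eql (inj_card_eq injp)).
have -> : (4 * size A)%N = #|B|.
  rewrite -(card_uniqP uA) -!sum1_card (partition_big tetra (mem A)) => [|i] //.
  rewrite big_distrr; apply: eq_bigr => b bA; rewrite /= muln1.
  rewrite (eq_bigl (fun i => tetra i == b)) => [|i]; last first.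
    by rewrite inE; case: eqP => [->|]; rewrite ?bA ?andbF.
  by move: b bA; apply: ord3P => _; rewrite big_mkcond !big_ord_recl big_ord0.
have -> : [set` B] = enum_val @` [set: 'I_#|B|].
  apply/seteqP; split=> [i iB|_ [k _ <-]]; last exact: enum_valP.
  by exists (enum_rank_in iB i) => //; rewrite enum_rankK_in.
rewrite (card_eql (inj_card_eq _)) ?(card_esym card_II) //.
by move=> i j _ _; apply: enum_val_inj.
Qed.

Lemma orbit_blocks g (t : 'S_3) (A : seq 'I_3) :
  g \in unitmx -> moves g t -> moves (invmx g) (t^-1)%g ->
  (forall b, reflect (exists k : nat, b = iter k t bE) (b \in A)) ->
  coord_orbit g = [set p | exists2 b, b \in A & points (block K b) p].
Proof.
move=> ug gt gti AP.
have fwd b p : points (block K b) p -> points (block K (t b)) (pact g p).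
  move=> [v vb <-]; rewrite pact_pt; have [c [w [c0 wb ->]]] := gt _ _ vb.
  by rewrite pt_scale //; exists w.
have bwd b p : points (block K (t b)) p -> exists2 q, points (block K b) q & p = pact g q.
  move=> [w wb <-]; have [c [v [c0]]] := gti _ _ wb; rewrite permK => vb e.
  exists (pt v); first by exists v.
  by rewrite pact_pt -(pt_scale (g *m v) c0) scalemxAr -e mulKVmx.
apply/seteqP; split=> [_ [k [e eE ->]]|p [b /AP[k ->]]].
  exists (iter k t bE); first by apply/AP; exists k.
  by elim: k => //= k; apply: fwd.
move=> pk; suff [e eE ->] : exists2 e, points (block K bE) e & p = iter k (pact g) e.
  by exists k, e.
elim: k p pk => [|k IH] p; first by exists p.
by move=> /bwd[q /IH[e eE ->] ->]; exists e.
Qed.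

Lemma bE_cases (t : 'S_3) : [\/ t bE = bE, t bE != bE /\ t (t bE) = bE |
  [/\ t bE != bE, t (t bE) != bE & t (t (t bE)) = bE]].
Proof.
have [|t1] := eqVneq (t bE) bE; first by constructor 1.
have [|t2] := eqVneq (t (t bE)) bE; first by constructor 2.
constructor 3; split=> //; apply/eqP; apply: contraT => t3.
have: uniq [:: bE; t bE; t (t bE); t (t (t bE))].
  by rewrite /= !inE !negb_or !(inj_eq perm_inj) ![bE == _]eq_sym t1 t2 t3.
by move/card_uniqP => /= e; have := max_card (mem [:: bE; t bE; t (t bE); t (t (t bE))]); rewrite e card_ord.
Qed.

Lemma orbit_swap g (t : 'S_3) : g \in unitmx -> moves g t -> moves (invmx g) (t^-1)%g ->
  t (t bE) = bE ->
  coord_orbit g = [set p | exists2 b, b \in [:: bE; t bE] & points (block K b) p].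
Proof.
move=> ug gt gti t2; apply: (orbit_blocks ug gt gti) => b; rewrite !inE.
apply: (iffP orP) => [[]/eqP->|[k ->]]; first by exists 0%N.
  by exists 1%N.
by elim: k => [|k [] /eqP e] /=; rewrite ?e ?t2 eqxx; [left|right|left].
Qed.

Theorem orbit_card g (t : 'S_3) : g \in unitmx -> moves g t -> moves (invmx g) (t^-1)%g ->
  [\/ t bE = bE /\ coord_orbit g #= `I_4,
      [/\ t bE != bE, t (t bE) = bE & coord_orbit g #= `I_8] |
      [/\ t bE != bE, t (t bE) != bE, t (t (t bE)) = bE & coord_orbit g #= `I_12]].
Proof.
move=> ug gt gti; have orb A := @orbit_blocks g t A ug gt gti.
case: (bE_cases t) => [t1|[t1 t2]|[t1 t2 t3]]; [constructor 1|constructor 2|constructor 3].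
- split=> //; rewrite (orb [:: bE]) ?(card_eql (card_blocks _)) //.
  move=> b; rewrite inE; apply: (iffP eqP) => [->|[k ->]]; first by exists 0%N.
  by elim: k => //= k ->.
- split=> //; rewrite (orbit_swap ug gt gti t2) (card_eql (card_blocks _)) //=.
  by rewrite inE eq_sym t1.
have u3 : uniq [:: bE; t bE; t (t bE)].
  by rewrite /= !inE !negb_or (inj_eq perm_inj) ![bE == _]eq_sym t1 t2.
split=> //; rewrite (orb [:: bE; t bE; t (t bE)]) ?(card_eql (card_blocks _)) //.
move=> b; apply: (iffP idP) => [|_].
  by rewrite !inE => /or3P[] /eqP ->; [exists 0%N | exists 1%N | exists 2%N].
have /subset_cardP : #|mem [:: bE; t bE; t (t bE)]| = #|'I_3|.
  by rewrite (card_uniqP u3) card_ord.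
by move=> /(_ (subset_predT _)) ->.
Qed.

End Configuration.

(** * The Cremona-cubes group *)

Section Classification.

Variable K : numFieldType.
Implicit Types (g h : 'M[K]_4) (v s : 'cV[K]_4) (t : 'S_3).

Definition sign_mx s : 'M[K]_4 := diag_mx s^T.

Definition mirror (e : K) : 'cV[K]_4 := vec4 e 1 1 1.

(** For [e = 1] or [e = -1] the reflection with centre [mirror e] fixes the
    tetrahedron to which this point belongs and swaps the other two. *)
Definition reflection (e : K) : 'M[K]_4 := 1%:M - 2^-1 *: (mirror e *m (mirror e)^T).

Lemma mirror_dot e : e ^+ 2 = 1 -> (mirror e)^T *m mirror e = 4%:M.
Proof.
move=> e2; apply/matrixP => i j; rewrite !ord1 !mxE big4 /=.
by rewrite ![_^T _ _]mxE !vec4E mulr1n -expr2 e2; ring.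
Qed.

Lemma reflectionK e : e ^+ 2 = 1 -> reflection e *m reflection e = 1%:M.
Proof.
move=> e2; rewrite /reflection mulmxBr mulmx1 -scalemxAr mulmxBl mul1mx -scalemxAl.
rewrite mulmxA -(mulmxA _ (mirror e)^T) mirror_dot // mul_mx_scalar -scalemxAl scalerA.
have -> : 2^-1 * 4 = 2 :> K by field.
rewrite -{2}[mirror e *m _]scale1r -scalerBl scalerA.
have -> : 2^-1 * (1 - 2) = - 2^-1 :> K by field.
by rewrite scaleNr opprK subrK.
Qed.

Lemma reflectionE e v : reflection e *m v =
  v - (2^-1 * (e * v o0 0 + v o1 0 + v o2 0 + v o3 0)) *: mirror e.
Proof.
rewrite /reflection mulmxBl mul1mx -scalemxAl -mulmxA; congr (_ - _).
rewrite -scalerA -[X in _ = _ *: X]mul_mx_scalar; congr (_ *: (_ *m _)).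
apply/matrixP => i j; rewrite !ord1 !mxE big4 /= ![_^T _ _]mxE !vec4E.
by rewrite !mul1r mulr1n.
Qed.

Definition zreflection (e : int) (x : zpt) : zpt :=
  let u := e * x.1.1.1 + x.1.1.2 + x.1.2 + x.2 in
  (2 * x.1.1.1 - e * u, 2 * x.1.1.2 - u, 2 * x.1.2 - u, 2 * x.2 - u).

Lemma zvec_reflection (e : int) x :
  zvec K (zreflection e x) = 2 *: (reflection e%:~R *m zvec K x).
Proof.
rewrite reflectionE; apply/matrixP => i j; rewrite ord1.
by move: i; apply: ord4P; rewrite !mxE /= !(rmorphB, rmorphD, rmorphM) /=; field.
Qed.

(** The second index only adapts the check to [all_pairs]. *)
Definition zswaps (e : int) (t : nat -> nat) i (j : nat) := (j != 0)%N ||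
  has (fun k => (k %/ 4 == t (i %/ 4))%N && has (fun a =>
    zreflection e (zpoint i) == zcomb a 0 (zpoint k) (zpoint k))
    [:: 1; -1; 2; -2; 4; -4]) (iota 0 12).

Lemma moves_zswaps (e : int) (t : nat -> nat) (t' : 'S_3) :
  (forall b : 'I_3, t' b = t b :> nat) -> (forall i j : 'I_12, zswaps e t i j) ->
  moves (reflection e%:~R : 'M[K]_4) t'.
Proof.
move=> tt' zs b v /blockP[i <- ->]; have := zs i ord0; rewrite /zswaps orFb.
case/hasP=> k k12 /andP[/eqP tk /hasP[a a6 /eqP e2]].
have lt_k : (k < 12)%N by move: k12; rewrite mem_iota.
exists (2^-1 * a%:~R), (rpt K (Ordinal lt_k)); split.
- rewrite mulf_neq0 ?invr_eq0 ?pnatr_eq0 // intr_eq0.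
  by apply: contraTneq a6 => ->.
- by apply/blockP; exists (Ordinal lt_k) => //; apply/val_inj; rewrite [RHS]tt' /= tk.
have n2 : 2 != 0 :> K by rewrite pnatr_eq0.
apply: (scalerI n2); rewrite /rpt -zvec_reflection e2 zvec_comb scale0r addr0.
by rewrite scalerA mulrA mulfV // mul1r.
Qed.

Lemma reflection_moves_EP : moves (reflection 1 : 'M[K]_4) (tperm bE bP).
Proof.
apply: (@moves_zswaps 1 (fun b => nth 0 [:: 1; 0; 2] b)%N) => [|i j].
  by apply: ord3P; rewrite ?tpermL ?tpermR ?tpermD.
by apply: all_pairs; vm_compute.
Qed.

Lemma reflection_moves_EQ : moves (reflection (-1) : 'M[K]_4) (tperm bE bQ).
Proof.
rewrite -[-1]/((-1)%:~R : K).
apply: (@moves_zswaps (-1) (fun b => nth 0 [:: 2; 1; 0] b)%N) => [|i j].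
  by apply: ord3P; rewrite ?tpermL ?tpermR ?tpermD.
by apply: all_pairs; vm_compute.
Qed.

Lemma moves_mul g h t t' : moves g t -> moves h t' -> moves (g *m h) (t' * t)%g.
Proof.
move=> gt ht b v /ht[c [w [c0 /gt[d [u [d0 ub eu]]] ew]]].
exists (c * d), u; split; rewrite ?mulf_neq0 ?permM //.
by rewrite -mulmxA ew -scalemxAr eu scalerA.
Qed.

Definition monomial_form (b : 'I_3) g := exists (c : K) s (p : 'S_4),
  [/\ c != 0, s \in block K b & g = c *: (sign_mx s *m perm_mx p)].

(** A matrix fixing the coordinate tetrahedron permutes the coordinate vectors up
    to factors; these are read off the image of the point with all coordinates 1,
    which is a sign vector. *)
Lemma moves_monomial g t : moves g t -> t bE = bE -> monomial_form (t bQ) g.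
Proof.
move=> gt tE; have qb : vec4 1 1 1 1 \in block K bQ by rewrite !inE eqxx !orbT.
have [c [s [c0 sb es]]] := gt _ _ qb.
have nE : t bQ != bE by rewrite -tE (inj_eq perm_inj).
have sv := block_sign nE sb.
have /fin_all_exists[a /fin_all_exists[f ef]] j :
    exists (a : K) i, g *m cvec K j = a *: cvec K i.
  have [a [w [_ wb ->]]] := gt _ _ (cvec_blockE K j); rewrite tE in wb.
  by have [i ->] := blockE_cvec wb; exists a, i.
have sumE : vec4 1 1 1 1 = \sum_j cvec K j.
  apply/matrixP => i k; rewrite ord1 summxE (bigD1 i) //= big1 => [|j neq].
    by rewrite addr0 !mxE !eqxx /=; move: i; apply: ord4P.
  by rewrite mxE eq_sym (negbTE neq).
have gE i : c * s i 0 = \sum_j a j * (i == f j)%:R.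
  rewrite -colZE -es sumE mulmx_sumr summxE; apply: eq_bigr => j _.
  by rewrite ef colZE mxE eqxx andbT.
have surj i : exists j, f j = i.
  apply: contrapT => /forallNP nf.
  have /eqP := gE i; rewrite big1 ?mulf_eq0 ?(negbTE c0) ?(negbTE (sign_vec_neq0 i sv)) //.
  by move=> j _; case: eqP => [e|_]; rewrite ?mulr0 //; case: (nf j).
have [f' f'K] := fin_all_exists surj.
have [f2 _ f2K] := injF_bij (can_inj f'K).
have injf : injective f by move=> j k; rewrite -(f2K j) -(f2K k) !f'K => ->.
exists c, s, (perm injf)^-1%g; split=> //; apply/matrixP => i j.
rewrite mxE mul_diag_mx !mxE.
have -> : g i j = (g *m cvec K j) i 0 by rewrite -colE mxE.
have -> : ((perm injf)^-1%g i == j) = (i == f j).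
  by rewrite -(inj_eq (@perm_inj _ (perm injf))) permKV permE.
rewrite ef colZE mxE eqxx andbT; case: eqP => [->|_]; last by rewrite !mulr0.
rewrite !mulr1 gE (bigD1 j) //= eqxx mulr1 big1 ?addr0 // => k neq.
by rewrite (inj_eq injf) eq_sym (negbTE neq) mulr0.
Qed.

(** A reflection brings the coordinate tetrahedron back to its place; what is
    left is a signed permutation of the coordinates. *)
Theorem moves_forms g t : moves g t ->
  [\/ t bE = bE /\ monomial_form (t bQ) g,
      t bE = bP /\ exists2 h, g = reflection 1 *m h & monomial_form (tperm bE bP (t bQ)) h |
      t bE = bQ /\ exists2 h, g = reflection (-1) *m h & monomial_form (tperm bE bQ (t bQ)) h].
Proof.
move=> gt; have inv e : e ^+ 2 = 1 -> g = reflection e *m (reflection e *m g).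
  by move=> e2; rewrite mulmxA reflectionK // mul1mx.
have red e b : e ^+ 2 = 1 -> moves (reflection e : 'M[K]_4) (tperm bE b) -> t bE = b ->
    exists2 h, g = reflection e *m h & monomial_form (tperm bE b (t bQ)) h.
  move=> e2 mr tb; exists (reflection e *m g); first exact: inv.
  by have := moves_monomial (moves_mul mr gt); rewrite !permM tb tpermR; apply.
have [tb|[tb|tb]] : t bE = bE \/ t bE = bP \/ t bE = bQ.
  by move: (t bE); apply: ord3P; [left | right; left | right; right].
- by constructor 1; split=> //; apply: moves_monomial gt tb.
- by constructor 2; split=> //; apply: red reflection_moves_EP _ => //; rewrite expr1n.
- by constructor 3; split=> //; apply: red reflection_moves_EQ _ => //; rewrite sqrrN expr1n.
Qed.

End Classification.

(** * Linear actions by signed permutations *)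

Section SignedAction.

Variable K : numFieldType.
Local Notation M := {mpoly K[4]}.
Implicit Types (g h : 'M[K]_4) (s : 'cV[K]_4) (p q : M).

(** Linear maps of this kind permute the squares of the forms [f i], which is what
    makes the symmetric functions of these squares invariant. *)
Definition signed_act n (f : 'I_n -> M) h :=
  exists w : 'S_n, forall i, exists b : bool, msub h (f i) = (-1) ^+ b *: f (w i).

Lemma signed_act_mul n (f : 'I_n -> M) g h :
  signed_act f g -> signed_act f h -> signed_act f (g *m h).
Proof.
move=> [w ew] [w' ew']; exists (w * w')%g => i; have [b eb] := ew i.
have [b' eb'] := ew' (w i); exists (b (+) b').
by rewrite -msubM eb linearZ /= eb' scalerA -signr_addb permM.
Qed.

Lemma signed_act_inv n (f : 'I_n -> M) g : g \in unitmx ->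
  signed_act f g -> signed_act f (invmx g).
Proof.
move=> ug [w ew]; exists w^-1%g => i; have [b eb] := ew (w^-1%g i); exists b.
rewrite permKV in eb; rewrite -[f (w^-1%g i)](msubK ug) eb linearZ /= scalerA.
by rewrite -signr_addb addbb scale1r.
Qed.

(** It is enough to treat transpositions. *)
Lemma perm_mx_ind (P : 'M[K]_4 -> Prop) :
  P 1%:M -> (forall g h, P g -> P h -> P (g *m h)) ->
  (forall i j : 'I_4, (i < j)%N -> P (perm_mx (tperm i j))) ->
  forall p : 'S_4, P (perm_mx p).
Proof.
move=> P1 PM ht p; have [ts -> {p}] := prod_tpermP p.
have {}ht i j : i != j -> P (perm_mx (tperm i j)).
  by rewrite neq_ltn => /orP[/ht //|/ht]; rewrite tpermC.
elim: ts => [_|[i j] ts IH /andP[neq /IH hts]]; first by rewrite big_nil perm_mx1.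
by rewrite big_cons perm_mxM; apply: PM (ht _ _ neq) hts.
Qed.

Lemma signed_act1 n (f : 'I_n -> M) : signed_act f 1%:M.
Proof. by exists 1%g => i; exists false; rewrite msub1 scale1r perm1. Qed.

Lemma signed_act_perm n (f : 'I_n -> M) :
  (forall i j : 'I_4, (i < j)%N -> signed_act f (perm_mx (tperm i j))) ->
  forall p : 'S_4, signed_act f (perm_mx p).
Proof. exact: perm_mx_ind (signed_act1 f) (@signed_act_mul _ f). Qed.

Lemma msub_perm (p : 'S_4) i : msub (perm_mx p : 'M[K]_4) 'X_i = 'X_(p i).
Proof.
rewrite /msub comp_mpolyXt tnth_linear (bigD1 (p i)) //= big1 => [|j neq].
  by rewrite addr0 !mxE eqxx scale1r.
by rewrite !mxE eq_sym (negbTE neq) scale0r.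
Qed.

Lemma msub_sign s i : msub (sign_mx s) 'X_i = s i 0 *: 'X_i.
Proof.
rewrite /msub comp_mpolyXt tnth_linear (bigD1 i) //= big1 => [|j neq].
  by rewrite addr0 !mxE eqxx mulr1n.
by rewrite !mxE eq_sym (negbTE neq) mulr0n scale0r.
Qed.

Lemma msub_reflection (e : K) i : msub (reflection e) 'X_i =
  'X_i - (2^-1 * mirror e i 0)%:MP * (e%:MP * 'X_o0 + 'X_o1 + 'X_o2 + 'X_o3).
Proof.
rewrite /msub comp_mpolyXt tnth_linear.
have -> : 'X_i = \sum_j (i == j)%:R *: 'X_j :> M.
  rewrite (bigD1 i) //= big1 ?addr0 ?eqxx ?scale1r // => j neq.
  by rewrite eq_sym (negbTE neq) scale0r.
rewrite !big4 /= !mxE !big_ord1 !mxE /=.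
rewrite -!mul_mpolyC !rmorphB !rmorphM /= !mpolyC1; ring.
Qed.

End SignedAction.

(** * Covariant linear systems *)

Section Covariance.

Variable K : numFieldType.
Local Notation M := {mpoly K[4]}.
Local Notation c3 := (cremona K).
Local Notation X := (xprod K).
Implicit Types (p q u : M) (F G : rmap K) (g h : 'M[K]_4).

Lemma valZ d c (W : dhomog 4 K d) : val (c *: W) = c *: val W.
Proof. by []. Qed.

Lemma valD d (W W' : dhomog 4 K d) : val (W + W') = val W + val W'.
Proof. by []. Qed.

Lemma val_sumZ d n (c : 'I_n -> K) (W : 'I_n -> dhomog 4 K d) :
  val (\sum_i c i *: W i) = \sum_i c i *: val (W i).
Proof. by rewrite raddf_sum. Qed.

Lemma span_ind (V : vectType K) n (f : 'I_n -> V) (W : V) (P : V -> Prop) :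
  P 0 -> (forall a x y, P x -> P y -> P (a *: x + y)) -> (forall i, P (f i)) ->
  W \in <<[tuple f i | i < n]>>%VS -> P W.
Proof.
move=> P0 PD Pf /coord_span ->; elim/big_rec: _ => // i x _ Px.
by apply: PD Px; rewrite -tnth_nth tnth_mktuple.
Qed.

(** Stability of [V] makes the induced linear map an automorphism by injectivity
    and dimension; the divisor [D] is that of [A]. *)
Lemma covariant_intro F G e d a (A : dhomog 4 K a) (V : {vspace dhomog 4 K d}) :
  rmap_inverse F G -> coprime_forms e G -> A != 0 ->
  (forall W : dhomog 4 K d, (val W \mPo G) = 0 -> W = 0) ->
  (forall W, W \in V -> exists2 W' : dhomog 4 K d, W' \in V & (val W \mPo G) = val A * val W') ->
  covariant F V.
Proof.
move=> FG cG A0 injG VG; exists G, e; split=> //.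
pose b := vbasis V.
have /fin_all_exists[c cE] i : exists c : dhomog 4 K d, c \in V /\
    (val (tnth b i) \mPo G) = val A * val c.
  by have [|c cV ec] := VG (tnth b i); [apply: vbasis_mem (mem_tnth _ _) | exists c].
pose f0 (W : dhomog 4 K d) : dhomog 4 K d := \sum_i coord b i W *: c i.
have f0lin : linear f0.
  move=> k x y; rewrite /f0 scaler_sumr -big_split; apply: eq_bigr => i _ /=.
  by rewrite linearP /= scalerDl scalerA.
pose f0L := GRing.isLinear.Build _ _ _ _ f0 f0lin.
pose f1 : {linear dhomog 4 K d -> dhomog 4 K d} := HB.pack f0 f0L.
pose f : 'End(dhomog 4 K d) := linfun f1.
have fE W : f W = f0 W by rewrite lfunE.
have fV W : W \in V -> (val W \mPo G) = val A * val (f W).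
  move=> WV; rewrite fE /f0 {1}(coord_vbasis WV) !val_sumZ raddf_sum mulr_sumr.
  apply: eq_bigr => i _; rewrite [LHS]comp_mpolyZ -(tnth_nth 0 b i).
  by rewrite (cE i).2 -scalerAr.
have sub : (f @: V <= V)%VS.
  apply/subvP => _ /memv_imgP[W WV ->]; rewrite fE; apply: rpred_sum => i _.
  by apply: rpredZ; have [] := cE i.
have kerf : (V :&: lker f)%VS = 0%VS.
  apply/eqP; rewrite -subv0; apply/subvP => W; rewrite memv_cap memv_ker.
  case/andP=> WV /eqP fW0; rewrite memv0; apply/eqP/injG.
  by rewrite (fV _ WV) fW0 raddf0 mulr0.
exists a, 0%N, A, (DHomog (dhomog1 K [measure of @mdeg 4])), f; split=> //.
- by rewrite -val_eqE; apply: oner_neq0.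
- by apply/eqP; rewrite eqEdim sub (limg_dim_eq kerf) leqnn.
by move=> W WV; rewrite /= mulr1 fV.
Qed.

Definition cubes_inverse (b : bool) g : rmap K :=
  if b then rmap_comp c3 (linear_rmap (invmx g)) else rmap_comp (linear_rmap (invmx g)) c3.

Lemma rmap_eq_mul u F G : u != 0 -> (exists i, tnth G i != 0) ->
  (forall i, tnth F i = u * tnth G i) -> rmap_eq F G.
Proof.
move=> u0 [k Gk] e; split; [exists k | exists k => // | move=> i j]; first by rewrite e mulf_neq0.
by rewrite !e; ring.
Qed.

Lemma linear_comp_scale g u F G : (forall i, tnth F i = u * tnth G i) ->
  forall i, tnth (rmap_comp (linear_rmap g) F) i = u * tnth (rmap_comp (linear_rmap g) G) i.
Proof.
move=> e i; rewrite !tnth_comp -[u]expr1; apply: comp_mpoly_scale => //.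
exact: linear_homog.
Qed.

Lemma cubes_inverseP b g : g \in unitmx -> rmap_inverse (cremona_cubes_map b g) (cubes_inverse b g).
Proof.
move=> ug; have id0 : exists i, tnth (rmap_id K) i != 0.
  by exists o0; rewrite tnth_mktuple coord_neq0.
have X20 : X ^+ 2 != 0 by rewrite expf_neq0 ?xprod_neq0.
have c3c3 i : tnth (rmap_comp c3 c3) i = X ^+ 2 * tnth (rmap_id K) i.
  by rewrite tnth_comp cremona_cremona tnth_mktuple.
have lin_c3c3 h i : tnth (rmap_comp (linear_rmap h) (rmap_comp c3 c3)) i =
    X ^+ 2 * tnth (linear_rmap h) i.
  by rewrite (linear_comp_scale h c3c3) rmap_comp_idr.
have sandwich h k : h *m k = 1%:M -> k \in unitmx ->
    rmap_eq (rmap_comp (rmap_comp (linear_rmap h) (rmap_comp c3 c3)) (linear_rmap k)) (rmap_id K).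
  move=> hk uk; apply: (@rmap_eq_mul (msub k (X ^+ 2))) => // [|i]; first by rewrite msub_eq0.
  by rewrite tnth_comp lin_c3c3 rmorphM /= -tnth_comp linear_comp hk linear1.
have middle h k : h *m k = 1%:M ->
    rmap_eq (rmap_comp c3 (rmap_comp (rmap_comp (linear_rmap h) (linear_rmap k)) c3)) (rmap_id K).
  by move=> hk; rewrite linear_comp hk linear1 rmap_comp_idl; apply: rmap_eq_mul c3c3.
have ui : invmx g \in unitmx by rewrite unitmx_inv.
split; case: b; rewrite /cremona_cubes_map /cubes_inverse ?rmap_compA.
- by have := sandwich _ _ (mulmxV ug) ui; rewrite !rmap_compA.
- by have := middle _ _ (mulmxV ug); rewrite !rmap_compA.
- by have := middle _ _ (mulVmx ug); rewrite !rmap_compA.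
- by have := sandwich _ _ (mulVmx ug) ug; rewrite !rmap_compA.
Qed.

Lemma cremona_linear_coprime h : h \in unitmx ->
  coprime_forms 3 (rmap_comp (linear_rmap h) c3).
Proof.
move=> uh; have [F' [[hF pF _] eF]] := state_cremona (state_linear uh).
rewrite (_ : rmap_comp _ _ = F'); first exact: primitive_coprime.
by apply: eq_from_tnth => i; rewrite tnth_comp eF expr0 mul1r.
Qed.

Lemma linear_cremona_coprime h : h \in unitmx ->
  coprime_forms 3 (rmap_comp c3 (linear_rmap h)).
Proof.
move=> uh; have [F' [[hF pF _] eF]] := state_cremona (state_linear (unitmx1 K 4)).
have -> : c3 = F'.
  rewrite linear1 in eF; apply: eq_from_tnth => i.
  by have := eF i; rewrite tnth_mktuple comp_mpolyXt expr0 mul1r.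
apply: primitive_coprime; last exact: primitive_msub.
by move=> i; rewrite tnth_comp; apply: msub_homog.
Qed.

Lemma cubes_map_coprime b g : g \in unitmx -> coprime_forms 3 (cremona_cubes_map b g).
Proof.
by case: b => ug; [apply: cremona_linear_coprime | apply: linear_cremona_coprime].
Qed.

(** The pull-back by the inverse is composed of those by [invmx g] and by [c_3], so
    that these can be treated separately for both orders of composition. *)
Lemma covariant_cubes b g d k (V : {vspace dhomog 4 K d}) : g \in unitmx ->
  (forall W, W \in V -> exists2 W' : dhomog 4 K d, W' \in V & msub (invmx g) (val W) = val W') ->
  (forall W, W \in V -> exists2 W' : dhomog 4 K d, W' \in V & (val W \mPo c3) = X ^+ k * val W') ->
  covariant (cremona_cubes_map b g) V.
Proof.
move=> ug Vg Vc; have ui : invmx g \in unitmx by rewrite unitmx_inv.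
have hX : X ^+ k \is (4 * k).-homog by apply/dhomogMn/xprod_homog.
have X0 : X ^+ k != 0 by rewrite expf_neq0 ?xprod_neq0.
case: b.
  have hA := msub_homog (invmx g) hX.
  apply: (@covariant_intro _ (cubes_inverse true g) 3 _ _ (DHomog hA)).
  - exact: (cubes_inverseP true ug).
  - exact: linear_cremona_coprime.
  - by rewrite -val_eqE; have := X0; rewrite -(msub_eq0 _ ui).
  - move=> W; rewrite -comp_mpolyA => /eqP; rewrite -[_ == _]/(msub _ _ == 0) msub_eq0 //.
    by move/eqP/(cremona_comp_eq0 (dhomog_is_dhomog W)) => W0; apply/val_inj.
  move=> W /Vc[W1 W1V e1]; have [W2 W2V e2] := Vg _ W1V; exists W2 => //.
  by rewrite -comp_mpolyA e1 rmorphM /= -e2.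
apply: (@covariant_intro _ (cubes_inverse false g) 3 _ _ (DHomog hX)).
- exact: (cubes_inverseP false ug).
- exact: cremona_linear_coprime.
- by rewrite -val_eqE; apply: X0.
- move=> W; rewrite -comp_mpolyA => /(cremona_comp_eq0 (msub_homog _ (dhomog_is_dhomog W))).
  by move/eqP; rewrite msub_eq0 // => /eqP W0; apply/val_inj.
move=> W /Vg[W1 W1V e1]; have [W2 W2V e2] := Vc _ W1V; exists W2 => //.
by rewrite -comp_mpolyA -/(msub _ _) e1 e2.
Qed.

Definition span_system d n (f : 'I_n -> dhomog 4 K d) : {vspace dhomog 4 K d} :=
  <<[tuple f i | i < n]>>%VS.

Lemma mem_span_system d n (f : 'I_n -> dhomog 4 K d) i : f i \in span_system f.
Proof. by apply/memv_span/tnthP; exists i; rewrite tnth_mktuple. Qed.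

Lemma span_system_stable d n (f : 'I_n -> dhomog 4 K d) F u :
  (forall i, exists c j, (val (f i) \mPo F) = u * val (c *: f j)) ->
  forall W, W \in span_system f ->
  exists2 W' : dhomog 4 K d, W' \in span_system f & (val W \mPo F) = u * val W'.
Proof.
move=> hf W; pose P (W : dhomog 4 K d) := exists2 W' : dhomog 4 K d,
  W' \in span_system f & (val W \mPo F) = u * val W'.
apply: (@span_ind _ _ f W P) => [|a x y [x' x'V ex] [y' y'V ey]|i].
- by exists 0; rewrite ?mem0v // !raddf0 mulr0.
- exists (a *: x' + y'); first by rewrite rpredD ?rpredZ.
  by rewrite !valD !valZ raddfD /= comp_mpolyZ ex ey mulrDr -scalerAr.
by have [c [j e]] := hf i; exists (c *: f j); rewrite ?rpredZ ?mem_span_system.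
Qed.

(** Evaluation at suitable points separates the generators. *)
Lemma span_system_dim d n (f : 'I_n -> dhomog 4 K d) (v : 'I_n -> 'cV[K]_4) :
  (forall i, (val (f i)).@[(v i)^~ 0] != 0) ->
  (forall i j, i != j -> (val (f i)).@[(v j)^~ 0] = 0) -> \dim (span_system f) = n.
Proof.
move=> f1 f0; have /eqnP -> : free [tuple f i | i < n]; last by rewrite size_tuple.
apply/freeP => c e j.
have {}e : \sum_i c i *: f i = 0.
  by rewrite -[RHS]e; apply: eq_bigr => i _; rewrite -tnth_nth tnth_mktuple.
have := congr1 (fun W : dhomog 4 K d => (val W).@[(v j)^~ 0]) e.
rewrite val_sumZ raddf_sum [RHS]raddf0 (bigD1 j) //= big1 => [|i neq]; last first.
  by rewrite mevalZ f0 ?mulr0.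
by rewrite addr0 mevalZ => /eqP; rewrite mulf_eq0 (negbTE (f1 j)) orbF => /eqP.
Qed.

Lemma covariant_scaled b h c d n k (f : 'I_n -> dhomog 4 K d) : h \in unitmx -> c != 0 ->
  (forall i, exists e j, msub (invmx h) (val (f i)) = e *: val (f j)) ->
  (forall i, exists e j, (val (f i) \mPo c3) = X ^+ k * val (e *: f j)) ->
  covariant (cremona_cubes_map b (c *: h)) (span_system f).
Proof.
move=> uh c0 sf cf; have ug : c *: h \in unitmx by rewrite unitmxZ ?unitfE.
apply: (covariant_cubes b ug _ (span_system_stable cf)) => W WV.
have [|W' W'V e] := @span_system_stable _ _ f (linear_rmap (invmx (c *: h))) 1 _ W WV.
  move=> i; have [e [j ej]] := sf i; exists (c^-1 ^+ d * e), j; rewrite mul1r.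
  rewrite -[LHS]/(msub _ _) invmxZ ?unitfE // (msub_scale _ _ (dhomog_is_dhomog _)) ej.
  by rewrite scalerA.
by exists W' => //; rewrite /msub e mul1r.
Qed.

(** * Invariants *)

(** Numerator and denominator are multiplied by the same factor, under [g] and
    under [c_3]. *)
Lemma ratfun_invariant_cubes b g (r : ratfun K) (c : K) u : g \in unitmx -> c != 0 -> u != 0 ->
  msub g (val (ratnum r)) = c *: val (ratnum r) -> msub g (val (ratden r)) = c *: val (ratden r) ->
  (val (ratnum r) \mPo c3) = u * val (ratnum r) -> (val (ratden r) \mPo c3) = u * val (ratden r) ->
  ratfun_invariant (cremona_cubes_map b g) r.
Proof.
move=> ug c0 u0 gN gD cN cD; have D0 : val (ratden r) != 0 by rewrite (ratden_neq0 r).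
case: b; rewrite /ratfun_invariant /cremona_cubes_map -!comp_mpolyA -?/(msub _ _).
  rewrite gN gD !linearZ /= cN cD; split; last by rewrite -!mul_mpolyC; ring.
  by rewrite scaler_eq0 negb_or c0 mulf_neq0.
rewrite cN cD !rmorphM /= gN gD; split; last by rewrite -!mul_mpolyC; ring.
by rewrite mulf_neq0 ?msub_eq0 // scaler_eq0 negb_or c0.
Qed.

End Covariance.

(** * Functional independence *)

Section Independence.

Variable K : numFieldType.
Local Notation M := {mpoly K[4]}.
Implicit Types (p q u : M) (v : 'cV[K]_4) (r : ratfun K).

Lemma mderiv_homog d p i : p \is d.-homog -> p^`M(i) \is d.-1.-homog.
Proof.
move=> hp; apply/dhomogP => m; rewrite mcoeff_msupp mcoeff_deriv mulrn_eq0 /= => hm.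
have /(_ (m + U_(i))%MM) := dhomog_mf hp; rewrite mcoeff_msupp => /(_ hm) /= <-.
by rewrite mdegD mdeg1 addn1.
Qed.

Lemma dhomog_bigprod n (F : 'I_n -> M) (e : 'I_n -> nat) :
  (forall i, F i \is (e i).-homog) -> \prod_i F i \is (\sum_i e i)%N.-homog.
Proof.
move=> hF; elim/big_rec2: _ => [|i d p _ hp]; first exact: dhomog1.
exact: dhomogM.
Qed.

Definition jacobian_num r (i : 'I_4) : M :=
  (val (ratnum r))^`M(i) * val (ratden r) - val (ratnum r) * (val (ratden r))^`M(i).

Lemma jacobian_num_homog r i :
  jacobian_num r i \is ((ratdeg r).-1 + ratdeg r)%N.-homog.
Proof.
have hN := dhomog_is_dhomog (ratnum r); have hD := dhomog_is_dhomog (ratden r).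
apply: rpredB; first exact: dhomogM (mderiv_homog i hN) hD.
by rewrite addnC; apply: dhomogM hN (mderiv_homog i hD).
Qed.

(** A minor of the Jacobian that is not zero at one point is not zero on the
    complement of a surface, of which [h] is the equation together with the
    denominators. *)
Lemma functionally_independent_at k (r : 'I_k -> ratfun K) (f : 'I_k -> 'I_4) v :
  (forall j, (val (ratden (r j))).@[v^~ 0] != 0) ->
  \det (\matrix_(j, l) (jacobian_num (r j) (f l)).@[v^~ 0]) != 0 ->
  functionally_independent r.
Proof.
move=> den0 det0; pose N : 'M[M]_k := \matrix_(j, l) jacobian_num (r j) (f l).
have evN w : (\det N).@[w^~ 0] = \det (\matrix_(j, l) (jacobian_num (r j) (f l)).@[w^~ 0]).
  by rewrite -det_map_mx; congr (\det _); apply/matrixP => j l; rewrite !mxE.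
have hN : \det N \is (\sum_j ((ratdeg (r j)).-1 + ratdeg (r j)))%N.-homog.
  apply: rpred_sum => s _; rewrite mulr_sign; case: ifP => _; rewrite ?rpredN;
    by apply: dhomog_bigprod => j; rewrite mxE; apply: jacobian_num_homog.
have hD : \prod_j val (ratden (r j)) \is (\sum_j ratdeg (r j))%N.-homog.
  by apply: dhomog_bigprod => j; apply: dhomog_is_dhomog.
exists _, (DHomog (dhomogM hD hN)); split=> [|w].
  rewrite -val_eqE; apply/eqP => /(congr1 (meval (v^~ 0))) /= /eqP.
  rewrite mevalM evN raddf0 mulf_eq0 (negbTE det0) orbF rmorph_prod.
  by apply/negP/prodf_neq0 => j _; apply: den0.
rewrite /= mevalM evN mulf_eq0 negb_or rmorph_prod => /andP[/prodf_neq0 dw detw].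
split=> [j|]; first exact: dw.
apply/eqP; rewrite eqn_leq rank_leq_row /=.
pose D : 'rV[K]_k := \row_j ((val (ratden (r j))).@[w^~ 0] ^+ 2)^-1.
have e : ratfun_jacobian r w *m colsub f 1%:M =
    diag_mx D *m \matrix_(j, l) (jacobian_num (r j) (f l)).@[w^~ 0].
  rewrite mulmx_colsub mulmx1; apply/matrixP => j l.
  by rewrite mul_diag_mx !mxE mulrC mevalB !mevalM.
apply: leq_trans (mxrankM_maxl _ (colsub f 1%:M)); rewrite e mxrank_unit //.
rewrite unitmxE unitfE det_mulmx det_diag mulf_neq0 //.
by apply/prodf_neq0 => j _; rewrite mxE invr_eq0 expf_neq0 ?dw.
Qed.

Lemma det2 (R : comNzRingType) (A : 'M[R]_2) :
  \det A = A 0 0 * A (lift 0 0) (lift 0 0) - A 0 (lift 0 0) * A (lift 0 0) 0.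
Proof.
rewrite (expand_det_row _ ord0) !big_ord_recl big_ord0 /cofactor !det_mx11 !mxE.
rewrite /bump /= expr0 expr1 (_ : lift (lift 0 0) 0 = 0 :> 'I_2); last exact/val_inj.
by ring.
Qed.

Lemma det3 (R : comNzRingType) (A : 'M[R]_3) (a : nat -> nat -> R) :
  (forall i j : 'I_3, A i j = a i j) ->
  \det A = a 0%N 0%N * (a 1%N 1%N * a 2%N 2%N - a 1%N 2%N * a 2%N 1%N) - a 0%N 1%N * (a 1%N 0%N * a 2%N 2%N - a 1%N 2%N * a 2%N 0%N)
    + a 0%N 2%N * (a 1%N 0%N * a 2%N 1%N - a 1%N 1%N * a 2%N 0%N).
Proof.
move=> eA; rewrite (expand_det_row _ ord0) !big_ord_recl big_ord0 /cofactor.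
rewrite !det2 !mxE !eA /bump /= expr0 expr1; ring.
Qed.

End Independence.

(** * Explicit forms *)

(** The covariant forms and the invariants are given by expressions, so that
    their degrees, and their values and derivatives at integer points, are
    obtained by computation. *)
Inductive form :=
  | FVar of 'I_4 | FAdd of form & form | FMul of form & form | FOpp of form.

Declare Scope form_scope.
Delimit Scope form_scope with F.
Bind Scope form_scope with form.
Infix "+" := FAdd : form_scope.
Infix "*" := FMul : form_scope.
Notation "- e" := (FOpp e) : form_scope.
Notation "e - f" := (FAdd e (FOpp f)) : form_scope.

Fixpoint fval (R : comNzRingType) (x : 'I_4 -> R) (e : form) : R :=
  match e with
  | FVar i => x i
  | FAdd a b => fval x a + fval x b
  | FMul a b => fval x a * fval x b
  | FOpp a => - fval x a
  end.

Fixpoint fder (R : comNzRingType) (x : 'I_4 -> R) (i : 'I_4) (e : form) : R :=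
  match e with
  | FVar j => (j == i)%:R
  | FAdd a b => fder x i a + fder x i b
  | FMul a b => fder x i a * fval x b + fval x a * fder x i b
  | FOpp a => - fder x i a
  end.

Fixpoint fdeg (e : form) : option nat :=
  match e with
  | FVar _ => Some 1%N
  | FAdd a b => if (fdeg a, fdeg b) is (Some m, Some n) then
                  if m == n then Some m else None else None
  | FMul a b => if (fdeg a, fdeg b) is (Some m, Some n) then Some (m + n)%N else None
  | FOpp a => fdeg a
  end.

Lemma fval_morph (R S : comNzRingType) (f : {rmorphism R -> S}) x e :
  f (fval x e) = fval (fun i => f (x i)) e.
Proof.
by elim: e => //= [a <- b <-|a <- b <-|a <-]; rewrite ?(rmorphD, rmorphM, rmorphN).
Qed.

Lemma fder_morph (R S : comNzRingType) (f : {rmorphism R -> S}) x i e :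
  f (fder x i e) = fder (fun i => f (x i)) i e.
Proof.
elim: e => //= [j|a <- b <-|a <- b <-|a <-]; first exact: rmorph_nat.
- exact: rmorphD.
- by rewrite rmorphD !rmorphM /= !fval_morph.
- exact: rmorphN.
Qed.

Lemma eq_fval (R : comNzRingType) (x y : 'I_4 -> R) e : x =1 y -> fval x e = fval y e.
Proof. by move=> exy; elim: e => //= [a -> b ->|a -> b ->|a ->]. Qed.

Lemma eq_fder (R : comNzRingType) (x y : 'I_4 -> R) i e : x =1 y -> fder x i e = fder y i e.
Proof.
by move=> exy; elim: e => //= [a -> b ->|a -> b ->|a ->] //; rewrite !(eq_fval _ exy).
Qed.

(** The numerator of the derivative of the quotient of two forms. *)
Definition fminor (a b : form) (x : 'I_4 -> BinNums.Z) (i : 'I_4) : BinNums.Z :=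
  fder x i a * fval x b - fval x a * fder x i b.

Section FormPolynomials.

Variable K : numFieldType.
Local Notation M := {mpoly K[4]}.
Local Notation c3 := (cremona K).

Definition fpoly (e : form) : M := fval (fun i => 'X_i) e.

Lemma fpoly_comp e (F : rmap K) : fpoly e \mPo F = fval (tnth F) e.
Proof. by rewrite /fpoly fval_morph; apply: eq_fval => i; rewrite /= comp_mpolyXt. Qed.

Lemma fpoly_msub e h : msub h (fpoly e) = fval (fun i => msub h 'X_i) e.
Proof. by rewrite /fpoly fval_morph. Qed.

Lemma fpoly_deriv e i : (fpoly e)^`M(i) = fder (fun j => 'X_j) i e.
Proof.
elim: e => [j|a IHa b IHb|a IHa b IHb|a IHa] /=.
- rewrite /fpoly /= mderivX mnm1E; case: eqP => [->|_]; last by rewrite scale0r.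
  by rewrite scale1r (_ : (_ - _)%MM = 0%MM) ?mpolyX0 //; apply/mnmP => k; rewrite !mnmE subnn.
- by rewrite -IHa -IHb -mderivD.
- by rewrite -IHa -IHb -mderivM.
- by rewrite -IHa -mderivN.
Qed.

Lemma fdegP e d : fdeg e = Some d -> fpoly e \is d.-homog.
Proof.
rewrite /fpoly; elim: e d => [j|a IHa b IHb|a IHa b IHb|a IHa] d /=.
- by case=> <-; apply: coord_homog.
- case: (fdeg a) IHa => // m IHa; case: (fdeg b) IHb => // n IHb.
  by case: eqP => // en [<-]; rewrite rpredD ?IHa ?IHb ?en.
- case: (fdeg a) IHa => // m IHa; case: (fdeg b) IHb => // n IHb [<-].
  by rewrite dhomogM ?IHa ?IHb.
- by move=> /IHa; rewrite rpredN.
Qed.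

Definition fdhomog e d (h : fdeg e = Some d) : dhomog 4 K d := DHomog (fdegP h).

(** Binary integers, so that the evaluations are fast. *)
Definition zK (z : BinNums.Z) : K := (ssrZ.int_of_Z z)%:~R.

Definition zcol (x : 'I_4 -> BinNums.Z) : 'cV[K]_4 := \col_i zK (x i).

Lemma zK_eq0 z : (zK z == 0) = (z == 0).
Proof. by rewrite intr_eq0 -(inj_eq (can_inj ssrZ.int_of_ZK)) rmorph0. Qed.

Lemma fpoly_eval x e : (fpoly e).@[(zcol x)^~ 0] = zK (fval x e).
Proof.
rewrite /fpoly /zK !fval_morph; apply: eq_fval => i.
by rewrite /= mevalXU mxE.
Qed.

Lemma fder_eval x i e : ((fpoly e)^`M(i)).@[(zcol x)^~ 0] = zK (fder x i e).
Proof.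
rewrite fpoly_deriv /zK !fder_morph; apply: eq_fder => j.
by rewrite /= mevalXU mxE.
Qed.

Lemma fpoly_neq0 x e : fval x e != 0 :> BinNums.Z -> fpoly e != 0.
Proof.
by rewrite -zK_eq0 -fpoly_eval; apply: contraNneq => ->; rewrite raddf0.
Qed.

HB.instance Definition _ := GRing.RMorphism.copy zK (intr \o ssrZ.int_of_Z).

Definition ffrac d (a b : form) (ha : fdeg a = Some d) (hb : fdeg b = Some d)
    (b0 : fpoly b != 0) : ratfun K :=
  @RatFun K d (fdhomog ha) (fdhomog hb) b0.

Lemma jacobian_num_eval (r : ratfun K) a b x i :
  val (ratnum r) = fpoly a -> val (ratden r) = fpoly b ->
  (jacobian_num r i).@[(zcol x)^~ 0] = zK (fminor a b x i).
Proof.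
by move=> ea eb; rewrite /jacobian_num ea eb mevalB !mevalM !fder_eval !fpoly_eval rmorphB !rmorphM.
Qed.

(** Functional independence of invariants given by expressions is decided by the
    value of one minor of the Jacobian at one integer point. *)
Lemma functionally_independent_form k (r : 'I_k -> ratfun K) (a b : nat -> form)
    (f : 'I_k -> 'I_4) x :
  (forall j, val (ratnum (r j)) = fpoly (a j)) -> (forall j, val (ratden (r j)) = fpoly (b j)) ->
  (forall j : 'I_k, fval x (b j) != 0 :> BinNums.Z) ->
  \det (\matrix_(j < k, l < k) fminor (a j) (b j) x (f l)) != 0 :> BinNums.Z ->
  functionally_independent r.
Proof.
move=> ea eb b0 d0; apply: (@functionally_independent_at _ _ _ f (zcol x)) => [j|].
  by rewrite eb fpoly_eval zK_eq0.
rewrite -zK_eq0 -det_map_mx in d0; apply: contraNneq d0 => d0; rewrite -d0.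
by apply/eqP; congr (\det _); apply/matrixP => j l; rewrite !mxE (jacobian_num_eval _ _ (ea j) (eb j)).
Qed.

End FormPolynomials.

Definition point4 (a b c d : BinNums.Z) (i : 'I_4) : BinNums.Z := nth 0 [:: a; b; c; d] i.

(** * Nets of quadrics, desmic pencil and their symmetries *)

Local Notation x0 := (FVar o0).
Local Notation x1 := (FVar o1).
Local Notation x2 := (FVar o2).
Local Notation x3 := (FVar o3).

(** For [b = true] the net of quadrics through [E] and [P], for [b = false] the
    net through [E] and [Q]. *)
Definition net (b : bool) (i : 'I_3) : form :=
  let pm u := if b then u else FOpp u in
  nth x0 [:: x2 * x3 + pm (x0 * x1); x1 * x3 + pm (x0 * x2); x1 * x2 + pm (x0 * x3)]%F i.

(** The three desmic surfaces that split into planes; their sum is zero. *)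
Definition desmic (i : 'I_3) : form :=
  nth x0 [:: (x0 * x0 - x1 * x1) * (x2 * x2 - x3 * x3);
             (x0 * x0 - x2 * x2) * (x3 * x3 - x1 * x1);
             (x0 * x0 - x3 * x3) * (x1 * x1 - x2 * x2)]%F i.

(** A basis of the quadrics through the four coordinate points. *)
Definition edge_quadric (i : 'I_6) : form :=
  nth x0 [:: x0 * x1; x0 * x2; x0 * x3; x1 * x2; x1 * x3; x2 * x3]%F i.

Section Symmetries.

Variable K : numFieldType.
Local Notation M := {mpoly K[4]}.
Local Notation c3 := (cremona K).
Local Notation X := (xprod K).
Implicit Types (g h : 'M[K]_4) (s : 'cV[K]_4).

(** Naming half the value of the linear form avoids the fractions in the
    verifications below: the coordinates become integral combinations of
    [u] and of three of them. *)
Lemma reflection_half (e : K) : exists u : M,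
  e%:MP * 'X_o0 + 'X_o1 + 'X_o2 + 'X_o3 = u + u /\
  forall i, msub (reflection e) 'X_i = 'X_i - (mirror e i 0)%:MP * u.
Proof.
exists ((2^-1)%:MP * (e%:MP * 'X_o0 + 'X_o1 + 'X_o2 + 'X_o3)); split.
  rewrite -mulrDl -mpolyCD (_ : 2^-1 + 2^-1 = 1 :> K); last by field.
  by rewrite mpolyC1 mul1r.
by move=> i; rewrite msub_reflection mpolyCM; ring.
Qed.

Ltac form_ring := rewrite /fpoly /net /desmic /edge_quadric /= ?expr0 ?expr1 ?scale1r ?scaleN1r; ring.

Ltac sign_ring := first [exists false; form_ring | exists true; form_ring].

Ltac by_perm w :=
  exists w; apply: ord3P; rewrite !fpoly_msub /tperm !permE /= !msub_perm !permE /=; sign_ring.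

Ltac transposition :=
  first [by_perm (tperm bE bP) | by_perm (tperm bE bQ) | by_perm (tperm bP bQ)].

Lemma net_perm b (p : 'S_4) : signed_act (fun i => fpoly K (net b i)) (perm_mx p).
Proof.
by move: p; apply: signed_act_perm; case: b; apply: ord4P; apply: ord4P => // _; transposition.
Qed.

Lemma desmic_perm (p : 'S_4) : signed_act (fun i => fpoly K (desmic i)) (perm_mx p).
Proof.
by move: p; apply: signed_act_perm; apply: ord4P; apply: ord4P => // _; transposition.
Qed.

Lemma net_sign b s : s \in block K bQ -> signed_act (fun i => fpoly K (net b i)) (sign_mx s).
Proof.
move=> sQ; exists 1%g => i; rewrite perm1; move: i; rewrite !inE in sQ.
by case/or4P: sQ => /eqP ->; case: b; apply: ord3P; rewrite fpoly_msub /= !msub_sign !vec4E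
  ?scale1r ?scaleN1r; sign_ring.
Qed.

Lemma coord_sign_sqr b s i : b != bE -> s \in block K b ->
  msub (sign_mx s) 'X_i * msub (sign_mx s) 'X_i = 'X_i * 'X_i :> M.
Proof.
move=> nb /(block_sign nb)/(_ i) s2; rewrite msub_sign -scalerAl -scalerAr scalerA.
by rewrite -expr2 s2 scale1r.
Qed.

Lemma desmic_sign b s : b != bE -> s \in block K b ->
  signed_act (fun i => fpoly K (desmic i)) (sign_mx s).
Proof.
move=> nb sb; exists 1%g => i; exists false; rewrite perm1 expr0 scale1r fpoly_msub.
by move: i; apply: ord3P; rewrite /= !(coord_sign_sqr _ nb sb).
Qed.

Lemma net_reflection (b : bool) :
  signed_act (fun i => fpoly K (net b i)) (reflection (if b then 1 else -1)).
Proof.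
exists 1%g => i; exists false; rewrite perm1 expr0 scale1r fpoly_msub.
case: b; [have [u [eu eX]] := reflection_half 1 | have [u [eu eX]] := reflection_half (-1)].
  have e0 : 'X_o0 = u + u - 'X_o1 - 'X_o2 - 'X_o3 :> M.
    by rewrite -eu mpolyC1; ring.
  by move: i; apply: ord3P; rewrite /= !eX !vec4E mpolyC1 /fpoly /= !e0; ring.
have e0 : 'X_o0 = 'X_o1 + 'X_o2 + 'X_o3 - (u + u) :> M.
  by rewrite -eu mpolyCN mpolyC1; ring.
by move: i; apply: ord3P; rewrite /= !eX !vec4E mpolyCN mpolyC1 /fpoly /= !e0; ring.
Qed.

Lemma desmic_reflection (b : bool) :
  signed_act (fun i => fpoly K (desmic i)) (reflection (if b then 1 else -1)).
Proof.
exists 1%g => i; exists false; rewrite perm1 expr0 scale1r fpoly_msub.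
case: b; [have [u [eu eX]] := reflection_half 1 | have [u [eu eX]] := reflection_half (-1)].
  have e0 : 'X_o0 = u + u - 'X_o1 - 'X_o2 - 'X_o3 :> M.
    by rewrite -eu mpolyC1; ring.
  by move: i; apply: ord3P; rewrite /= !eX !vec4E mpolyC1 /fpoly /= !e0; ring.
have e0 : 'X_o0 = 'X_o1 + 'X_o2 + 'X_o3 - (u + u) :> M.
  by rewrite -eu mpolyCN mpolyC1; ring.
by move: i; apply: ord3P; rewrite /= !eX !vec4E mpolyCN mpolyC1 /fpoly /= !e0; ring.
Qed.

Lemma coord_signed b s (p : 'S_4) : b != bE -> s \in block K b ->
  signed_act (fun i => 'X_i : M) (sign_mx s *m perm_mx p).
Proof.
move=> nb sb; apply: signed_act_mul; last first.
  by exists p => i; exists false; rewrite expr0 scale1r msub_perm.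
exists 1%g => i; rewrite perm1 msub_sign; have /eqP := block_sign nb sb i.
by rewrite sqrf_eq1 => /orP[] /eqP ->; [exists false | exists true].
Qed.

(** * Action of the Cremona map *)

Lemma net_cremona b i :
  (fpoly K (net b i) \mPo c3) = X * ((-1) ^+ (~~ b) *: fpoly K (net b i)).
Proof.
by rewrite fpoly_comp xprodE; move: i; case: b; apply: ord3P; rewrite /= !cremonaE /fpoly /=
  ?expr0 ?expr1 ?scale1r ?scaleN1r; ring.
Qed.

Lemma desmic_cremona i :
  (fpoly K (desmic i) \mPo c3) = X ^+ 2 * ((-1) ^+ false *: fpoly K (desmic i)).
Proof.
by rewrite fpoly_comp xprodE; move: i; apply: ord3P; rewrite /= !cremonaE /fpoly /=
  expr0 scale1r; ring.
Qed.

Lemma edge_quadric_cremona i : exists j,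
  (fpoly K (edge_quadric i) \mPo c3) = X * fpoly K (edge_quadric j).
Proof.
exists (rev_ord i); rewrite fpoly_comp xprodE.
by case: i => [[|[|[|[|[|[|//]]]]]] lt_i]; rewrite /= !cremonaE /fpoly /=; ring.
Qed.

Lemma edge_quadric_signed h i : signed_act (fun i => 'X_i : M) h ->
  exists e j, msub h (fpoly K (edge_quadric i)) = e *: fpoly K (edge_quadric j).
Proof.
move=> [w ew]; have edge k l : k != l -> exists j, fpoly K (edge_quadric j) = 'X_k * 'X_l.
  have ed j : fpoly K (edge_quadric j) = fval (fun i => 'X_i) (edge_quadric j) by [].
  move: k l; apply: ord4P; apply: ord4P => // _;
  first [by exists (@Ordinal 6 0 isT); rewrite ed /=; ring
       | by exists (@Ordinal 6 1 isT); rewrite ed /=; ring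
       | by exists (@Ordinal 6 2 isT); rewrite ed /=; ring
       | by exists (@Ordinal 6 3 isT); rewrite ed /=; ring
       | by exists (@Ordinal 6 4 isT); rewrite ed /=; ring
       | by exists (@Ordinal 6 5 isT); rewrite ed /=; ring].
have act k l : k != l -> exists e j,
    msub h 'X_k * msub h 'X_l = e *: fpoly K (edge_quadric j).
  move=> neq; have [b ->] := ew k; have [b' ->] := ew l.
  have [|j ej] := edge (w k) (w l); first by rewrite (inj_eq perm_inj).
  by exists ((-1) ^+ b * (-1) ^+ b'), j; rewrite ej -scalerAl -scalerAr scalerA.
by rewrite fpoly_msub; case: i => [[|[|[|[|[|[|//]]]]]] lt_i] /=; apply: act.
Qed.

(** * Symmetric functions *)

Definition square_sum (f : 'I_3 -> form) : form :=
  (f bE * f bE + f bP * f bP + f bQ * f bQ)%F.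

Definition quartic_sum (f : 'I_3 -> form) : form :=
  ((f bE * f bE) * (f bE * f bE) + (f bP * f bP) * (f bP * f bP)
   + (f bQ * f bQ) * (f bQ * f bQ))%F.

Definition square_prod (f : 'I_3 -> form) : form :=
  ((f bE * f bE) * (f bP * f bP) * (f bQ * f bQ))%F.

Lemma big3 (T : Type) (idx : T) (op : Monoid.law idx) (F : 'I_3 -> T) :
  \big[op/idx]_i F i = op (op (F bE) (F bP)) (F bQ).
Proof.
rewrite !big_ord_recr big_ord0 /= Monoid.mul1m.
by do !congr (op _ _); congr F; apply/val_inj.
Qed.

Lemma symmetricE (f : 'I_3 -> form) :
  (fpoly K (square_sum f) = \sum_i fpoly K (f i) ^+ 2) *
  (fpoly K (quartic_sum f) = \sum_i (fpoly K (f i) ^+ 2) ^+ 2) *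
  (fpoly K (square_prod f) = \prod_i fpoly K (f i) ^+ 2).
Proof. by rewrite !big3. Qed.

Lemma symmetric_act (f : 'I_3 -> form) h : signed_act (fun i => fpoly K (f i)) h ->
  [/\ msub h (fpoly K (square_sum f)) = fpoly K (square_sum f),
      msub h (fpoly K (quartic_sum f)) = fpoly K (quartic_sum f) &
      msub h (fpoly K (square_prod f)) = fpoly K (square_prod f)].
Proof.
move=> [w ew]; have e2 i : msub h (fpoly K (f i)) ^+ 2 = fpoly K (f (w i)) ^+ 2.
  by have [b ->] := ew i; rewrite exprZn sqrr_sign scale1r.
rewrite !symmetricE !rmorph_sum rmorph_prod /=; split.
- rewrite [RHS](reindex_inj (@perm_inj _ w)); apply: eq_bigr => i _.
  by rewrite rmorphXn /= e2.
- rewrite [RHS](reindex_inj (@perm_inj _ w)); apply: eq_bigr => i _.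
  by rewrite !rmorphXn /= e2.
rewrite [RHS](reindex_inj (@perm_inj _ w)); apply: eq_bigr => i _.
by rewrite rmorphXn /= e2.
Qed.

Lemma symmetric_cremona (f : 'I_3 -> form) (u : M) (b : bool) :
  (forall i, (fpoly K (f i) \mPo c3) = u * ((-1) ^+ b *: fpoly K (f i))) ->
  [/\ (fpoly K (square_sum f) \mPo c3) = u ^+ 2 * fpoly K (square_sum f),
      (fpoly K (quartic_sum f) \mPo c3) = u ^+ 4 * fpoly K (quartic_sum f) &
      (fpoly K (square_prod f) \mPo c3) = u ^+ 6 * fpoly K (square_prod f)].
Proof.
move=> ef; have e2 i : (fpoly K (f i) \mPo c3) ^+ 2 = u ^+ 2 * fpoly K (f i) ^+ 2.
  by rewrite ef exprMn exprZn sqrr_sign scale1r.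
rewrite !symmetricE !rmorph_sum rmorph_prod /= !mulr_sumr; split.
- by apply: eq_bigr => i _; rewrite rmorphXn /= e2.
- by apply: eq_bigr => i _; rewrite !rmorphXn /= e2 exprMn -(exprM u).
by rewrite !big3 /= !rmorphXn /= !e2; ring.
Qed.

(** The elementary symmetric functions of the squares of the coordinates. *)
Definition elem1 : form := (x0 * x0 + x1 * x1 + x2 * x2 + x3 * x3)%F.
Definition elem2 : form := ((x0 * x0) * (x1 * x1) + (x0 * x0) * (x2 * x2)
  + (x0 * x0) * (x3 * x3) + (x1 * x1) * (x2 * x2) + (x1 * x1) * (x3 * x3)
  + (x2 * x2) * (x3 * x3))%F.
Definition elem3 : form := ((x0 * x0) * (x1 * x1) * (x2 * x2)
  + (x0 * x0) * (x1 * x1) * (x3 * x3) + (x0 * x0) * (x2 * x2) * (x3 * x3)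
  + (x1 * x1) * (x2 * x2) * (x3 * x3))%F.
Definition elem4 : form := ((x0 * x0) * (x1 * x1) * (x2 * x2) * (x3 * x3))%F.

Definition elem (e : nat) : form := nth x0 [:: elem1; elem2; elem3; elem4] e.

Lemma elem_act b s (p : 'S_4) e : b != bE -> s \in block K b -> (e < 4)%N ->
  msub (sign_mx s *m perm_mx p) (fpoly K (elem e)) = fpoly K (elem e).
Proof.
move=> nb sb e4; rewrite -msubM.
have -> : msub (sign_mx s) (fpoly K (elem e)) = fpoly K (elem e).
  have sq i := coord_sign_sqr i nb sb; rewrite fpoly_msub.
  by case: e e4 => [|[|[|[|//]]]] _; rewrite /= !sq.
pose P g := msub g (fpoly K (elem e)) = fpoly K (elem e).
move: p; apply: (@perm_mx_ind K P) => [|g h eg eh|]; first exact: msub1.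
  by rewrite /P -msubM eg eh.
by apply: ord4P; apply: ord4P => // _; rewrite /P {P} fpoly_msub; case: e e4 => [|[|[|[|//]]]] _;
  rewrite /= !msub_perm /tperm !permE /= /fpoly /=; ring.
Qed.

Lemma elem_cremona :
  [/\ (fpoly K elem1 \mPo c3) = fpoly K elem3,
      (fpoly K elem2 \mPo c3) = X ^+ 2 * fpoly K elem2,
      (fpoly K elem3 \mPo c3) = X ^+ 4 * fpoly K elem1 &
      (fpoly K elem4 \mPo c3) = X ^+ 6].
Proof. by split; rewrite fpoly_comp ?xprodE /= !cremonaE /fpoly /=; ring. Qed.

End Symmetries.

(** * Covariant systems and invariants of the three classes *)

Section Classes.

Variable K : numFieldType.
Local Notation M := {mpoly K[4]}.
Local Notation c3 := (cremona K).
Local Notation X := (xprod K).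
Implicit Types (g h : 'M[K]_4) (s : 'cV[K]_4) (t : 'S_3).

Lemma scaled_unit (c : K) h g : c != 0 -> g \in unitmx -> g = c *: h -> h \in unitmx.
Proof. by move=> c0 + eg; rewrite eg unitmxZ ?unitfE. Qed.

Lemma ord3_third (a b c d : 'I_3) : a != b -> c != a -> c != b -> d != a -> d != b -> c = d.
Proof.
move: a b c d; do 4!apply: ord3P => //.
Qed.

(** With three tetrahedra, exchanging two leaves no choice for the third. *)
Lemma swap_fixes t b d : t bE = b -> t b = bE -> d != bE -> d != b -> b != bE ->
  t d = d.
Proof.
move=> tE tb dE db nb; apply: (@ord3_third bE b) => //; first by rewrite eq_sym.
  by rewrite -tb (inj_eq perm_inj).
by rewrite -tE (inj_eq perm_inj).
Qed.

Definition partner (b : bool) : 'I_3 := if b then bP else bQ.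

(** As [g] exchanges [E] with the partner, it is a reflection times a signed
    permutation with signs in [Q]: these, and not the signs in [P], act on the
    net by signs. *)
Lemma moves_net (b : bool) g t : moves g t -> g \in unitmx ->
  t bE = partner b -> t (partner b) = bE ->
  exists (c : K) h, [/\ c != 0, h \in unitmx, g = c *: h & signed_act (fun i => fpoly K (net b i)) h].
Proof.
move=> gt ug tE td; have s1 := net_reflection K b.
have [m eg [c [s [p [c0 sb em]]]]] : exists2 m,
    g = reflection (if b then 1 else -1) *m m & monomial_form bQ m.
  have /eqP := tE; case: (moves_forms gt) => [[-> _]|[tE' [m eg hm]]|[tE' [m eg hm]]].
  - by case: (b).
  - rewrite tE'; case: b {s1} tE td => // tE td _; exists m => //.
    by rewrite (swap_fixes tE' td) ?tpermD in hm.
  rewrite tE'; case: b {s1} tE td => // tE td _; exists m => //.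
  by rewrite td tpermL in hm.
exists c, (reflection (if b then 1 else -1) *m (sign_mx s *m perm_mx p)).
have eg' : g = c *: (reflection (if b then 1 else -1) *m (sign_mx s *m perm_mx p)).
  by rewrite eg em -scalemxAr.
split=> //; first exact: scaled_unit eg'.
by apply: signed_act_mul s1 (signed_act_mul (net_sign b sb) (net_perm K b p)).
Qed.

(** Signs disappear in the squares, so that every element of the group permutes
    the split desmic surfaces. *)
Lemma moves_desmic g t : moves g t -> g \in unitmx ->
  exists (c : K) h, [/\ c != 0, h \in unitmx, g = c *: h & signed_act (fun i => fpoly K (desmic i)) h].
Proof.
move=> gt ug; have mono b s (p : 'S_4) : b != bE -> s \in block K b ->
    signed_act (fun i => fpoly K (desmic i)) (sign_mx s *m perm_mx p).
  by move=> nb sb; apply: signed_act_mul (desmic_sign nb sb) (desmic_perm K p).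
have tQE : t bQ != t bE by rewrite (inj_eq perm_inj).
have refl (b : bool) m d : g = reflection (if b then 1 else -1) *m m -> d != bE ->
    monomial_form d m -> exists (c : K) h, [/\ c != 0, h \in unitmx, g = c *: h &
      signed_act (fun i => fpoly K (desmic i)) h].
  move=> eg nd [c [s [p [c0 sb em]]]].
  exists c, (reflection (if b then 1 else -1) *m (sign_mx s *m perm_mx p)).
  have eg' : g = c *: (reflection (if b then 1 else -1) *m (sign_mx s *m perm_mx p)).
    by rewrite eg em -scalemxAr.
  split=> //; first exact: scaled_unit eg'.
  exact: signed_act_mul (desmic_reflection K b) (mono _ _ p nd sb).
case: (moves_forms gt) => [[tE [c [s [p [c0 sb eg]]]]]|[tE [m eg hm]]|[tE [m eg hm]]].
- exists c, (sign_mx s *m perm_mx p); split=> //; first exact: scaled_unit eg.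
  by apply: mono sb; rewrite -tE.
- apply: (refl true _ _ eg _ hm); rewrite tE in tQE.
  by apply: contraNneq tQE => e; rewrite -[t bQ](tpermK bE bP) e tpermL.
apply: (refl false _ _ eg _ hm); rewrite tE in tQE.
by apply: contraNneq tQE => e; rewrite -[t bQ](tpermK bE bQ) e tpermL.
Qed.

Lemma moves_fixed g t : moves g t -> g \in unitmx -> t bE = bE ->
  exists (c : K) b s (p : 'S_4), [/\ c != 0, b != bE, s \in block K b,
    sign_mx s *m perm_mx p \in unitmx & g = c *: (sign_mx s *m perm_mx p)].
Proof.
move=> gt ug tE; have [c [s [p [c0 sb eg]]]] := moves_monomial gt tE.
exists c, (t bQ), s, p; split=> //; first by rewrite -tE (inj_eq perm_inj).
exact: scaled_unit eg.
Qed.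

(** * Two swapped tetrahedra: the net of quadrics *)

Lemma net_deg b i : fdeg (net b i) = Some 2%N.
Proof. by move: i; case: b; apply: ord3P. Qed.

Definition net_system b : {vspace dhomog 4 K 2} :=
  span_system (fun i => fdhomog K (net_deg b i)).

Lemma net_system_dim b : \dim (net_system b) = 3%N.
Proof.
pose v (i : 'I_3) := zcol K (nth (point4 1 0 0 1) [:: point4 1 1 0 0; point4 1 0 1 0] i).
apply: (@span_system_dim _ _ _ _ v) => [i|i j]; rewrite [val _]/(fpoly K _) fpoly_eval.
  by rewrite zK_eq0; move: i; case: b; apply: ord3P; vm_compute.
by move=> neq; apply/eqP; rewrite zK_eq0; move: i j neq; case: b; apply: ord3P; apply: ord3P; vm_compute.
Qed.

Lemma net_covariant (o b : bool) g t : moves g t -> g \in unitmx ->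
  t bE = partner b -> t (partner b) = bE ->
  covariant (cremona_cubes_map o g) (net_system b).
Proof.
move=> gt ug tE td; have [c [h [c0 uh -> sh]]] := moves_net gt ug tE td.
apply: (@covariant_scaled K o h c 2 3 1) => // i; last first.
  by exists ((-1) ^+ (~~ b)), i; rewrite expr1; apply: net_cremona.
have [w ew] := signed_act_inv uh sh; have [e ee] := ew i.
by exists ((-1) ^+ e), (w i).
Qed.

Lemma square_sum_net_neq0 b : fpoly K (square_sum (net b)) != 0.
Proof. by apply: (@fpoly_neq0 K (point4 0 1 2 3)); case: b; vm_compute. Qed.

Lemma net_ratio1_deg b :
  (fdeg (quartic_sum (net b)) = Some 8%N) *
  (fdeg (square_sum (net b) * square_sum (net b))%F = Some 8%N).
Proof. by case: b. Qed.

Lemma net_ratio2_deg b :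
  (fdeg (square_prod (net b)) = Some 12%N) *
  (fdeg (square_sum (net b) * square_sum (net b) * square_sum (net b))%F = Some 12%N).
Proof. by case: b. Qed.

Lemma net_den1 b : fpoly K (square_sum (net b) * square_sum (net b))%F != 0.
Proof. by rewrite mulf_neq0 ?square_sum_net_neq0. Qed.

Lemma net_den2 b :
  fpoly K (square_sum (net b) * square_sum (net b) * square_sum (net b))%F != 0.
Proof. by rewrite !mulf_neq0 ?square_sum_net_neq0. Qed.

(** The power sum of degree 2 and the product of the squares of the three
    generators, divided by powers of the sum of these squares. *)
Definition net_invariants b (j : 'I_2) : ratfun K :=
  if val j == 0%N then ffrac (net_ratio1_deg b).1 (net_ratio1_deg b).2 (net_den1 b)
  else ffrac (net_ratio2_deg b).1 (net_ratio2_deg b).2 (net_den2 b).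

Lemma comp_mpoly_mul (p q : M) (F : rmap K) :
  (p * q \mPo F) = (p \mPo F) * (q \mPo F).
Proof. exact: rmorphM. Qed.

Lemma msub_mul h (p q : M) : msub h (p * q) = msub h p * msub h q.
Proof. exact: rmorphM. Qed.

(** Quotients of two such forms of the same degree and with the same [n] are
    invariant. *)
Definition cubes_inv h n (p : M) := msub h p = p /\ (p \mPo c3) = X ^+ n * p.

Lemma cubes_inv_mul h m n p q :
  cubes_inv h m p -> cubes_inv h n q -> cubes_inv h (m + n) (p * q).
Proof.
move=> [p1 p2] [q1 q2]; split; rewrite rmorphM /= ?p1 ?q1 // p2 q2 exprD.
by rewrite mulrACA.
Qed.

Lemma invariant_ffrac (o : bool) g h (c : K) k d n m (hn : fdeg n = Some d)
    (hm : fdeg m = Some d) (m0 : fpoly K m != 0) :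
  c != 0 -> h \in unitmx -> g = c *: h ->
  cubes_inv h k (fpoly K n) -> cubes_inv h k (fpoly K m) ->
  ratfun_invariant (cremona_cubes_map o g) (ffrac hn hm m0).
Proof.
move=> c0 uh -> [en cn] [em cm].
have ug : c *: h \in unitmx by rewrite unitmxZ ?unitfE.
apply: (@ratfun_invariant_cubes K o (c *: h) _ (c ^+ d) (X ^+ k)) => //.
- exact: expf_neq0.
- by rewrite expf_neq0 ?xprod_neq0.
- by rewrite (msub_scale _ _ (fdegP K hn)) en.
by rewrite (msub_scale _ _ (fdegP K hm)) em.
Qed.

Lemma net_invariants_invariant (o b : bool) g t j : moves g t -> g \in unitmx ->
  t bE = partner b -> t (partner b) = bE ->
  ratfun_invariant (cremona_cubes_map o g) (net_invariants b j).
Proof.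
move=> gt ug tE td; have [c [h [c0 uh eg sh]]] := moves_net gt ug tE td.
have [a1 a2 a3] := symmetric_act sh.
have [k1 k2 k3] := symmetric_cremona (net_cremona K b).
have i1 : cubes_inv h 2 (fpoly K (square_sum (net b))) by [].
rewrite /net_invariants; case: ifP => _.
  by apply: (@invariant_ffrac o g h c 4 _ _ _ _ _ _ c0 uh eg); last exact: (cubes_inv_mul i1 i1).
by apply: (@invariant_ffrac o g h c 6 _ _ _ _ _ _ c0 uh eg); last exact: (cubes_inv_mul (cubes_inv_mul i1 i1) i1).
Qed.

Lemma net_invariants_independent b : functionally_independent (net_invariants b).
Proof.
pose n (j : nat) := if j == 0%N then quartic_sum (net b) else square_prod (net b).
pose m (j : nat) := if j == 0%N then (square_sum (net b) * square_sum (net b))%F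
  else (square_sum (net b) * square_sum (net b) * square_sum (net b))%F.
pose f (j : nat) := nth o0 [:: o0; o1] j.
apply: (@functionally_independent_form _ _ _ n m f (point4 0 1 2 3)) => [j|j|j|].
- by rewrite /net_invariants /n; case: ifP.
- by rewrite /net_invariants /m; case: ifP.
- by case: j => [[|[|//]] lt_j]; rewrite /m; case: (b); vm_compute.
by rewrite det2 !mxE /n /m {n m}; case: b; vm_compute.
Qed.

(** * Coordinate tetrahedron fixed *)

Lemma edge_deg i : fdeg (edge_quadric i) = Some 2%N.
Proof. by case: i => [[|[|[|[|[|[|//]]]]]] lt_i]. Qed.

Definition edge_system : {vspace dhomog 4 K 2} :=
  span_system (fun i => fdhomog K (edge_deg i)).

Lemma edge_system_dim : \dim edge_system = 6%N.
Proof.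
pose v (i : 'I_6) := zcol K (nth (point4 0 0 1 1) [:: point4 1 1 0 0; point4 1 0 1 0;
  point4 1 0 0 1; point4 0 1 1 0; point4 0 1 0 1] i).
apply: (@span_system_dim _ _ _ _ v) => [i|i j]; rewrite [val _]/(fpoly K _) fpoly_eval.
  by rewrite zK_eq0; case: i => [[|[|[|[|[|[|//]]]]]] lt_i]; vm_compute.
move=> neq; apply/eqP; rewrite zK_eq0; case: i neq => [[|[|[|[|[|[|//]]]]]] lt_i];
  by case: j => [[|[|[|[|[|[|//]]]]]] lt_j]; vm_compute.
Qed.

Lemma edge_covariant (o : bool) g t : moves g t -> g \in unitmx -> t bE = bE ->
  covariant (cremona_cubes_map o g) edge_system.
Proof.
move=> gt ug tE; have [c [b [s [p [c0 nb sb uh ->]]]]] := moves_fixed gt ug tE.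
apply: (@covariant_scaled K o _ c 2 6 1) => // i.
  exact: edge_quadric_signed (signed_act_inv uh (coord_signed p nb sb)).
by have [j ej] := edge_quadric_cremona K i; exists 1, j; rewrite scale1r expr1.
Qed.

Lemma elem2_neq0 : fpoly K elem2 != 0.
Proof. by apply: (@fpoly_neq0 K (point4 1 1 1 1)); vm_compute. Qed.

Lemma edge_den1 : fpoly K (elem2 * elem2)%F != 0.
Proof. by rewrite mulf_neq0 ?elem2_neq0. Qed.

Lemma edge_den2 : fpoly K (elem2 * elem2 * elem2)%F != 0.
Proof. by rewrite !mulf_neq0 ?elem2_neq0. Qed.

(** Divided by the [edge_den] these are functions of the squares that do not
    change when all coordinates are inverted. *)
Definition edge_num (j : nat) : form :=
  nth (elem3 * elem3 + elem1 * elem1 * elem4)%F [:: elem4; elem1 * elem3]%F j.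

Definition edge_den (j : nat) : form :=
  nth (elem2 * elem2 * elem2)%F [:: elem2 * elem2; elem2 * elem2]%F j.

Definition edge_invariants (j : 'I_3) : ratfun K :=
  nth (@ffrac K 12 (edge_num 2) (edge_den 2) erefl erefl edge_den2)
    [:: @ffrac K 8 (edge_num 0) (edge_den 0) erefl erefl edge_den1;
        @ffrac K 8 (edge_num 1) (edge_den 1) erefl erefl edge_den1] j.

Lemma edge_invariants_invariant (o : bool) g t j : moves g t -> g \in unitmx -> t bE = bE ->
  ratfun_invariant (cremona_cubes_map o g) (edge_invariants j).
Proof.
move=> gt ug tE; have [c [b [s [p [c0 nb sb uh eg]]]]] := moves_fixed gt ug tE.
have act e : (e < 4)%N -> msub (sign_mx s *m perm_mx p) (fpoly K (elem e)) = fpoly K (elem e).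
  exact: elem_act nb sb.
have a1 := act 0 isT; have a2 := act 1 isT; have a3 := act 2 isT; have a4 := act 3 isT.
rewrite /elem /= in a1 a2 a3 a4; have [k1 k2 k3 k4] := elem_cremona K.
have e4 : fpoly K elem4 = X ^+ 2 by rewrite xprodE /fpoly /=; ring.
have i2 : cubes_inv (sign_mx s *m perm_mx p) 2 (fpoly K elem2) by [].
have i4 : cubes_inv (sign_mx s *m perm_mx p) 4 (fpoly K elem4).
  by split=> //; rewrite k4 e4 -exprD.
case: j => [[|[|[|//]]] lt_j].
- by apply: (@invariant_ffrac o g _ c 4 _ _ _ _ _ _ c0 uh eg i4); exact: (cubes_inv_mul i2 i2).
- apply: (@invariant_ffrac o g _ c 4 _ _ _ _ _ _ c0 uh eg); last exact: (cubes_inv_mul i2 i2).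
  have -> : fpoly K (edge_num 1) = fpoly K elem1 * fpoly K elem3 by [].
  split; first by rewrite msub_mul a1 a3.
  rewrite comp_mpoly_mul k1 k3.
  by move: (fpoly K elem1) (fpoly K elem3) => u v; ring.
apply: (@invariant_ffrac o g _ c 6 _ _ _ _ _ _ c0 uh eg); last exact: (cubes_inv_mul (cubes_inv_mul i2 i2) i2).
have -> : fpoly K (edge_num 2) =
  fpoly K elem3 * fpoly K elem3 + fpoly K elem1 * fpoly K elem1 * fpoly K elem4 by [].
move: (fpoly K elem1) (fpoly K elem3) (fpoly K elem4) e4 a1 a3 a4 k1 k3 k4 {i4}.
move=> u v w e4 a1 a3 a4 k1 k3 k4; split; first by rewrite raddfD /= !msub_mul a1 a3 a4.
by rewrite raddfD /= !comp_mpoly_mul k1 k3 k4 e4; ring.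
Qed.

Lemma edge_invariants_independent : functionally_independent edge_invariants.
Proof.
pose f (j : nat) := nth o0 [:: o0; o1; o2] j.
apply: (@functionally_independent_form _ _ _ edge_num edge_den f (point4 1 2 3 4)) => [j|j|j|].
- by case: j => [[|[|[|//]]] lt_j].
- by case: j => [[|[|[|//]]] lt_j].
- by case: j => [[|[|[|//]]] lt_j]; vm_compute.
by rewrite (det3 (a := fun i j => fminor (edge_num i) (edge_den i) (point4 1 2 3 4) (f j)))
  => [|i j]; [vm_compute | rewrite mxE].
Qed.

(** * Three tetrahedra permuted cyclically: the desmic pencil *)

Lemma desmic_deg i : fdeg (desmic i) = Some 4%N.
Proof. by move: i; apply: ord3P. Qed.

Definition desmicH i : dhomog 4 K 4 := fdhomog K (desmic_deg i).

Definition desmic_pencil : {vspace dhomog 4 K 4} := span_system desmicH.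

Lemma desmic_relation : desmicH bQ = - desmicH bE - desmicH bP.
Proof. by apply/val_inj; rewrite /= /fpoly /=; ring. Qed.

Lemma desmic_pencil2 : desmic_pencil = span_system (fun i : 'I_2 => desmicH (widen_ord (isT : (2 <= 3)%N) i)).
Proof.
have mem2 (i : 'I_2) : desmicH (widen_ord (isT : (2 <= 3)%N) i) \in
    span_system (fun i : 'I_2 => desmicH (widen_ord (isT : (2 <= 3)%N) i)).
  exact: (mem_span_system (fun i : 'I_2 => desmicH (widen_ord (isT : (2 <= 3)%N) i))).
apply/eqP; rewrite eqEsubv; apply/andP; split; apply/span_subvP => W /tnthP[i ->].
  have mE := mem2 ord0; have mP := mem2 (lift ord0 ord0).
  rewrite (_ : widen_ord _ _ = bE) in mE; last exact/val_inj.
  rewrite (_ : widen_ord _ _ = bP) in mP; last exact/val_inj.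
  rewrite tnth_mktuple; move: i; apply: ord3P => //.
  by rewrite desmic_relation rpredB ?rpredN.
by rewrite tnth_mktuple; apply: mem_span_system.
Qed.

Lemma desmic_pencil_dim : \dim desmic_pencil = 2%N.
Proof.
rewrite desmic_pencil2; pose v (i : 'I_2) := zcol K (nth (point4 0 0 1 1) [:: point4 0 1 0 1] i).
apply: (@span_system_dim _ _ _ _ v) => [i|i j]; rewrite [val _]/(fpoly K _) fpoly_eval.
  by rewrite zK_eq0; case: i => [[|[|//]] lt_i]; vm_compute.
by move=> neq; apply/eqP; rewrite zK_eq0; case: i neq => [[|[|//]] lt_i]; case: j => [[|[|//]] lt_j]; vm_compute.
Qed.

Lemma desmic_covariant (o : bool) g t : moves g t -> g \in unitmx ->
  covariant (cremona_cubes_map o g) desmic_pencil.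
Proof.
move=> gt ug; have [c [h [c0 uh -> sh]]] := moves_desmic gt ug.
apply: (@covariant_scaled K o h c 4 3 2) => // i; last first.
  by exists ((-1) ^+ false), i; apply: desmic_cremona.
have [w ew] := signed_act_inv uh sh; have [e ee] := ew i.
by exists ((-1) ^+ e), (w i).
Qed.

Lemma desmic_ratio_deg :
  (fdeg (square_sum desmic * square_sum desmic * square_sum desmic)%F = Some 24%N) *
  (fdeg (square_prod desmic) = Some 24%N).
Proof. by []. Qed.

Lemma desmic_den : fpoly K (square_prod desmic) != 0.
Proof. by apply: (@fpoly_neq0 K (point4 0 1 2 3)); vm_compute. Qed.

(** The group permutes the three split members of the pencil; this is, up to a
    constant factor, the j-invariant of the cross-ratio that they form with the
    member through a point. *)
Definition desmic_invariant : ratfun K :=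
  ffrac desmic_ratio_deg.1 desmic_ratio_deg.2 desmic_den.

Lemma desmic_invariant_invariant (o : bool) g t : moves g t -> g \in unitmx ->
  ratfun_invariant (cremona_cubes_map o g) desmic_invariant.
Proof.
move=> gt ug; have [c [h [c0 uh eg sh]]] := moves_desmic gt ug.
have [a1 a2 a3] := symmetric_act sh.
have [k1 k2 k3] := symmetric_cremona (desmic_cremona K).
have i1 : cubes_inv h 4 (fpoly K (square_sum desmic)).
  by split=> //; rewrite k1 -exprM.
apply: (@invariant_ffrac o g h c 12 _ _ _ _ _ _ c0 uh eg); first exact: (cubes_inv_mul (cubes_inv_mul i1 i1) i1).
by split=> //; rewrite k3 -exprM.
Qed.

Lemma desmic_invariant_nonconstant : nonconstant desmic_invariant.
Proof.
move=> [c /(congr1 val)].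
rewrite valZ (_ : val (ratnum _) = fpoly K (square_sum desmic * square_sum desmic * square_sum desmic)%F) //.
rewrite (_ : val (ratden _) = fpoly K (square_prod desmic)) //.
move=> /(congr1 (meval ((zcol K (point4 0 1 2 0))^~ 0))) /eqP; rewrite mevalZ !fpoly_eval.
rewrite (_ : fval _ (square_prod desmic) = 0) ?raddf0 ?mulr0 ?zK_eq0; last by vm_compute.
by apply/negP; vm_compute.
Qed.

End Classes.

(** * Quartics singular at the twelve points *)

Section DesmicSystem.

Variable K : numFieldType.
Local Notation M := {mpoly K[4]}.
Implicit Types (p : M) (v : 'cV[K]_4) (W : dhomog 4 K 4).

Definition zcoords (x : zpt) (i : 'I_4) : int := zcoord i x.

Lemma rpt_zcoords j i : rpt K j i 0 = (zcoords (zpoint j) i)%:~R.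
Proof. by case: i => i lt_i; rewrite /rpt zvecE. Qed.

Lemma form_eval_rpt e j : (fpoly K e).@[(rpt K j)^~ 0] = (fval (zcoords (zpoint j)) e)%:~R.
Proof.
rewrite /fpoly !fval_morph; apply: eq_fval => i.
by rewrite /= mevalXU rpt_zcoords.
Qed.

Lemma form_deriv_rpt e i j :
  ((fpoly K e)^`M(i)).@[(rpt K j)^~ 0] = (fder (zcoords (zpoint j)) i e)%:~R.
Proof.
rewrite fpoly_deriv !fder_morph; apply: eq_fder => k.
by rewrite /= mevalXU rpt_zcoords.
Qed.

Definition zsingular e j := (fval (zcoords (zpoint j)) e == 0) &&
  all (fun i => fder (zcoords (zpoint j)) i e == 0) [:: o0; o1; o2; o3].

Lemma desmic_singular i v : v \in coordR K -> singular_at (fpoly K (desmic i)) v.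
Proof.
move=> /coordRP[j ->]; have /andP[/eqP f0 /allP d0] : zsingular (desmic i) j.
  move: i; apply: ord3P; apply: (@all_pairs (fun _ j => zsingular _ j) j j); vm_compute => //.
split=> [|k]; first by rewrite form_eval_rpt f0.
by rewrite form_deriv_rpt (eqP (d0 k _)) //; move: k; apply: ord4P.
Qed.

Lemma desmic_pencil_singular W v : W \in desmic_pencil K -> v \in coordR K ->
  singular_at (val W) v.
Proof.
move=> WV vR; pose P (W : dhomog 4 K 4) := singular_at (val W) v.
apply: (@span_ind K _ _ (desmicH K) W P) WV => [|a x y [x0 dx] [y0 dy]|i].
- by split=> [|i]; rewrite [val _]/(0 : M) ?raddf0 //= ?mderiv0 ?raddf0.
- by split=> [|i]; rewrite valD valZ ?mderivD ?mderivZ mevalD mevalZ ?x0 ?y0 ?dx ?dy mulr0 addr0.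
exact: desmic_singular.
Qed.

(** Each term of the Euler derivation in one variable is weighted by its
    exponent in that variable. *)
Lemma coord_euler p v i : v i 0 * (p^`M(i)).@[v^~ 0] =
  \sum_(m <- msupp p) p@_m * (m i)%:R * \prod_j v j 0 ^+ m j.
Proof.
rewrite /mderiv raddf_sum mulr_sumr; apply: eq_bigr => m _ /=.
rewrite mevalZ mevalX; case: (posnP (m i)) => [->|mi]; first by rewrite !(mul0r, mulr0).
rewrite mulrCA (mulrC (m i)%:R) -!mulrA; congr (_ * (_ * _)).
rewrite (bigD1 i) //= [RHS](bigD1 i) //= mnmBE mnm1E eqxx mulrA -exprS subn1 prednK //.
congr (_ * _); apply: eq_bigr => j neq.
by rewrite mnmBE mnm1E eq_sym (negbTE neq) subn0.
Qed.

(** The exponents of the quartic monomials that have degree at most 2 in each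
    variable. *)
Definition exps : seq (seq nat) :=
  [seq s <- [seq a :: s | a <- iota 0 3, s <- [seq b :: s | b <- iota 0 3,
     s <- [seq [:: c; d] | c <- iota 0 3, d <- iota 0 3]]] | sumn s == 4%N].

Lemma exps_uniq : uniq exps.
Proof. by vm_compute. Qed.

Definition expm (s : seq nat) : 'X_{1..4} := [multinom nth 0%N s i | i < 4].

Lemma expmX s : 'X_[expm s] = 'X_o0 ^+ nth 0%N s 0 * 'X_o1 ^+ nth 0%N s 1 *
  'X_o2 ^+ nth 0%N s 2 * 'X_o3 ^+ nth 0%N s 3 :> M.
Proof. by rewrite mpolyXE_id big4 /= !mnmE. Qed.

Lemma expm_inj : {in exps &, injective expm}.
Proof.
move=> s s' sE s'E /mnmP e; have size4 u : u \in exps -> size u = 4%N.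
  have /allP h : all (fun u => size u == 4%N) exps by vm_compute.
  by move=> /h/eqP.
apply: (@eq_from_nth _ 0%N) => [|i]; rewrite !size4 // => i4.
by have := e (Ordinal i4); rewrite !mnmE.
Qed.

Lemma exps_cover (m : 'X_{1..4}) : mdeg m = 4%N -> (forall i, (m i <= 2)%N) ->
  m \in map expm exps.
Proof.
move=> dm m2; apply/mapP; exists [:: m o0; m o1; m o2; m o3].
  have : (m o0 + m o1 + m o2 + m o3 = 4)%N by have := dm; rewrite mdegE big4.
  move: (m2 o0) (m2 o1) (m2 o2) (m2 o3); move: (m o0) (m o1) (m o2) (m o3).
  by do 4!case=> [|[|[|//]]]; vm_compute.
by apply/mnmP; apply: ord4P; rewrite mnmE.
Qed.

Lemma meval_cvec d p i : p \is d.-homog -> p.@[(cvec K i)^~ 0] = p@_(U_(i) *+ d).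
Proof.
move=> /dhomogP hp; rewrite mevalE.
have prodE m : m \in msupp p -> \prod_j cvec K i j 0 ^+ m j = (m == (U_(i) *+ d)%MM)%:R.
  move=> /hp/= dm; case: eqP => [->|ne].
    apply: big1 => j _; rewrite mxE eqxx andbT mulmnE mnm1E eq_sym.
    by case: (i == j); rewrite ?expr1n ?mul0n ?expr0.
  have [j neq mj] : exists2 j, j != i & (0 < m j)%N.
    apply: contrapT => nj; apply: ne.
    have m0 j : j != i -> m j = 0%N.
      by move=> neq; apply/eqP; rewrite -leqn0 leqNgt; apply/negP => mj; apply: nj; exists j.
    apply/mnmP => j; rewrite mulmnE mnm1E; have [<-|neq] := eqVneq i j.
      by rewrite mul1n -dm mdegE (bigD1 i) //= big1 ?addn0.
    by rewrite mul0n m0 // eq_sym.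
  by rewrite (bigD1 j) //= mxE (negbTE neq) expr0n eqn0Ngt mj mul0r.
rewrite big_seq (eq_bigr _ (fun m mp => congr1 _ (prodE m mp))) -big_seq.
have [dp|dp] := boolP ((U_(i) *+ d)%MM \in msupp p); last first.
  rewrite memN_msupp_eq0 // big1_seq // => m /andP[_ mp]; case: eqP => [em|_]; last by rewrite mulr0.
  by rewrite -em mp in dp.
rewrite (bigD1_seq _ dp) ?msupp_uniq //= eqxx mulr1 big1 ?addr0 // => m /negbTE ->.
by rewrite mulr0.
Qed.

(** At a coordinate point the [j]-th derivative of a quartic reads off the
    coefficient of [x_i ^+ 3 * x_j]. *)
Lemma singular_exponents W : (forall v, v \in coordR K -> singular_at (val W) v) ->
  forall m, m \in msupp (val W) -> forall i, (m i <= 2)%N.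
Proof.
move=> sW m mW i; rewrite leqNgt; apply/negP => mi.
have dm : mdeg m = 4%N by apply: (dhomog_mf (dhomog_is_dhomog W)).
have iR : cvec K i \in coordR K by rewrite mem_cat cvec_blockE.
have le3 : (U_(i) *+ 3 <= m)%MM.
  apply/mnm_lepP => j; rewrite mulmnE mnm1E; case: eqP => [<-|_] //.
have : mdeg (m - U_(i) *+ 3) == 1%N.
  by rewrite -(eqn_add2r (mdeg (U_(i) *+ 3))) -mdegD submK // dm mdegMn mdeg1.
rewrite mdeg_eq1 => /existsP[j /eqP ej].
have [_ /(_ j)] := sW _ iR.
rewrite (meval_cvec i (mderiv_homog j (dhomog_is_dhomog W))) mcoeff_deriv -ej addmC submK //.
by move/eqP; rewrite mulrn_eq0 /= mcoeff_eq0 mW.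
Qed.

Lemma big_exps W (F : 'X_{1..4} -> K) : (forall m, m \in msupp (val W) -> forall i, (m i <= 2)%N) ->
  (forall m, (val W)@_m = 0 -> F m = 0) ->
  \sum_(m <- msupp (val W)) F m = \sum_(s <- exps) F (expm s).
Proof.
move=> W2 F0.
have pe : perm_eq (msupp (val W)) [seq m <- map expm exps | m \in msupp (val W)].
  apply: uniq_perm; first exact: msupp_uniq.
    by rewrite filter_uniq // map_inj_in_uniq //; apply: expm_inj.
  move=> m; rewrite mem_filter; case: (boolP (m \in msupp _)) => //= mW.
  by rewrite exps_cover //; [apply: (dhomog_mf (dhomog_is_dhomog W)) | apply: W2].
rewrite (perm_big _ pe) big_filter big_mkcond big_map; apply: eq_bigr => s _.
by case: ifP => // /negbT /memN_msupp_eq0/F0 ->.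
Qed.

Definition zmono (s : seq nat) (x : zpt) : int :=
  zcoord 0 x ^+ nth 0%N s 0 * zcoord 1 x ^+ nth 0%N s 1 *
  zcoord 2 x ^+ nth 0%N s 2 * zcoord 3 x ^+ nth 0%N s 3.

(** The points of [P] and [Q] have the indices from 4 to 11. *)
Definition chi (s s' : seq nat) : int :=
  foldr (fun k z => zmono s (zpoint k) * zmono s' (zpoint k) + z) 0 (iota 4 8).

Lemma sum_foldr (I : Type) (r : seq I) (F : I -> int) :
  foldr (fun k z => F k + z) 0 r = \sum_(k <- r) F k.
Proof. by elim: r => [|k r IH]; rewrite ?big_nil // big_cons -IH. Qed.

Lemma zmono_rpt s (j : 'I_12) : (zmono s (zpoint j))%:~R = \prod_i rpt K j i 0 ^+ expm s i.
Proof.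
by rewrite big4 /= !rpt_zcoords !mnmE /zmono !rmorphM !rmorphXn.
Qed.

(** The points of [P] and [Q] are the sign vectors up to a common sign.  Summing
    the Euler derivatives over them, weighted by the values of the monomial [s],
    only leaves the monomials with the parities of [s]. *)
Lemma singular_parity W (s : seq nat) (i : 'I_4) :
  (forall v, v \in coordR K -> singular_at (val W) v) ->
  \sum_(s' <- exps) (val W)@_(expm s') * ((nth 0%N s' i)%:R * (chi s s')%:~R) = 0.
Proof.
move=> sW; have W2 := singular_exponents sW.
have eq0 k : k \in iota 4 8 -> \sum_(s' <- exps)
    (val W)@_(expm s') * ((nth 0%N s' i)%:R * (zmono s (zpoint k) * zmono s' (zpoint k))%:~R) = 0.
  rewrite mem_iota => /andP[_ k12]; pose j : 'I_12 := Ordinal k12.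
  have [_ /(_ i) di] := sW _ (rpt_coordR K j).
  have := coord_euler (val W) (rpt K j) i; rewrite di mulr0 big_exps // => [e|m ->]; last first.
    by rewrite !mul0r.
  rewrite -[RHS](mulr0 (zmono s (zpoint k))%:~R) {2}e mulr_sumr; apply: eq_bigr => s' _.
  by rewrite rmorphM -(zmono_rpt s' j) mnmE /=; ring.
transitivity (\sum_(k <- iota 4 8) \sum_(s' <- exps) (val W)@_(expm s') *
    ((nth 0%N s' i)%:R * (zmono s (zpoint k) * zmono s' (zpoint k))%:~R)).
  rewrite exchange_big; apply: eq_bigr => s' _ /=.
  by rewrite /chi sum_foldr rmorph_sum !mulr_sumr.
by rewrite big_seq big1 // => k kI; apply: eq0.
Qed.

Definition even_exps : seq (seq nat) := [seq s <- exps | all (fun n => ~~ odd n) s].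

(** The sum for [s0] and [i] reduces to the single coefficient of [s0]. *)
Definition isolated s0 i := all (fun s => [|| s == s0, nth 0%N s i == 0%N | chi s0 s == 0]) exps
  && (nth 0%N s0 i != 0%N) && (chi s0 s0 != 0).

Lemma exps_isolated : all (fun s => all (fun n => ~~ odd n) s || has (isolated s) (iota 0 4)) exps.
Proof. by vm_compute. Qed.

Lemma odd_coeff0 W s : (forall v, v \in coordR K -> singular_at (val W) v) ->
  s \in exps -> ~~ all (fun n => ~~ odd n) s -> (val W)@_(expm s) = 0.
Proof.
move=> sW sE sodd; have /allP/(_ s sE) := exps_isolated; rewrite (negbTE sodd) orFb.
case/hasP=> i; rewrite mem_iota => i4 /andP[/andP[/allP iso si] cs].
have := singular_parity s (Ordinal (i4 : (i < 4)%N)) sW.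
rewrite (bigD1_seq s sE exps_uniq) /= big1_seq ?addr0.
  by move/eqP; rewrite !mulf_eq0 pnatr_eq0 intr_eq0 (negbTE si) (negbTE cs) !orbF => /eqP.
move=> s' /andP[neq s'E]; have := iso s' s'E; rewrite (negbTE neq) /=.
by case/orP=> /eqP ->; rewrite ?mul0r ?mulr0 // mulr0.
Qed.

(** A singular quartic is even in each variable. *)
Lemma sum_even_exps W (F : seq nat -> K) : (forall v, v \in coordR K -> singular_at (val W) v) ->
  \sum_(s <- exps) (val W)@_(expm s) * F s = \sum_(s <- even_exps) (val W)@_(expm s) * F s.
Proof.
move=> sW; rewrite (eq_big_seq (fun s => if all (fun n => ~~ odd n) s
    then (val W)@_(expm s) * F s else 0)) => [|s sE].
  by rewrite -big_mkcond /even_exps big_filter.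
by case: ifP => // /negbT sodd; rewrite odd_coeff0 ?mul0r.
Qed.

Lemma even_expsE : even_exps = [:: [:: 0; 0; 2; 2]; [:: 0; 2; 0; 2]; [:: 0; 2; 2; 0];
  [:: 2; 0; 0; 2]; [:: 2; 0; 2; 0]; [:: 2; 2; 0; 0]]%N.
Proof. by vm_compute. Qed.

Lemma singular_even_sum W (i : 'I_4) : (forall v, v \in coordR K -> singular_at (val W) v) ->
  \sum_(s <- even_exps | nth 0%N s i != 0%N) (val W)@_(expm s) = 0.
Proof.
move=> sW; have := singular_parity [:: 0; 0; 0; 0]%N i sW; rewrite sum_even_exps //.
have /allP ev : all (fun s => chi [:: 0; 0; 0; 0]%N s == 8) even_exps by vm_compute.
have /allP ev2 : all (fun s => all (fun k => (nth 0 s k == 0) || (nth 0 s k == 2))%N (iota 0 4))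
    even_exps by vm_compute.
rewrite (eq_big_seq (fun s => (if nth 0%N s i != 0%N then (val W)@_(expm s) else 0) * 16)).
  by rewrite -mulr_suml -big_mkcond => /eqP; rewrite mulf_eq0 pnatr_eq0 orbF => /eqP.
move=> s sE; rewrite (eqP (ev s sE)); have /allP/(_ (val i)) := ev2 s sE.
rewrite mem_iota ltn_ord => /(_ isT) /orP[] /eqP -> /=; first by rewrite !mul0r mulr0.
by rewrite -natrM.
Qed.

(** The four sums of three coefficients of [singular_even_sum], one for each
    variable, leave a two-dimensional space. *)
Lemma even_relations (a01 a02 a03 a12 a13 a23 : K) :
  a03 + (a02 + a01) = 0 -> a13 + (a12 + a01) = 0 -> a23 + (a12 + a02) = 0 ->
  a23 + (a13 + a03) = 0 ->
  [/\ a23 = a01, a13 = a02, a03 = - a02 - a01 & a12 = - a02 - a01].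
Proof.
move=> e0 e1 e2 e3; have n2 : 2 != 0 :> K by rewrite pnatr_eq0.
have dbl (x y : K) : 2 * x - 2 * y = 0 -> x = y.
  by move/eqP; rewrite subr_eq0 => /eqP/(mulfI n2).
have e23 : a23 = a01.
  apply: dbl; transitivity ((a23 + (a12 + a02)) + (a23 + (a13 + a03)) -
    (a03 + (a02 + a01)) - (a13 + (a12 + a01))); first by ring.
  by rewrite e0 e1 e2 e3; ring.
have e13 : a13 = a02.
  apply: dbl; transitivity ((a13 + (a12 + a01)) + (a23 + (a13 + a03)) -
    (a03 + (a02 + a01)) - (a23 + (a12 + a02))); first by ring.
  by rewrite e0 e1 e2 e3; ring.
split=> //; first by rewrite -[a03]subr0 -e0; ring.
by rewrite -[a12]subr0 -e2 e23; ring.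
Qed.

(** Only the six products of two squares remain, and the relations between their
    coefficients express the quartic by two of the split desmic surfaces. *)
Lemma desmic_of_singular W : (forall v, v \in coordR K -> singular_at (val W) v) ->
  W \in desmic_pencil K.
Proof.
move=> sW; pose a s := (val W)@_(expm s).
have ev i : \sum_(s <- even_exps | nth 0%N s (i : 'I_4) != 0%N) a s = 0 by apply: singular_even_sum.
have eW : val W = \sum_(s <- even_exps) a s *: 'X_[expm s] :> M.
  apply/mpolyP => m; rewrite {1}(mpolyE (val W)) !raddf_sum /=.
  have e (m' : 'X_{1..4}) : ((val W)@_m' *: 'X_[m'] : M)@_m = (val W)@_m' * (m' == m)%:R.
    by rewrite mcoeffZ mcoeffX.
  rewrite (eq_bigr _ (fun m' _ => e m')) (big_exps (singular_exponents sW)) => [|m' ->]; last first.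
    by rewrite mul0r.
  by rewrite (sum_even_exps (fun s => (expm s == m)%:R) sW); apply: eq_bigr => s _; rewrite -e.
clearbody a; rewrite even_expsE in ev eW.
have e0 := ev o0; have e1 := ev o1; have e2 := ev o2; have e3 := ev o3.
rewrite !big_cons !big_nil /= !addr0 in e0 e1 e2 e3.
have [e23 e13 e03 e12] := even_relations e0 e1 e2 e3.
set a02 := a [:: 2; 0; 2; 0]%N in e13 e03 e12; set a01 := a [:: 2; 2; 0; 0]%N in e23 e03 e12.
suff -> : W = a02 *: desmicH K bE - a01 *: desmicH K bP.
  by rewrite rpredB ?rpredZ ?(mem_span_system (desmicH K)).
apply/val_inj.
have -> : val (a02 *: desmicH K bE - a01 *: desmicH K bP) =
    a02%:MP * fpoly K (desmic bE) - a01%:MP * fpoly K (desmic bP).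
  by rewrite !mul_mpolyC.
rewrite eW !big_cons big_nil e23 e13 e12 e03.
have eX a b c d : 'X_[expm [:: a; b; c; d]] =
    'X_o0 ^+ a * 'X_o1 ^+ b * 'X_o2 ^+ c * 'X_o3 ^+ d :> M := expmX _.
have -> : fpoly K (desmic bE) =
    ('X_o0 * 'X_o0 - 'X_o1 * 'X_o1) * ('X_o2 * 'X_o2 - 'X_o3 * 'X_o3) by [].
have -> : fpoly K (desmic bP) =
    ('X_o0 * 'X_o0 - 'X_o2 * 'X_o2) * ('X_o3 * 'X_o3 - 'X_o1 * 'X_o1) by [].
rewrite !eX -!mul_mpolyC mpolyCB mpolyCN.
move: ('X_o0 : M) ('X_o1 : M) ('X_o2 : M) ('X_o3 : M) (a01%:MP : M) (a02%:MP : M).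
by move=> u0 u1 u2 u3 c c'; ring.
Qed.

Theorem desmic_pencil_system : desmic_system (desmic_pencil K).
Proof.
move=> W; split=> [WV v|]; last exact: desmic_of_singular.
exact: desmic_pencil_singular.
Qed.

End DesmicSystem.

(** * Contracted planes and exceptional divisors *)

Section Confinement.

Variable K : numFieldType.
Local Notation M := {mpoly K[4]}.
Local Notation c3 := (cremona K).
Local Notation X := (xprod K).
Implicit Types (p q u : M) (F G : rmap K) (g h : 'M[K]_4) (v w : 'cV[K]_4) (l : 'rV[K]_4).
Implicit Types (S : set 'cV[K]_4).

Lemma base_inj N a b c d : (a < N)%N -> (c < N)%N -> (a + N * b = c + N * d)%N -> a = c /\ b = d.
Proof.
move=> aN cN e; have N0 : (0 < N)%N by apply: leq_ltn_trans aN.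
have := congr1 (modn^~ N) e; rewrite /= !(addnC _ (N * _)%N) !(mulnC N) !modnMDl !modn_small //.
move=> ac; split=> //; move: e; rewrite ac => /addnI/eqP.
by rewrite eqn_pmul2l // => /eqP.
Qed.

(** Kronecker substitution: reading exponents as digits turns [p] into a
    polynomial in one variable with the same coefficients. *)
Lemma meval_eq0 p : (forall v, p.@[v^~ 0] = 0) -> p = 0.
Proof.
move=> p0; pose N := msize p.
pose code (m : 'X_{1..4}) := (m o0 + N * (m o1 + N * (m o2 + N * (m o3 + N * 0))))%N.
pose P : {poly K} := \sum_(m <- msupp p) p@_m *: 'X^(code m).
have root0 (x : K) : P.[x] = 0.
  rewrite -[RHS](p0 (\col_i x ^+ (N ^ i))) mevalE horner_sum.
  apply: eq_bigr => m _; rewrite hornerZ hornerXn big4 !mxE -!exprM /= -!exprD; congr (_ * _ ^+ _).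
  by rewrite /code /= !expnS expn0; ring.
have P0 : P = 0.
  apply: (@roots_geq_poly_eq0 _ _ [seq n%:R | n <- iota 0 (size P)]).
  - by apply/allP => x _; apply/eqP/root0.
  - by rewrite map_inj_uniq ?iota_uniq //; apply: mulrIn; apply: oner_neq0.
  by rewrite size_map size_iota.
have digit m i : m \in msupp p -> (m i < N)%N.
  by move=> /msize_mdeg_lt; apply: leq_ltn_trans; rewrite mdegE (bigD1 i) //= leq_addr.
apply/mpolyP => m; rewrite mcoeff0; have [mp|/memN_msupp_eq0 //] := boolP (m \in msupp p).
have := congr1 (fun r : {poly K} => r`_(code m)) P0; rewrite coef0 coef_sum => e.
rewrite -[RHS]e (bigD1_seq m) ?msupp_uniq //= coefZ coefXn eqxx mulr1 big1_seq ?addr0 // => m'.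
case/andP=> neq m'p; rewrite coefZ coefXn; case: eqP => [|_]; last by rewrite mulr0.
case/base_inj => [||e0 /base_inj[||e1 /base_inj[||e2 /base_inj[||e3 _]]]]; try exact: digit.
by case/eqP: neq; apply/mnmP; apply: ord4P.
Qed.

(** * Vanishing on a plane *)

Definition plane_form l : M := \sum_i l 0 i *: 'X_i.

(** The projection onto the plane [l] along the [i]-th coordinate direction. *)
Definition plane_proj l (i : 'I_4) : 'M[K]_4 := 1%:M - (l 0 i)^-1 *: (cvec K i *m l).

Lemma plane_projK l i : l 0 i != 0 -> l *m plane_proj l i = 0.
Proof.
move=> li; rewrite mulmxBr mulmx1 -scalemxAr mulmxA.
have -> : l *m cvec K i = (l 0 i)%:M.
  by rewrite -colE; apply/matrixP => a b; rewrite !ord1 !mxE eqxx.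
by rewrite mul_scalar_mx scalerA mulVf // scale1r subrr.
Qed.

(** The projection changes each coordinate by a multiple of the equation of the
    plane. *)
Lemma plane_form_dvd l i p : l 0 i != 0 ->
  msub (plane_proj l i) p = 0 -> mdvd (plane_form l) p.
Proof.
move=> li p0; rewrite -[p]subr0 -p0 -{1}[p]comp_mpoly_id; apply: comp_mpoly_congr => k.
exists ((l 0 i)^-1 * (k == i)%:R)%:MP.
rewrite -[[tuple _ | _ < _]]/(rmap_id K) -[rmap_id K]linear1 !tnth_linear -sumrB mulrC mul_mpolyC scaler_sumr.
apply: eq_bigr => j _; rewrite scalerA -scalerBl; congr (_ *: _).
by rewrite !mxE big_ord1 !mxE eqxx andbT; ring.
Qed.

Lemma plane_proj_coord l i k : l 0 i != 0 -> (exists2 j, j != k & l 0 j != 0) ->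
  msub (plane_proj l i) 'X_k != 0.
Proof.
move=> li [j neq lj]; apply/eqP => /(plane_form_dvd li)[u eu].
pose v := l 0 k *: cvec K j - l 0 j *: cvec K k.
have := congr1 (meval (v^~ 0)) eu.
rewrite mevalM mevalXU /plane_form raddf_sum /= (eq_bigr (fun a => l 0 a * v a 0)) => [|a _].
  have -> : \sum_a l 0 a * v a 0 = (l *m v) 0 0 by rewrite mxE.
  rewrite mulmxBr -!scalemxAr -!colE !mxE !eqxx eq_sym (negbTE neq).
  by rewrite [l 0 k * l 0 j]mulrC subrr mul0r mulr0 mulr1 sub0r => /eqP; rewrite oppr_eq0 (negbTE lj).
by rewrite mevalZ mevalXU.
Qed.

(** The hypothesis on [l] says that it is no coordinate plane: then the Cremona
    map is defined at the general point of the plane, and the form vanishes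
    after composition with the projection. *)
Lemma vanishing_plane_image l p : (forall k, exists2 j, j != k & l 0 j != 0) ->
  (forall w, plane_image c3 l w -> p.@[w^~ 0] = 0) -> mdvd (plane_form l) (p \mPo c3).
Proof.
move=> l2 p0; have [i _ li] := l2 o0; apply: (plane_form_dvd li).
have ck : msub (plane_proj l i) (tnth c3 o0) != 0.
  rewrite tnth_cremona rmorph_prod; apply/prodf_neq0 => k _.
  exact: plane_proj_coord.
apply: (mulIf ck); rewrite mul0r; apply: meval_eq0 => v.
rewrite mevalM (meval_msub _ (p \mPo c3)) (meval_msub _ (tnth c3 o0)) (meval_comp p c3); set w := _ *m v.
have [cw|cw] := eqVneq (rmap_eval c3 w) 0.
  by have := congr1 (fun u : 'cV[K]_4 => u o0 0) cw; rewrite !mxE => ->; rewrite mulr0.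
by rewrite p0 ?mul0r //; split=> //; exists w; rewrite // mulmxA plane_projK // mul0mx.
Qed.

(** * Planes contracted by the Cremona transformation *)

Section Contracted.

Variable l : 'rV[K]_4.
Let support := [pred i | l 0 i != 0].

(** The equation of the image of the plane: what is left of the composite of its
    equation with [c_3] after removal of the coordinate factors. *)
Definition strict_transform : M :=
  \sum_(i in support) l 0 i *: \prod_(k in support | k != i) 'X_k.

Lemma plane_form_cremona :
  plane_form l \mPo c3 = \prod_(k | l 0 k == 0) 'X_k * strict_transform.
Proof.
rewrite raddf_sum mulr_sumr [RHS]big_mkcond; apply: eq_bigr => i _ /=.
rewrite inE comp_mpolyZ; have [->|li] := eqVneq (l 0 i) 0; first by rewrite scale0r.
rewrite comp_mpolyXt tnth_cremona -scalerAr; congr (_ *: _).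
rewrite (bigID support) /= mulrC; congr (_ * _); apply: eq_bigl => k.
  by rewrite negbK; case: (eqVneq k i) => [->|]; rewrite ?(negbTE li) ?andbT.
by rewrite andbC inE.
Qed.

Lemma strict_transform_kill k : k \in support ->
  strict_transform \mPo xkill K k = l 0 k *: \prod_(j in support | j != k) 'X_j.
Proof.
move=> lk; rewrite raddf_sum (bigD1 k) //= [X in _ + X]big1 ?addr0 => [|i /andP[li neq]].
  rewrite comp_mpolyZ rmorph_prod; congr (_ *: _); apply: eq_bigr => j /andP[_ /negbTE neq].
  by rewrite /= comp_mpolyXt tnth_mktuple neq.
rewrite comp_mpolyZ rmorph_prod (bigD1 k) /=; last by rewrite lk eq_sym.
by rewrite comp_mpolyXt tnth_mktuple eqxx mul0r scaler0.
Qed.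

Hypothesis l2 : forall k, exists2 j, j != k & l 0 j != 0.

Lemma strict_transform_ndvd k : ~ mdvd 'X_k strict_transform.
Proof.
have nz j : j \in support -> strict_transform \mPo xkill K j != 0.
  move=> lj; rewrite strict_transform_kill // scaler_eq0 negb_or; apply/andP; split=> //.
  by apply/prodf_neq0 => i _; apply: coord_neq0.
move/coord_dvdP/eqP; apply/negP.
have [lk|lk] := boolP (k \in support); first exact: nz.
have [j _ lj] := l2 k; have := nz j lj; apply: contraNneq => f0.
suff <- : strict_transform \mPo xkill K k = strict_transform by rewrite f0 raddf0.
rewrite raddf_sum; apply: eq_bigr => i li; rewrite /= comp_mpolyZ rmorph_prod; congr (_ *: _).
apply: eq_bigr => a /andP[la _]; rewrite /= comp_mpolyXt tnth_mktuple ifN //.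
by apply: contraNneq lk => <-.
Qed.

(** Composing once more with [c_3] returns [p] up to a power of the coordinates,
    and these do not divide the strict transform. *)
Lemma strict_transform_dvd d p : p \is d.-homog -> mdvd (plane_form l) (p \mPo c3) ->
  mdvd strict_transform p.
Proof.
move=> hp [u eu]; have := comp_cremonaK hp; rewrite eu rmorphM /= plane_form_cremona => e.
set r := _ * _ in e.
have : mdvd (X ^+ (2 * d)) (\prod_(k | l 0 k == 0) 'X_k * (u \mPo c3)).
  apply: xprod_dvd => k; apply: (coord_gauss (@strict_transform_ndvd k)).
  have [w ew] : mdvd ('X_k ^+ (2 * d)) (X ^+ (2 * d) * p).
    by exists (tnth c3 k ^+ (2 * d) * p); rewrite -(cremona_coord K k) exprMn mulrA.
  by exists w; rewrite -ew -e /r; ring.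
case=> w ew; exists w; apply: (@mulfI _ (X ^+ (2 * d))); first by rewrite expf_neq0 ?xprod_neq0.
by rewrite -e /r mulrCA -ew; ring.
Qed.

(** Two forms vanishing on the image have the strict transform as a common factor;
    it is no constant, since it vanishes at the origin. *)
Lemma cremona_image_big : ~ small (plane_image c3 l).
Proof.
case=> d [e [p [q [cpq pq0]]]].
have [c fc] : exists c : K, strict_transform = c%:MP.
  apply: cpq => r; rewrite !inE => /orP[] /eqP ->.
    have [|u ->] := @strict_transform_dvd d (val p) (dhomog_is_dhomog p).
      by apply: vanishing_plane_image => // w /pq0[].
    by exists u; rewrite mulrC.
  have [|u ->] := @strict_transform_dvd e (val q) (dhomog_is_dhomog q).
    by apply: vanishing_plane_image => // w /pq0[].
  by exists u; rewrite mulrC.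
have : strict_transform.@[(0 : 'cV[K]_4)^~ 0] = 0.
  rewrite raddf_sum big1 // => i li; have [j neq lj] := l2 i.
  rewrite /= mevalZ rmorph_prod (bigD1 j) /=; last by rewrite inE lj.
  by rewrite mevalXU mxE mul0r mulr0.
rewrite fc mevalC => c0; apply: (@strict_transform_ndvd o0).
by rewrite fc c0 mpolyC0; exists 0; rewrite mulr0.
Qed.

End Contracted.

Lemma contracted_plane l : l != 0 -> small (plane_image c3 l) ->
  exists i, forall v, l *m v = 0 -> v i 0 = 0.
Proof.
move=> l0 sl; have [k lk] : exists k, forall j, j != k -> l 0 j = 0.
  apply: contrapT => nk; apply: (@cremona_image_big l) sl => k.
  apply: contrapT => nj; apply: nk; exists k => j neq; apply/eqP.
  by apply: contraT => lj; case: nj; exists j.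
have lkn : l 0 k != 0.
  apply: contraNneq l0 => lk0; apply/eqP/matrixP => a j; rewrite ord1 mxE.
  by have [->|/lk] := eqVneq j k.
exists k => v /matrixP/(_ 0 0)/eqP; rewrite !mxE (bigD1 k) //= big1 ?addr0 => [|j /lk ->].
  by rewrite mulf_eq0 (negbTE lkn) => /eqP.
by rewrite mul0r.
Qed.

End Confinement.

Section LateConfinement.

Variable K : numFieldType.
Local Notation M := {mpoly K[4]}.
Local Notation c3 := (cremona K).
Local Notation X := (xprod K).
Implicit Types (p q u : M) (F G : rmap K) (g h : 'M[K]_4) (v w m : 'cV[K]_4) (l : 'rV[K]_4).
Implicit Types (i j : 'I_4) (S : set 'cV[K]_4).

Lemma unit_mulmx_eq0 g v : g \in unitmx -> (g *m v == 0) = (v == 0).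
Proof.
move=> ug; apply/eqP/eqP => [e|->]; last exact: mulmx0.
by rewrite -[v](mulKmx ug) e mulmx0.
Qed.

(** Smallness is a projective notion. *)
Lemma small_preimage g S S' : g \in unitmx -> (forall v, S v -> S' (g *m v)) ->
  small S' -> small S.
Proof.
move=> ug SS' [d [e [p [q [cpq S'0]]]]].
exists d, e, (DHomog (msub_homog g (dhomog_is_dhomog p))), (DHomog (msub_homog g (dhomog_is_dhomog q))).
split=> [r hr|v /SS'/S'0[pv qv]]; last by rewrite /= !meval_msub.
have ui : invmx g \in unitmx by rewrite unitmx_inv.
have [c ec] : exists c : K, msub (invmx g) r = c%:MP.
  apply: cpq => a; rewrite !inE => aE; have [|b eb] := hr (msub g a).
    by rewrite !inE; case/orP: aE => /eqP ->; rewrite eqxx ?orbT.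
  by exists (msub (invmx g) b); rewrite -rmorphM /= -eb msubK.
by exists c; rewrite -[r](msubKV ug) ec /msub comp_mpolyC.
Qed.

(** * The exceptional divisor over a coordinate point *)

(** The plane quadratic transformation by which [c_3] maps the exceptional
    divisor over the [j]-th coordinate point to the opposite face. *)
Definition quadratic_cremona j : rmap K :=
  [tuple if i == j then 0 else \prod_(k | (k != i) && (k != j)) 'X_k | i < 4].

Lemma quadratic_cremonaK j i : tnth (quadratic_cremona j) i \mPo quadratic_cremona j =
  \prod_(k | k != j) 'X_k * (tnth (xkill K j) i).
Proof.
have E a b : tnth (quadratic_cremona a) b =
    (if b == a then 0 else \prod_k (if (k != b) && (k != a) then 'X_k else 1)).
  by rewrite tnth_mktuple -big_mkcond.
have [->|neq] := eqVneq i j.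
  by rewrite [X in X \mPo _]E tnth_mktuple eqxx raddf0 mulr0.
rewrite [X in X \mPo _]tnth_mktuple (negbTE neq) rmorph_prod.
rewrite [LHS](eq_bigr (fun k => tnth (quadratic_cremona j) k)) => [|k _]; last first.
  exact: comp_mpolyXt.
rewrite tnth_mktuple (negbTE neq) [LHS]big_mkcond [X in X * _]big_mkcond !big4 !E !big4.
move: j i neq; apply: ord4P; apply: ord4P => //= _; ring.
Qed.

Lemma quadratic_cremona_kernel d p j : p \is d.-homog ->
  (p \mPo quadratic_cremona j = 0) -> mdvd 'X_j p.
Proof.
move=> hp p0; apply/coord_dvdP.
have := congr1 (fun r => r \mPo quadratic_cremona j) p0; rewrite /= raddf0 comp_mpolyA.
have Y0 : \prod_(k | k != j) 'X_k != 0 :> M by apply/prodf_neq0 => k _; apply: coord_neq0.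
rewrite (comp_mpoly_scale (u := \prod_(k | k != j) 'X_k) (F := xkill K j) hp) => [/eqP|i].
  by rewrite mulf_eq0 expf_eq0 (negbTE Y0) andbF => /eqP.
by rewrite tnth_comp quadratic_cremonaK.
Qed.

(** The lowest term at a coordinate point has order 2, except in the component
    of that coordinate. *)
Lemma along_cremona (a : K) j w i : along c3 (a *: cvec K j) w i =
  'X^2 * ((if i == j then 'X else a%:P + w j 0 *: 'X) *
           \prod_(k | (k != i) && (k != j)) (w k 0)%:P).
Proof.
rewrite /along tnth_cremona rmorph_prod /=.
rewrite (eq_bigr (fun k => (a * (k == j)%:R)%:P + w k 0 *: 'X)) => [|k _]; last first.
  by rewrite mmapX mmap1U !mxE eqxx andbT.
rewrite [LHS]big_mkcond [\prod_(k | _ && _) _]big_mkcond !big4 /=.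
move: i j; apply: ord4P; apply: ord4P => /=;
  rewrite !(mulr0, mulr1, mul1r, polyC0, add0r) -?mul_polyC. all: ring.
Qed.

Lemma quadratic_cremona_eval j v i :
  (rmap_eval (quadratic_cremona j) v) i 0 = 
  if i == j then 0 else \prod_(k | (k != i) && (k != j)) v k 0.
Proof.
rewrite mxE tnth_mktuple; case: ifP => _; first exact: raddf0.
by rewrite rmorph_prod; apply: eq_bigr => k _; rewrite /= mevalXU.
Qed.

Lemma exceptional_cremona (a : K) j w :
  rmap_eval (quadratic_cremona j) w != 0 -> a != 0 ->
  exceptional_image c3 (a *: cvec K j) (a *: rmap_eval (quadratic_cremona j) w).
Proof.
move=> q0 a0; split; first by rewrite scaler_eq0 negb_or a0.
exists 2%N; split=> [w' i k k2|]; first by rewrite along_cremona coefXnM k2.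
exists w; apply/matrixP => i i0; rewrite ord1 [RHS]mxE along_cremona coefXnM ltnn subnn.
rewrite [LHS]mxE quadratic_cremona_eval -horner_coef0 hornerM horner_prod.
case: eqP => _; first by rewrite mulr0 hornerX mul0r.
rewrite hornerD hornerZ hornerX mulr0 addr0 hornerC; congr (_ * _).
by apply: eq_bigr => k _; rewrite hornerC.
Qed.

(** The quadratic transformation is birational, so that a form vanishing on its
    image is a multiple of [x_j]; two such forms have [x_j] in common. *)
Lemma exceptional_big (a : K) j : a != 0 -> ~ small (exceptional_image c3 (a *: cvec K j)).
Proof.
move=> a0 [d [e [p [q [cpq pq0]]]]]; pose Q := quadratic_cremona j.
have [i neq] : exists i, i != j.
  by exists (lift j ord0); rewrite eq_sym neq_lift.
have Qi : tnth Q i != 0.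
  by rewrite tnth_mktuple (negbTE neq); apply/prodf_neq0 => k _; apply: coord_neq0.
have dvd d' (r : dhomog 4 K d') : (forall v, exceptional_image c3 (a *: cvec K j) v ->
    (val r).@[v^~ 0] = 0) -> mdvd 'X_j (val r).
  move=> r0; apply: (quadratic_cremona_kernel (dhomog_is_dhomog r)).
  apply: (mulIf Qi); rewrite mul0r; apply: meval_eq0 => v.
  rewrite mevalM (meval_comp (val r) Q).
  have [Qv|/exceptional_cremona/(_ a0)/r0] := eqVneq (rmap_eval Q v) 0.
    by have := congr1 (fun u : 'cV[K]_4 => u i 0) Qv; rewrite !mxE => ->; rewrite mulr0.
  rewrite (meval_scale _ _ (dhomog_is_dhomog r)) => /eqP.
  by rewrite mulf_eq0 expf_eq0 (negbTE a0) andbF => /eqP ->; rewrite mul0r.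
have [|c /coord_nonconstant //] := cpq 'X_j.
move=> r; rewrite !inE => /orP[] /eqP ->.
  by have [|u ->] := dvd d p; [move=> v /pq0[] | exists u; rewrite mulrC].
by have [|u ->] := dvd e q; [move=> v /pq0[] | exists u; rewrite mulrC].
Qed.

(** * Confinement for the twelve-point orbit *)

Lemma eval_cremona_sign (b : 'I_3) v : b != bE -> v \in block K b ->
  exists2 c : K, c != 0 & rmap_eval c3 v = c *: v.
Proof.
move=> nb /(block_sign nb) sv; exists (\prod_i v i 0).
  by apply/prodf_neq0 => i _; apply: sign_vec_neq0.
apply/matrixP => i i0; rewrite ord1 !mxE tnth_cremona rmorph_prod [X in _ = X * _](bigD1 i) //= mulrAC -expr2 sv.
by rewrite mul1r; apply: eq_bigr => k _; rewrite /= mevalXU.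
Qed.

Lemma eval_cremona_scale (c : K) v : rmap_eval c3 (c *: v) = c ^+ 3 *: rmap_eval c3 v.
Proof. by apply/matrixP => i j; rewrite !mxE (meval_scale _ _ (cremona_homog K i)). Qed.

Lemma eval_cremona_coord (i : 'I_4) v : v i 0 = 0 ->
  rmap_eval c3 v = (rmap_eval c3 v) i 0 *: cvec K i.
Proof.
move=> vi; apply/matrixP => k k0; rewrite ord1 [RHS]mxE [X in _ * X]mxE eqxx andbT.
have [->|neq] := eqVneq k i; first by rewrite mulr1.
rewrite mulr0 mxE tnth_cremona rmorph_prod (bigD1 i) /=; last by rewrite eq_sym.
by rewrite mevalXU vi mul0r.
Qed.

Lemma eval_cremona_cvec i : rmap_eval c3 (cvec K i) = 0.
Proof.
apply/matrixP => k k0; rewrite ord1 !mxE tnth_cremona rmorph_prod.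
have [j /andP[jk ji]] : exists j, (j != k) && (j != i).
  move: k i; apply: ord4P; apply: ord4P;
    by [exists o0 | exists o1 | exists o2 | exists o3].
by rewrite (bigD1 j) //= mevalXU mxE (negbTE ji) mul0r.
Qed.

Lemma eval_comp F G v : rmap_eval (rmap_comp F G) v = rmap_eval F (rmap_eval G v).
Proof. by apply/matrixP => i j; rewrite !mxE tnth_comp meval_comp. Qed.

Lemma cubes_eval s g v : rmap_eval (cremona_cubes_map s g) v =
  if s then g *m rmap_eval c3 v else rmap_eval c3 (g *m v).
Proof. by case: s; rewrite eval_comp linear_eval. Qed.

Lemma along_linear_comp g F m w i :
  along (rmap_comp (linear_rmap g) F) m w i = \sum_k g i k *: along F m w k.
Proof.
rewrite /along; have -> : tnth (rmap_comp (linear_rmap g) F) i = \sum_k g i k *: tnth F k.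
  rewrite tnth_comp tnth_linear raddf_sum; apply: eq_bigr => k _.
  by rewrite /= comp_mpolyZ comp_mpolyXt.
by rewrite raddf_sum; apply: eq_bigr => k _; rewrite /= mmapZ mul_polyC.
Qed.

Lemma along_comp_linear g F m w i :
  along (rmap_comp F (linear_rmap g)) m w i = along F (g *m m) (g *m w) i.
Proof.
rewrite /along tnth_comp comp_mpolyE [LHS]raddf_sum; apply: eq_bigr => a _ /=.
rewrite mmapZ rmorph_prod; congr (_ * _); apply: eq_bigr => k _ /=.
rewrite rmorphXn; congr (_ ^+ _); rewrite tnth_linear raddf_sum.
rewrite !mxE raddf_sum scaler_suml -big_split; apply: eq_bigr => j _ /=.
by rewrite mmapZ mmapX mmap1U -!mul_polyC !polyCM; ring.
Qed.

Lemma cubes_contracted s g l : g \in unitmx -> small (plane_image (cremona_cubes_map s g) l) ->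
  small (plane_image c3 (if s then l else l *m invmx g)).
Proof.
move=> ug; case: s => sl.
  apply: (small_preimage ug) sl => v [v0 [w lw ev]].
  split; first by rewrite unit_mulmx_eq0.
  by exists w; rewrite // cubes_eval ev.
apply: (small_preimage (unitmx1 K 4)) sl => v [v0 [w lw ev]]; rewrite mul1mx; split=> //.
by exists (invmx g *m w); rewrite ?mulmxA // cubes_eval /= mulKVmx.
Qed.

Lemma cubes_exceptional_big s g (a : K) j m : g \in unitmx -> a != 0 ->
  (if s then m else g *m m) = a *: cvec K j ->
  ~ small (exceptional_image (cremona_cubes_map s g) m).
Proof.
move=> ug a0 em sm; apply: (@exceptional_big a j a0); rewrite -em {em}; case: s sm => sm.
  apply: (small_preimage ug) sm => v [v0 [mu [low [w ev]]]]; split.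
    by rewrite unit_mulmx_eq0.
  exists mu; split=> [w' i k /low kl|].
    rewrite along_linear_comp coef_sum big1 // => b _; by rewrite coefZ kl mulr0.
  exists w; apply/matrixP => i i0; rewrite ev !mxE along_linear_comp coef_sum.
  by apply: eq_bigr => b _; rewrite !mxE coefZ.
apply: (small_preimage (unitmx1 K 4)) sm => v [v0 [mu [low [w ev]]]]; rewrite mul1mx; split=> //.
exists mu; split=> [w' i k /low kl|]; first by rewrite along_comp_linear kl.
exists (invmx g *m w); apply/matrixP => i i0.
by rewrite ev !mxE along_comp_linear mulKVmx.
Qed.

(** A contracted plane goes to a coordinate point for [c_3 o g], and to the image
    of one under [g] for [g o c_3].  Since [c_3] fixes the points of [P] and [Q],
    the chain follows the orbit of the coordinate point under [g], until it meets
    the coordinate points again. *)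
Lemma confined_cubes s g (t : 'S_3) : g \in unitmx -> moves g t ->
  t bE != bE -> t (t bE) != bE -> t (t (t bE)) = bE ->
  confined_in 3 (cremona_cubes_map s g).
Proof.
move=> ug gt t1 t2 t3 l l0 sl.
have [i hi] : exists i, forall v, (if s then l else l *m invmx g) *m v = 0 -> v i 0 = 0.
  apply: contracted_plane (cubes_contracted ug sl); case: s {sl} => //.
  by apply: contraNneq l0 => e; rewrite -[l](mulmxKV ug) e mul0mx.
pose e k := iter k (mulmx g) (cvec K i).
have eb k : exists c v, [/\ c != 0, v \in block K (iter k t bE) & e k = c *: v].
  elim: k => [|k [c [v [c0 vb ev]]]].
    by exists 1, (cvec K i); rewrite scale1r cvec_blockE oner_neq0.
  have [c' [v' [c'0 v'b ev']]] := gt _ _ vb.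
  by exists (c * c'), v'; rewrite mulf_neq0 //= -scalerA -ev' scalemxAr -ev.
have e0 k : e k != 0.
  by have [c [v [c0 /block_neq0 v0 ->]]] := eb k; rewrite scaler_eq0 negb_or c0.
have fixe k : iter k t bE != bE -> exists2 c : K, c != 0 & rmap_eval c3 (e k) = c *: e k.
  move=> nb; have [c [v [c0 vb ->]]] := eb k; have [c' c'0 ec'] := eval_cremona_sign nb vb.
  exists (c ^+ 2 * c'); first by rewrite mulf_neq0 ?expf_neq0.
  by rewrite eval_cremona_scale ec' !scalerA; congr (_ *: _); ring.
have [a [w [a0 /blockE_cvec[j ->] e3]]] : exists c v, [/\ c != 0, v \in block K bE & e 3%N = c *: v].
  by have := eb 3%N; rewrite /= t3.
(* the chain starts at [g e_i] for [g o c_3] and at [e_i] for [c_3 o g] *)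
exists (fun k => e (if s then k else k.-1)); split=> [k _|u [u0 [v lv eu]]|k k3||].
- exact: e0.
- rewrite eu cubes_eval in u0 *; case: s hi u0 {sl e3 eu} => hi u0.
    have ev := eval_cremona_coord (hi v lv); rewrite ev in u0 *.
    rewrite -scalemxAr pt_scale //; apply: contraNneq u0 => ->.
    by rewrite scale0r mulmx0.
  have ev : (g *m v) i 0 = 0 by apply: hi; rewrite -mulmxA mulKmx.
  rewrite (eval_cremona_coord ev) in u0 *; rewrite pt_scale //.
  by apply: contraNneq u0 => ->; rewrite scale0r.
- rewrite cubes_eval.
  have [c c0 ec] : exists2 c : K, c != 0 & rmap_eval c3 (e k) = c *: e k.
    by apply: fixe; case: k k3 => [|[|[|]]].
  case: s {hi sl}; last by case: k k3 ec => // k _ ec; rewrite -[g *m _]/(e k.+1) ec pt_scale.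
  by rewrite ec -scalemxAr pt_scale.
- rewrite cubes_eval; case: s {hi sl}; rewrite -?[g *m e _]/(e 3%N) e3.
    by rewrite eval_cremona_scale eval_cremona_cvec scaler0 mulmx0.
  by rewrite eval_cremona_scale eval_cremona_cvec scaler0.
by apply: (cubes_exceptional_big (a := a) (j := j)) => //; rewrite -e3; case: s {hi sl}.
Qed.

Theorem late_confinement_cubes s g (t : 'S_3) : g \in unitmx -> moves g t ->
  t bE != bE -> t (t bE) != bE -> t (t (t bE)) = bE ->
  late_confinement (cremona_cubes_map s g).
Proof.
move=> ug gt t1 t2 t3; have cF := cubes_map_coprime s ug.
exists 3%N, (cremona_cubes_map s g); split=> //; last exact: confined_cubes gt _ _ _.
have nF : exists i, tnth (cremona_cubes_map s g) i != 0.
  apply: contrapT => F0; have [_ /(_ 'X_o0)[|c /coord_nonconstant //]] := cF.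
  move=> p /tnthP[i ->]; exists 0; rewrite mul0r; apply/eqP.
  by apply: contraT => ni; case: F0; exists i.
by split=> // i j; rewrite mulrC.
Qed.

End LateConfinement.

(** * The three orbit lengths *)

(** When the orbit of [E] consists of two tetrahedra, this tells whether the other
    one is [P] or [Q]; the choice of the net, and of its invariants, is thus made
    from the orbit alone. *)
Definition meets_P (K : fieldType) (O : set {vspace 'cV[K]_4}) : bool :=
  `[< O (pt (vec4 1 (-1) (-1) (-1))) >].

Lemma meets_P_partner (K : numFieldType) (g : 'M[K]_4) (t : 'S_3) :
  g \in unitmx -> moves g t -> moves (invmx g) (t^-1)%g -> t bE != bE -> t (t bE) = bE ->
  t bE = partner (meets_P (coord_orbit g)).
Proof.
move=> ug gt gti t1 t2; rewrite /meets_P (orbit_swap ug gt gti t2).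
have pP : vec4 1 (-1) (-1) (-1) \in block K bP by rewrite inE eqxx.
have [tP|tQ] : t bE = bP \/ t bE = bQ.
- by move: (t bE) t1; apply: ord3P; auto.
- rewrite tP /partner asboolT //; exists bP; first by rewrite !inE eqxx.
  by exists (vec4 1 (-1) (-1) (-1)).
rewrite tQ /partner asboolF // => -[b bA [v vb e]].
have [c c0 ev] := pt_eq (block_neq0 vb) e.
by move: bA; rewrite (blocks_disjoint c0 vb pP ev).
Qed.

Section Cases.

Local Open Scope card_scope.

Variables (R : realType) (g : 'M[R[i]]_4) (t : 'S_3) (s : bool).
Hypotheses (ug : g \in unitmx) (gt : moves g t) (gti : moves (invmx g) (t^-1)%g).
Let Phi := cremona_cubes_map s g.
Let O := coord_orbit g.

Lemma orbit8_case : t bE != bE -> t (t bE) = bE ->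
  [/\ integrable_entropy R (deg_seq Phi),
      grows_like (deg_seq Phi) (fun n => n%:R ^+ 2 : R),
      exists V : {vspace dhomog 4 R[i] 2}, \dim V = 3%N /\ covariant Phi V &
      functionally_independent (net_invariants R[i] (meets_P O)) /\
      forall j, ratfun_invariant Phi (net_invariants R[i] (meets_P O) j)].
Proof.
move=> t1 t2; have tE := meets_P_partner ug gt gti t1 t2.
have [|e gr] := @growth_quadratic R (deg_seq Phi).
  by move=> n; rewrite (deg_seq_degrees _ _ ug gt); case: (degrees_swapped n t1 t2).
split=> //.
  exists (net_system R[i] (meets_P O)); split; first exact: net_system_dim.
  by apply: (net_covariant _ gt ug tE); rewrite -tE.
split=> [|j]; first exact: net_invariants_independent.
by apply: (net_invariants_invariant _ _ gt ug tE); rewrite -tE.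
Qed.

Lemma orbit4_case : t bE = bE ->
  [/\ periodic_seq (deg_seq Phi),
      forall n, deg_seq Phi n = 1%N \/ deg_seq Phi n = 3%N,
      exists V : {vspace dhomog 4 R[i] 2}, \dim V = 6%N /\ covariant Phi V &
      exists r : 'I_3 -> ratfun R[i],
        functionally_independent r /\ forall j, ratfun_invariant Phi (r j)].
Proof.
move=> tE; have degE n : deg_seq Phi n = if odd n then 3%N else 1%N.
  by rewrite (deg_seq_degrees _ _ ug gt); case: (degrees_fixed n tE).
split.
- by exists 2%N; first exact: isT; move=> n; rewrite !degE oddD addbF.
- by move=> n; rewrite degE; case: (odd n); [right | left].
- exists (edge_system R[i]); split; first exact: edge_system_dim.
  exact: edge_covariant gt ug tE.
exists (edge_invariants R[i]); split=> [|j]; first exact: edge_invariants_independent.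
exact: edge_invariants_invariant gt ug tE.
Qed.

Lemma orbit12_case : t bE != bE -> t (t bE) != bE -> t (t (t bE)) = bE ->
  [/\ nonintegrable_entropy R (deg_seq Phi),
      grows_like (deg_seq Phi) (fun n => golden R ^+ (2 * n)),
      late_confinement Phi,
      exists V : {vspace dhomog 4 R[i] 4},
        [/\ desmic_system V, \dim V = 2%N & covariant Phi V] &
      exists r : ratfun R[i], nonconstant r /\ ratfun_invariant Phi r].
Proof.
move=> t1 t2 t3; have [|e gr] := @growth_golden R (deg_seq Phi).
  by move=> n; rewrite (deg_seq_degrees _ _ ug gt); apply: degrees_cyclic.
split=> //.
- exact: late_confinement_cubes gt t1 t2 t3.
- exists (desmic_pencil R[i]); split; first exact: desmic_pencil_system.
    exact: desmic_pencil_dim.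
  exact: desmic_covariant gt ug.
exists (desmic_invariant R[i]); split; first exact: desmic_invariant_nonconstant.
exact: desmic_invariant_invariant gt ug.
Qed.

End Cases.

Local Open Scope classical_set_scope.
Local Open Scope ring_scope.
Local Open Scope card_scope.
Local Open Scope complex_scope.

Theorem theorem1p8 (R : realType) :
  exists J : bool -> set {vspace 'cV[R[i]]_4} ->
      ({vspace 'cV[R[i]]_4} -> {vspace 'cV[R[i]]_4}) -> 'I_2 -> ratfun R[i],
  forall g : 'M[R[i]]_4, cremona_cubes g ->
  [\/ coord_orbit g #= `I_4, coord_orbit g #= `I_8 | coord_orbit g #= `I_12] /\
  forall (s : bool) (Phi : rmap R[i]), Phi = cremona_cubes_map s g ->
  [/\ coord_orbit g #= `I_8 ->
        [/\ integrable_entropy R (deg_seq Phi),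
            grows_like (deg_seq Phi) (fun n => n%:R ^+ 2 : R),
            exists V : {vspace dhomog 4 R[i] 2},
              \dim V = 3%N /\ covariant Phi V &
            functionally_independent (J s (coord_orbit g) (residual_action g)) /\
            forall j, ratfun_invariant Phi (J s (coord_orbit g) (residual_action g) j)],
      coord_orbit g #= `I_4 ->
        [/\ periodic_seq (deg_seq Phi),
            forall n, deg_seq Phi n = 1%N \/ deg_seq Phi n = 3%N,
            exists V : {vspace dhomog 4 R[i] 2},
              \dim V = 6%N /\ covariant Phi V &
            exists r : 'I_3 -> ratfun R[i],
              functionally_independent r /\ forall j, ratfun_invariant Phi (r j)] &
      coord_orbit g #= `I_12 ->
        [/\ nonintegrable_entropy R (deg_seq Phi),
            grows_like (deg_seq Phi) (fun n => golden R ^+ (2 * n)),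
            late_confinement Phi,
            exists V : {vspace dhomog 4 R[i] 4},
              [/\ desmic_system V, \dim V = 2%N & covariant Phi V] &
            exists r : ratfun R[i], nonconstant r /\ ratfun_invariant Phi r]].
Proof.
exists (fun _ O _ => net_invariants R[i] (meets_P O)) => g cg; have ug := cg.1.
have [t [gt gti]] := cubes_moves cg; have cardO := orbit_card ug gt gti.
have card_inj m n : coord_orbit g #= `I_m -> coord_orbit g #= `I_n -> m = n.
  by move=> gm gn; apply/card_eq_II; rewrite -(card_eql gm).
split; first by case: cardO => [[_]|[_ _]|[_ _ _]]; [constructor 1|constructor 2|constructor 3].
move=> s _ ->; split=> gn; case: cardO => [[t1 gm]|[t1 t2 gm]|[t1 t2 t3 gm]];
  try by have := card_inj _ _ gn gm.
- exact: orbit8_case ug gt gti t1 t2.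
- exact: orbit4_case ug gt t1.
exact: orbit12_case ug gt t1 t2 t3.
Qed.
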